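(* Consider the nonholonomic ODE in coordinates $$\dot\xi=(\nabla_\xi\psi)^{-1}(\xi)\,h(\psi(\xi)),\qquad \xi\in\mathbb{R}^{2n-m},$$ with $\psi$, $h$ as in the context, whose right-hand side is real analytic. Any $p$-th order discretization $\xi_{k+1}=\Phi(\epsilon,\xi_k)$ of this ODE (in the sense of the context) can be viewed as the time-$\epsilon$ map of a suitable $\epsilon$-periodic non-autonomous perturbation of the form $$\dot\xi(t)=(\nabla_\xi\psi)^{-1}(\xi(t))\,h(\psi(\xi(t)))+\epsilon^p\,g(\epsilon,t/\epsilon,\xi(t)).$$ Precisely: there exist $\epsilon_0>0$, a continuous non-increasing function $\rho:[0,\epsilon_0]\to[0,\infty]$ with $\rho(0)=\infty$, and a vector field $g=g(\epsilon,\tau,\xi)\in\mathbb{R}^{2n-m}$, defined for all real $\tau$, $0\le\epsilon\le\epsilon_0$ and real $\xi$ with $|\xi|<\rho(\epsilon)$, such that on this domain: $g$ is $C^\infty$ in all variables, and $g$ and all its $\tau$-derivatives are analytic in $(\epsilon,\xi)$; $g$ has period $1$ in $\tau$; and, if $G(t,s,\epsilon,\cdot)$ denotes the evolution map from time $s$ to time $t$ of the perturbed ODE, then $G(\epsilon,0,\epsilon,\xi)=\Phi(\epsilon,\xi)$.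
   Context: Repeated indices are summed. $Q=\mathbb{R}^n$, $TQ\simeq\mathbb{R}^{2n}$ with coordinates $(q^i,v^i)$. $L:TQ\to\mathbb{R}$ is a Lagrangian whose matrix $(m_{ij})=(\partial^2L/\partial v^i\partial v^j)$ depends only on $q$ and is regular and positive definite, with inverse $(m^{ij})$. $\mu^\alpha=\mu^\alpha_i(q)dq^i$, $\alpha=1,\dots,m$, are pointwise linearly independent one-forms, and $D=\{(q,v)\in\mathbb{R}^{2n}:\mu^\alpha_i(q)v^i=0,\ \alpha=1,\dots,m\}$, a submanifold of dimension $2n-m$. The nonholonomic vector field $h$ on $D$ (tangent to $D$) is, for $x=(q,v)\in D$, $h(x)=(h_q^i,h_v^i)$ with $h_q^i=v^i$ and $h_v^i=f_v^i+\lambda_\alpha(x)m^{ij}\mu^\alpha_j(q)$, where $f_v^i=-m^{ik}\frac{\partial^2L}{\partial q^j\partial v^k}v^j+m^{ij}\frac{\partial L}{\partial q^j}$, $\lambda_\alpha(x)=-C_{\alpha\beta}\left(\frac{\partial\mu^\beta_i}{\partial q^j}v^iv^j+\mu^\beta_if_v^i\right)$, and $(C_{\alpha\beta})$ is the inverse of $(C^{\alpha\beta})=(\mu^\alpha_im^{ij}\mu^\beta_j)$. $\psi:\mathbb{R}^{2n-m}\to D\subset\mathbb{R}^{2n}$ is a coordinate map for $D$, $x=\psi(\xi)$, with Jacobian $\nabla_\xi\psi$ of full rank, and $(\nabla_\xi\psi)^{-1}$ denotes a left inverse of $\nabla_\xi\psi$ (the paper's choice: $\xi=(q^i,v^a)$,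 $a=1,\dots,n-m$, $\psi(q,v^a)=(q^i,v^a,-A^\alpha_a(q)v^a)$, with $(\nabla_\xi\psi)^{-1}$ the projection onto the $(q^i,v^a)$ components). A $p$-th order discretization ($p\ge1$) of an ODE $\dot z=\tilde f(z)$, $z\in\mathbb{R}^N$, $\tilde f$ real analytic, with local flow $F(t,z)$, is a map $\Phi(\epsilon,z)$, $|\epsilon|\le\epsilon^0$, which is a diffeomorphism with respect to $z$ and real analytic in $\epsilon$ and $z$, and for which there is a continuous increasing function $C:[0,\infty)\to[0,\infty)$ with $|\Phi(\epsilon,z)-F(\epsilon,z)|\le C(|z|)\epsilon^{p+1}$ for all $\epsilon,z$ for which the left-hand side is defined. *)

(* Defs.v *)
From HB Require Import structures.
From mathcomp Require Export all_boot all_order all_algebra.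
From mathcomp Require Export all_classical all_reals all_analysis.

Set Implicit Arguments.
Unset Strict Implicit.
Unset Printing Implicit Defensive.

Export Order.TTheory GRing.Theory Num.Theory.
Export numFieldNormedType.Exports.

Local Open Scope classical_set_scope.
Local Open Scope ring_scope.

(* R^d is 'rV[R]_d, as for the library's [jacobian]; [`|x|] is the library's
   norm on it, i.e. the maximum norm. *)

Section Regularity.
Context {R : realType}.

Definition partial d (V : normedModType R) (i : 'I_d)
    (f : 'rV[R]_d -> V) (x : 'rV[R]_d) : V :=
  'D_(delta_mx 0 i) f x.

(* C^k on an open set U: all iterated partial derivatives up to order k exist
   and are continuous on U. *)
Fixpoint Ck d (V : normedModType R) (k : nat) (U : set 'rV[R]_d)
    (f : 'rV[R]_d -> V) : Prop :=
  {in U, continuous f} /\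
  (if k is k'.+1 then
     forall i : 'I_d,
       (forall x, U x -> derivable f x (delta_mx 0 i)) /\
       Ck k' U (partial i f)
   else True).

(* C^oo on a set S that need not be open: near each of its points, f agrees
   on S with a C^oo function defined on an open neighbourhood. *)
Definition smooth_on d (V : normedModType R) (S : set 'rV[R]_d)
    (f : 'rV[R]_d -> V) : Prop :=
  forall x, S x -> exists (U : set 'rV[R]_d) (F : 'rV[R]_d -> V),
    [/\ open U, U x, (forall k, Ck k U F) &
        forall y, U y -> S y -> f y = F y].

(* Real analyticity on a set S that need not be open: around each x in S there
   is a power series in d variables (coefficients c indexed by multi-indices),
   absolutely convergent on the polydisc of radius r, whose sum is f on the
   points of S in that polydisc.  As the convergence is absolute, the order of
   summation is immaterial; the partial sums below run over the multi-indices
   with all components < k. *)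
Definition analytic_on d (V : normedModType R) (S : set 'rV[R]_d)
    (f : 'rV[R]_d -> V) : Prop :=
  forall x, S x -> exists (c : {ffun 'I_d -> nat} -> V) (r : R),
    [/\ 0 < r,
        summable [set: {ffun 'I_d -> nat}]
          (fun a => (`|c a| * r ^+ (\sum_i a i)%N)%:E) &
        forall h : 'rV[R]_d, `|h| < r -> S (x + h) ->
          (fun k : nat => \sum_(a : {ffun 'I_d -> 'I_k})
             (\prod_i h 0 i ^+ a i) *: c [ffun i => nat_of_ord (a i)])
            @ \oo --> f (x + h)].

(* (e, x) |-> f e x as a function of the single variable (e, x) in R^(1+d). *)
Definition joint d (V : Type) (f : R -> 'rV[R]_d -> V)
    (z : 'rV[R]_(1 + d)) : V :=
  f (lsubmx z 0 0) (rsubmx z).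

Definition diffeo_onto_image d (f : 'rV[R]_d -> 'rV[R]_d) : Prop :=
  [/\ forall k, Ck k setT f, open (range f) &
      exists2 f' : 'rV[R]_d -> 'rV[R]_d,
        (forall k, Ck k (range f) f') & cancel f f'].

End Regularity.

Section Evolution.
Context {R : realType}.

(* Some solution of x' = v t x on the closed interval between s and t, staying
   in Om, goes from x0 at time s to x1 at time t.  It is the graph of the
   (partially defined) evolution map from time s to time t, where t < s is
   allowed. *)
Definition evolves d (v : R -> 'rV[R]_d -> 'rV[R]_d) (Om : set 'rV[R]_d)
    (s t : R) (x0 x1 : 'rV[R]_d) : Prop :=
  exists x : R -> 'rV[R]_d,
    [/\ x s = x0, x t = x1,
        {within `[Num.min s t, Num.max s t], continuous x},
        (forall u, u \in `]Num.min s t, Num.max s t[ ->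
           is_derive u 1 x (v u (x u))) &
        forall u, u \in `[Num.min s t, Num.max s t] -> Om (x u)].

(* p-th order discretization, for |e| <= e0, of the ODE z' = f z. *)
Record discretization d (p : nat) (f : 'rV[R]_d -> 'rV[R]_d)
    (e0 : R) (Phi : R -> 'rV[R]_d -> 'rV[R]_d) : Prop := Discretization {
  discr_order : (0 < p)%N;
  discr_field : analytic_on setT f;
  discr_range : 0 < e0;
  discr_diffeo : forall e, `|e| <= e0 -> diffeo_onto_image (Phi e);
  discr_analytic :
    analytic_on [set z | `|lsubmx z 0 0| <= e0] (joint Phi);
  discr_error : exists C : R -> R,
    [/\ {within `[0, +oo[, continuous C},
        {in `[0, +oo[ &, {homo C : a b / a < b}},
        (forall a, 0 <= a -> 0 <= C a) &
        forall e z w, `|e| <= e0 -> evolves (fun=> f) setT 0 e z w ->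
          `|Phi e z - w| <= C `|z| * `|e| ^+ p.+1]
}.

End Evolution.

Section Nonholonomic.
Context {R : realType} {n m : nat}.
Implicit Types (L : 'rV[R]_(n + n) -> R) (mu : 'rV[R]_n -> 'M[R]_(m, n)).
Implicit Types x : 'rV[R]_(n + n).

(* A point of TQ is x = row_mx q v, so that lsubmx x = q and rsubmx x = v. *)

Definition dq d (V : normedModType R) (i : 'I_d) (f : 'rV[R]_(d + d) -> V) :=
  partial (lshift d i) f.
Definition dv d (V : normedModType R) (i : 'I_d) (f : 'rV[R]_(d + d) -> V) :=
  partial (rshift d i) f.

Definition mass L x : 'M[R]_n := \matrix_(i, j) dv i (dv j L) x.

Definition mechanical L : Prop :=
  [/\ Ck 2 setT L,
      (forall x y, lsubmx x = lsubmx y -> mass L x = mass L y),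
      (forall x, mass L x \in unitmx) &
      forall x (w : 'rV[R]_n), w != 0 -> 0 < (w *m mass L x *m w^T) 0 0].

(* Row alpha of [mu q] lists the coefficients of the one-form mu^alpha at q. *)
Definition constraints mu : Prop :=
  Ck 1 setT mu /\ forall q, row_free (mu q).

Definition constraint_set mu : set 'rV[R]_(n + n) :=
  [set x | forall a : 'I_m, \sum_i mu (lsubmx x) a i * rsubmx x 0 i = 0].

Definition free_accel L x : 'rV[R]_n :=
  let minv := invmx (mass L x) in let v := rsubmx x in
  \row_i (- (\sum_k \sum_j minv i k * dq j (dv k L) x * v 0 j)
          + \sum_j minv i j * dq j L x).

Definition Cmat L mu x : 'M[R]_m :=
  mu (lsubmx x) *m invmx (mass L x) *m (mu (lsubmx x))^T.

Definition multiplier L mu x : 'rV[R]_m :=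
  let q := lsubmx x in let v := rsubmx x in
  \row_a (- \sum_b invmx (Cmat L mu x) a b *
     (\sum_i \sum_j partial j (fun q' => mu q' b i) q * v 0 i * v 0 j
      + \sum_i mu q b i * free_accel L x 0 i)).

Definition nonholonomic_field L mu x : 'rV[R]_(n + n) :=
  row_mx (rsubmx x)
    (\row_i (free_accel L x 0 i +
       \sum_a \sum_j multiplier L mu x 0 a *
         invmx (mass L x) i j * mu (lsubmx x) a j)).

End Nonholonomic.

(* psi is a parametrization of D by R^d: a C^1 immersion that is a
   homeomorphism onto a relatively open subset of D (possibly all of D). *)
Definition coordinate_map {R : realType} d k (D : set 'rV[R]_k)
    (psi : 'rV[R]_d -> 'rV[R]_k) : Prop :=
  [/\ Ck 1 setT psi, (forall xi, \rank (jacobian psi xi) = d),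
      injective psi &
      forall U : set 'rV[R]_d, open U ->
        exists2 V : set 'rV[R]_k, open V & psi @` U = V `&` D].

(* With row vectors, [jacobian psi xi] is the transpose of the usual Jacobian
   matrix: a left inverse of the latter becomes a right inverse of the former,
   acting on row vectors from the right. *)
Definition jacobian_left_inverse {R : realType} d k
    (psi : 'rV[R]_d -> 'rV[R]_k) (P : 'rV[R]_d -> 'M[R]_(k, d)) : Prop :=
  forall xi, jacobian psi xi *m P xi = 1%:M.

Definition nonholonomic_rhs {R : realType} n m d
    (L : 'rV[R]_(n + n) -> R) (mu : 'rV[R]_n -> 'M[R]_(m, n))
    (psi : 'rV[R]_d -> 'rV[R]_(n + n)) (P : 'rV[R]_d -> 'M[R]_(n + n, d))
    (xi : 'rV[R]_d) : 'rV[R]_d :=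
  nonholonomic_field L mu (psi xi) *m P xi.

(* Main.v *)
Require Import Defs.
From mathcomp Require Import lra ring finmap.

(** Let F be the flow of xi' = f xi.  By the order condition,
    F(-e, Phi(e, xi)) = xi + e^(p+1) r(e, xi) with r analytic.  If chi is a
    smooth step from 0 to 1 which is constant near 0 and near 1, the curve
      X(t) = F(t, xi + e chi(t/e) e^p r(e, xi))
    goes from xi at t = 0 to Phi(e, xi) at t = e, with velocity
    f(X) + e^p chi'(t/e) G(e, t, e chi(t/e), X).  Expressing xi through X only
    requires inverting F(t, .) and xi |-> xi + k e^p r(e, xi) for small e, t, k,
    so that G is analytic near (0, 0, 0, x) for each x.  The perturbation
    is g(e, tau, x) = chi'(tau) G(e, e tau, e chi(tau), x) for 0 <= tau <= 1,
    extended periodically; it is smooth because chi' vanishes near the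
    integers.  How small e must be depends on |x| only, hence a radius rho(e)
    that tends to infinity sufficiently slowly as e tends to 0.

    Analyticity is established in the Banach algebras of power series with a
    weighted l^1 norm, where flows and inverses arise by Picard iteration; the
    error estimate makes r analytic through repeated division by e. *)

Set Implicit Arguments.
Unset Strict Implicit.
Unset Printing Implicit Defensive.

Local Open Scope classical_set_scope.
Local Open Scope ring_scope.

(** * Unordered sums *)

Section UnorderedSums.
Context {R : realType}.
Implicit Types I J : choiceType.

(** One power of e separates the order condition from the perturbation because k(t) = e chi(t/e) has
    derivative chi'(t/e): the shift e^(p+1) r is traversed in time e. The variables t = e tau and k
    = e chi(tau) of G are kept independent. Although tau runs through [0, 1], both are small with e,
    so G is needed only near the points (0, 0, 0, x); the flow is used for short times only, and
    solutions that blow up do no harm. Keeping chi out of G also separates two kinds of regularity: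
    G is analytic, whereas chi, constant near 0 and near 1, cannot be. Hence joint regularity is
    C^oo, and analyticity holds in (e, x) for fixed tau. Local objects are described without
    reference to a base point, as limits or as unique solutions, so that they glue to one g;
    compactness of closed balls then gives one step size per ball. Lipschitz bounds serve the
    converse claim: every solution of the perturbed equation that stays in the domain, not only X,
    ends at Phi(e, xi). *)

Definition asum I (f : I -> R) : \bar R := (\esum_(i in setT) `|f i|%:E)%E.

(** Total by convention: [fine] sends an infinite sum to 0, so the value is meaningful only under
    [asum f < +oo]. *)
Definition rsum I (f : I -> R) : R :=
  fine (asum (fun i => Num.max (f i) 0)) -
  fine (asum (fun i => Num.max (- f i) 0)).

Lemma asum_ge0 I (f : I -> R) : (0 <= asum f)%E.
Proof. by apply: esum_ge0 => i _; rewrite lee_fin. Qed.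

Lemma le_asum I (f g : I -> R) : (forall i, `|f i| <= `|g i|) -> (asum f <= asum g)%E.
Proof. by move=> h; apply: le_esum => i _; rewrite lee_fin. Qed.

Lemma eq_asum I (f g : I -> R) : (forall i, `|f i| = `|g i|) -> asum f = asum g.
Proof. by move=> h; apply: eq_esum => i _; rewrite h. Qed.

Lemma eq_rsum I (f g : I -> R) : f =1 g -> rsum f = rsum g.
Proof. by move=> /funext ->. Qed.

Lemma asum_fin I (f : I -> R) : (asum f < +oo)%E -> (fine (asum f))%:E = asum f.
Proof. by move=> h; rewrite fineK// ge0_fin_numE// asum_ge0. Qed.

Lemma asum_ltoo I (f : I -> R) M : (asum f <= M%:E)%E -> (asum f < +oo)%E.
Proof. by move=> /le_lt_trans; apply; rewrite ltry. Qed.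

Lemma asumD I (f g : I -> R) : (forall i, 0 <= f i) -> (forall i, 0 <= g i) ->
  asum (fun i => f i + g i) = (asum f + asum g)%E.
Proof.
move=> f0 g0; rewrite /asum -esumD.
- by apply: eq_esum => i _; rewrite -EFinD !ger0_norm// addr_ge0.
- by move=> i _; rewrite lee_fin.
- by move=> i _; rewrite lee_fin.
Qed.

Lemma asumD_le I (f g : I -> R) :
  (asum (fun i => f i + g i)%R <= asum f + asum g)%E.
Proof.
rewrite /asum -esumD; try by move=> i _; rewrite lee_fin.
by apply: le_esum => i _; rewrite -EFinD lee_fin ler_normD.
Qed.

Lemma asumD_fin I (f g : I -> R) : (forall i, 0 <= f i) -> (forall i, 0 <= g i) ->
  (asum f < +oo)%E -> (asum g < +oo)%E ->
  fine (asum (fun i => f i + g i)) = fine (asum f) + fine (asum g).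
Proof.
move=> f0 g0 fo go; rewrite asumD// fineD//.
- by rewrite ge0_fin_numE// asum_ge0.
- by rewrite ge0_fin_numE// asum_ge0.
Qed.

(** Any splitting of [f] into nonnegative summable parts computes its sum: with [P] and [Q] the
    positive and negative parts, [P + q = p + Q], and sums of nonnegative families are additive.
    Linearity and Fubini for [rsum] are reduced to nonnegative families in this way. *)
Lemma rsum_pm I (f p q : I -> R) : (forall i, 0 <= p i) -> (forall i, 0 <= q i) ->
  (asum p < +oo)%E -> (asum q < +oo)%E -> (forall i, f i = p i - q i) ->
  rsum f = fine (asum p) - fine (asum q).
Proof.
move=> p0 q0 po qo fpq; rewrite /rsum.
set P := fun i => Num.max (f i) 0; set Q := fun i => Num.max (- f i) 0.
have P0 i : 0 <= P i by rewrite le_max lexx orbT.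
have Q0 i : 0 <= Q i by rewrite le_max lexx orbT.
have PQ i : P i + q i = p i + Q i.
  by rewrite /P /Q fpq; have := p0 i; have := q0 i; rewrite /Num.max; do 2 case: ifP; lra.
have Po : (asum P < +oo)%E.
  apply: le_lt_trans po; apply: le_asum => i; rewrite !ger0_norm//.
  by rewrite /P fpq ge_max p0 andbT; have := q0 i; lra.
have Qo : (asum Q < +oo)%E.
  apply: le_lt_trans qo; apply: le_asum => i; rewrite !ger0_norm//.
  by rewrite /Q fpq ge_max q0 andbT; have := p0 i; lra.
have := asumD_fin P0 q0 Po qo; have := asumD_fin p0 Q0 po Qo.
by rewrite (funext PQ); lra.
Qed.

Lemma posneg I (f : I -> R) :
  [/\ (forall i, 0 <= Num.max (f i) 0), (forall i, 0 <= Num.max (- f i) 0),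
      (asum (fun i => Num.max (f i) 0)%R <= asum f)%E,
      (asum (fun i => Num.max (- f i) 0)%R <= asum f)%E &
      forall i, f i = Num.max (f i) 0 - Num.max (- f i) 0].
Proof.
split.
- by move=> i; rewrite le_max lexx orbT.
- by move=> i; rewrite le_max lexx orbT.
- apply: le_asum => i; rewrite [leLHS]ger0_norm ?le_max ?lexx ?orbT//.
  by rewrite ge_max normr_ge0 ler_norm.
- apply: le_asum => i; rewrite [leLHS]ger0_norm ?le_max ?lexx ?orbT//.
  by rewrite ge_max normr_ge0 -normrN ler_norm.
- by move=> i; rewrite /Num.max; do 2 case: ifP; lra.
Qed.

Lemma rsumD I (f g : I -> R) : (asum f < +oo)%E -> (asum g < +oo)%E ->
  rsum (fun i => f i + g i) = rsum f + rsum g.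
Proof.
move=> fo go.
have [p0 q0 po qo e] := posneg f; have [p0' q0' po' qo' e'] := posneg g.
have {}po := le_lt_trans po fo; have {}qo := le_lt_trans qo fo.
have {}po' := le_lt_trans po' go; have {}qo' := le_lt_trans qo' go.
rewrite (@rsum_pm _ _ (fun i => Num.max (f i) 0 + Num.max (g i) 0)
   (fun i => Num.max (- f i) 0 + Num.max (- g i) 0)).
- by rewrite (asumD_fin p0 p0' po po') (asumD_fin q0 q0' qo qo') /rsum; lra.
- by move=> i; rewrite addr_ge0.
- by move=> i; rewrite addr_ge0.
- by rewrite asumD// lte_add_pinfty.
- by rewrite asumD// lte_add_pinfty.
- by move=> i; rewrite [in LHS]e [in LHS]e'; lra.
Qed.

Lemma asumZ I (c : R) (f : I -> R) : (asum (fun i => c * f i)%R = `|c|%:E * asum f)%E.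
Proof.
have le c' f' : (asum (fun i => c' * f' i)%R <= `|c'|%:E * @asum I f')%E.
  apply: ge_ereal_sup => /= _ [X [finX XI]] <-.
  under eq_fsbigr do rewrite normrM EFinM.
  rewrite -ge0_mule_fsumr; last by move=> i; rewrite lee_fin.
  rewrite lee_wpmul2l ?lee_fin// ?normr_ge0//.
  by apply: ereal_sup_ubound; exists X.
have [->|c0] := eqVneq c 0.
  rewrite normr0 mul0e /asum esum1// => i _; by rewrite mul0r normr0.
apply/eqP; rewrite eq_le le/=.
(* The reverse inequality is [le] for [c^-1] and the family [c * f]. *)
rewrite -lee_pdivlMl ?normr_gt0//.
rewrite -normfV; apply: le_trans (le _ _).
rewrite le_asum// => i; by rewrite mulKf.
Qed.

Lemma rsumN I (f : I -> R) : rsum (fun i => - f i) = - rsum f.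
Proof. by rewrite /rsum; under [X in _ - fine (asum X)]funext do rewrite opprK; lra. Qed.

Lemma rsumZ I (c : R) (f : I -> R) : (asum f < +oo)%E ->
  rsum (fun i => c * f i) = c * rsum f.
Proof.
move=> fo; wlog c0 : c / 0 <= c.
  move=> h; have [/h//|/ltW c0] := leP 0 c.
  rewrite (_ : (fun i => c * f i) = (fun i => - (- c * f i))); last first.
    by apply/funext => i; rewrite mulNr opprK.
  by rewrite rsumN h ?oppr_ge0// mulNr opprK.
have [p0 q0 po qo e] := posneg f.
have {}po := le_lt_trans po fo; have {}qo := le_lt_trans qo fo.
rewrite (@rsum_pm _ _ (fun i => c * Num.max (f i) 0) (fun i => c * Num.max (- f i) 0)).
- by rewrite !asumZ -(asum_fin po) -(asum_fin qo)/= ger0_norm// /rsum; lra.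
- by move=> i; rewrite mulr_ge0.
- by move=> i; rewrite mulr_ge0.
- by rewrite asumZ -(asum_fin po) -EFinM ltry.
- by rewrite asumZ -(asum_fin qo) -EFinM ltry.
- by move=> i; rewrite -mulrBr -e.
Qed.

Lemma rsumB I (f g : I -> R) : (asum f < +oo)%E -> (asum g < +oo)%E ->
  rsum (fun i => f i - g i) = rsum f - rsum g.
Proof.
move=> fo go; rewrite rsumD ?rsumN//.
by rewrite (@eq_asum _ _ g)// => i; rewrite normrN.
Qed.

Lemma rsum_norm I (f : I -> R) M : (asum f <= M%:E)%E -> `|rsum f| <= M.
Proof.
move=> fM; have [p0 q0 po qo e] := posneg f.
have := asumD p0 q0; rewrite (@eq_asum _ _ f); last first.
  move=> i /=; have [f0|f0] := leP 0 (f i).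
    by rewrite max_r ?addr0// oppr_le0.
  by rewrite max_l ?add0r ?normrN// oppr_ge0 ltW.
move=> E; move: (fM); rewrite E -(asum_fin (le_lt_trans po (asum_ltoo fM))).
rewrite -(asum_fin (le_lt_trans qo (asum_ltoo fM))) -EFinD lee_fin /rsum.
have h1 : 0 <= fine (asum (fun i => Num.max (f i) 0)) by rewrite fine_ge0// asum_ge0.
have h2 : 0 <= fine (asum (fun i => Num.max (- f i) 0)) by rewrite fine_ge0// asum_ge0.
by rewrite ler_norml; lra.
Qed.

Lemma asum_pair I J (f : I * J -> R) :
  asum f = (\esum_(i in setT) asum (fun j => f (i, j)))%E.
Proof.
rewrite /asum (esum_esum (a := fun i j => `|f (i, j)|%:E)).
  rewrite (_ : _ `*`` _ = setT); last by apply/seteqP; split => // -[].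
  by apply: eq_esum => -[].
by move=> i j _ _; rewrite lee_fin.
Qed.

Lemma asum_swap I J (f : I -> J -> R) :
  (\esum_(i in setT) asum (f i) = \esum_(j in setT) asum (f ^~ j))%E.
Proof.
rewrite -(asum_pair (fun k => f k.1 k.2)) -(asum_pair (fun k => f k.2 k.1)).
rewrite /asum (reindex_esum setT setT (fun k : I * J => (k.2, k.1)))//=.
split=> //; first by move=> [a b] [c d] _ _ /= [-> ->].
by move=> [b a] _; exists (a, b).
Qed.

Lemma esum_nonneg_fin I (f : I -> \bar R) : (forall i, 0 <= f i)%E ->
  (\esum_(i in setT) f i < +oo)%E -> forall i, (f i < +oo)%E.
Proof.
move=> f0 fo i; apply: le_lt_trans fo; apply: esum_ge.
by exists [set i]; [split=> //; exact: finite_set1|rewrite fsbig_set1].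
Qed.

Lemma asum_esum I (f : I -> \bar R) : (forall i, 0 <= f i)%E ->
  (\esum_(i in setT) f i < +oo)%E ->
  (asum (fun i => fine (f i)) = \esum_(i in setT) f i)%E.
Proof.
move=> f0 fo; apply: eq_esum => i _; rewrite ger0_norm ?fine_ge0// fineK//.
by rewrite ge0_fin_numE//; exact: esum_nonneg_fin.
Qed.

(** Tonelli for the positive and the negative part; the inner sums of these parts split the outer
    family, to which [rsum_pm] applies. *)
Lemma rsum_pair I J (f : I * J -> R) : (asum f < +oo)%E ->
  rsum f = rsum (fun i => rsum (fun j => f (i, j))).
Proof.
move=> fo; have [p0 q0 po qo e] := posneg f.
have {}po := le_lt_trans po fo; have {}qo := le_lt_trans qo fo.
rewrite [LHS](rsum_pm p0 q0 po qo e) [asum _]asum_pair [X in _ - fine X]asum_pair.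
rewrite asum_pair in po; rewrite asum_pair in qo.
rewrite -(asum_esum _ po) -?(asum_esum _ qo); try by move=> i; exact: asum_ge0.
apply/esym/rsum_pm.
- by move=> i; rewrite fine_ge0// asum_ge0.
- by move=> i; rewrite fine_ge0// asum_ge0.
- by rewrite asum_esum// => i; exact: asum_ge0.
- by rewrite asum_esum// => i; exact: asum_ge0.
- by [].
Qed.

Lemma rsum_swap I J (f : I -> J -> R) :
  (\esum_(i in setT) asum (f i) < +oo)%E ->
  rsum (fun i => rsum (f i)) = rsum (fun j => rsum (f ^~ j)).
Proof.
move=> fo; have fo' : (\esum_(j in setT) asum (f ^~ j) < +oo)%E by rewrite -asum_swap.
have e1 := @rsum_pair _ _ (fun k => f k.1 k.2); rewrite -e1 ?asum_pair//.
have e2 := @rsum_pair _ _ (fun k => f k.2 k.1); rewrite -e2 ?asum_pair//.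
have sw (g : I * J -> R) : asum g = asum (fun k => g (k.2, k.1)).
  rewrite /asum (reindex_esum setT setT (fun k : J * I => (k.2, k.1)))//=.
  split=> //; first by move=> [a b] [c d] _ _ /= [-> ->].
  by move=> [b a] _; exists (a, b).
by rewrite /rsum; congr (fine _ - fine _); apply: sw.
Qed.

Lemma asum1 I (i0 : I) (f : I -> R) : (forall i, i != i0 -> f i = 0) ->
  asum f = `|f i0|%:E.
Proof.
move=> h; rewrite /asum (esumID [set i0]) => [|i _]; last by rewrite lee_fin.
rewrite setTI esum_set1 ?lee_fin//.
rewrite [X in (_ + X)%E]esum1 ?adde0// => i [_ /= /eqP ii0].
by rewrite h// normr0.
Qed.

Lemma rsum1 I (i0 : I) (f : I -> R) : (forall i, i != i0 -> f i = 0) ->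
  rsum f = f i0.
Proof.
move=> h; rewrite /rsum !(asum1 (i0 := i0)).
- have [f0|f0] := leP 0 (f i0).
    by rewrite max_r ?oppr_le0// normr0 /= ger0_norm ?subr0.
  by rewrite max_l ?oppr_ge0 ?ltW// normr0 normrN /= ltr0_norm// sub0r opprK.
- by move=> i /h ->; rewrite oppr0 maxxx.
- by move=> i /h ->; rewrite maxxx.
Qed.

End UnorderedSums.

(** * Absolutely convergent power series *)

Section PowerSeries.
Context {R : realType}.

Definition mi (d : nat) := {ffun 'I_d -> nat}.
Definition mdeg d (a : mi d) : nat := (\sum_i a i)%N.
Definition mon d (h : 'rV[R]_d) (a : mi d) : R := \prod_i h 0 i ^+ a i.
Definition madd d (a b : mi d) : mi d := [ffun i => (a i + b i)%N].

(* On the closed polydisc of radius r, f is the sum of a power series whose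
   coefficients have weighted l^1 norm at most M.  All estimates are carried
   out in this Banach algebra, so that no complex analysis is needed. *)
Definition rep d (r M : R) (f : 'rV[R]_d -> R) : Prop :=
  exists c : mi d -> R, (asum (fun a => c a * r ^+ mdeg a)%R <= M%:E)%E /\
    forall h, `|h| <= r -> f h = rsum (fun a => c a * mon h a).

Lemma rV_norm_le d (h : 'rV[R]_d) r : 0 <= r ->
  (forall i, `|h 0 i| <= r) -> `|h| <= r.
Proof.
move=> r0 hr; rewrite [leLHS]/Num.norm/= mx_normrE.
by apply/bigmax_leP; split=> // -[i j] _ /=; rewrite (ord1 i).
Qed.

Lemma rV_norm_lt d (h : 'rV[R]_d) r : 0 < r ->
  (forall i, `|h 0 i| < r) -> `|h| < r.
Proof.
move=> r0 hr; rewrite [ltLHS]/Num.norm/= mx_normrE.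
by apply/bigmax_ltP; split=> // -[i j] _ /=; rewrite (ord1 i).
Qed.

Lemma rV_coord_le d (h : 'rV[R]_d) i : `|h 0 i| <= `|h|.
Proof.
rewrite [leRHS]/Num.norm/= mx_normrE.
by rewrite (le_bigmax _ (fun k => `|h k.1 k.2|) (0, i)).
Qed.

Lemma mon_norm d (h : 'rV[R]_d) a r : `|h| <= r -> `|mon h a| <= r ^+ mdeg a.
Proof.
move=> hr; rewrite /mon /mdeg normr_prod -prodrXr ler_prod// => i _.
rewrite normrX exprn_ge0//= lerXn2r ?nnegrE//.
  exact: le_trans hr.
by apply: le_trans hr; exact: rV_coord_le.
Qed.

Lemma asumZ_le (I : choiceType) (k M : R) (f : I -> R) : 0 <= k ->
  (asum f <= M%:E)%E -> (asum (fun i => k * f i)%R <= (k * M)%:E)%E.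
Proof.
by move=> k0 fM; rewrite asumZ EFinM ger0_norm// lee_wpmul2l// lee_fin.
Qed.

Lemma mon_madd d (h : 'rV[R]_d) a b : mon h (madd a b) = mon h a * mon h b.
Proof. by rewrite /mon -big_split; apply: eq_bigr => i _; rewrite ffunE exprD. Qed.

Lemma mdeg_madd d (a b : mi d) : mdeg (madd a b) = (mdeg a + mdeg b)%N.
Proof. by rewrite /mdeg -big_split; apply: eq_bigr => i _; rewrite ffunE. Qed.

Lemma asum_term d (c : mi d -> R) r M h :
  (asum (fun a => c a * r ^+ mdeg a)%R <= M%:E)%E -> `|h| <= r ->
  (asum (fun a => c a * mon h a)%R <= M%:E)%E.
Proof.
move=> cM hr; apply: le_trans cM; apply: le_asum => a; rewrite !normrM.
rewrite ler_wpM2l//; apply: le_trans (mon_norm _ hr) _.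
by rewrite ger0_norm// exprn_ge0// (le_trans _ hr).
Qed.

Lemma rep_norm d r M (f : 'rV[R]_d -> R) h : rep r M f -> `|h| <= r -> `|f h| <= M.
Proof. by move=> [c [cM e]] hr; rewrite e//; apply: rsum_norm (asum_term cM hr). Qed.

Lemma rep_ge0 d r M (f : 'rV[R]_d -> R) : rep r M f -> 0 <= M.
Proof. by move=> [c [cM _]]; rewrite -lee_fin (le_trans _ cM)// asum_ge0. Qed.

Lemma rep_ext d r M (f g : 'rV[R]_d -> R) :
  (forall h, `|h| <= r -> f h = g h) -> rep r M f -> rep r M g.
Proof. by move=> fg [c [cM e]]; exists c; split=> // h hr; rewrite -fg// e. Qed.

Lemma rep_le d r M M' (f : 'rV[R]_d -> R) : M <= M' -> rep r M f -> rep r M' f.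
Proof. by move=> MM [c [cM e]]; exists c; split=> //; apply: le_trans cM _; rewrite lee_fin. Qed.

Lemma rep_radius d r r' M (f : 'rV[R]_d -> R) : 0 <= r' -> r' <= r -> rep r M f -> rep r' M f.
Proof.
move=> r0 rr [c [cM e]]; exists c; split; last by move=> h hr; rewrite e// (le_trans hr).
apply: le_trans cM; apply: le_asum => a; rewrite !normrM ler_wpM2l//.
by rewrite !ger0_norm ?exprn_ge0// ?(le_trans r0)// lerXn2r// ?nnegrE// (le_trans r0).
Qed.

Lemma norm_rsum_le (I : choiceType) (f : I -> R) : (`|rsum f|%:E <= asum f)%E.
Proof.
have [fo|] := ltP (asum f) +oo%E; last by rewrite leye_eq => /eqP ->; rewrite leey.
by rewrite -(asum_fin fo) lee_fin; apply: rsum_norm; rewrite asum_fin.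
Qed.

(* Every further closure property is an instance of this one, because products
   and composites are absolutely convergent sums of simpler functions. *)
Lemma rep_rsum d (I : choiceType) r M (m : I -> R) (F : I -> 'rV[R]_d -> R) :
  0 < r -> (forall i, rep r `|m i| (F i)) -> (asum m <= M%:E)%E ->
  rep r M (fun h => rsum (fun i => F i h)).
Proof.
move=> r0 /choice[c ce] mM.
have cle : (\esum_(i in setT) asum (fun a => c i a * r ^+ mdeg a)%R <= M%:E)%E.
  by apply: le_trans mM; apply: le_esum => i _; have [] := ce i.
have cle' : (\esum_(a in setT) asum (fun i => c i a * r ^+ mdeg a)%R <= M%:E)%E.
  by rewrite (asum_swap (fun a i => c i a * r ^+ mdeg a)).
have cfin a : (asum (c ^~ a) < +oo)%E.
  have rn0 : r ^+ mdeg a != 0 by rewrite expf_neq0// gt_eqF.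
  have /= := @esum_nonneg_fin _ _ (fun a => asum (fun i => c i a * r ^+ mdeg a)) _
     (le_lt_trans cle' (ltry M)) a.
  rewrite (_ : (fun i => c i a * _) = (fun i => r ^+ mdeg a * c i a)); last first.
    by apply/funext => i; rewrite mulrC.
  move=> /(_ (fun=> asum_ge0 _)); rewrite asumZ.
  have := asum_ge0 (c ^~ a); case: (asum (c ^~ a)) => [x _ _|_|//]; first by rewrite ltry.
  by rewrite muleC gt0_mulye ?lte_fin ?normr_gt0.
exists (fun a => rsum (c ^~ a)); split.
  apply: le_trans cle'; apply: le_esum => a _.
  rewrite mulrC -rsumZ//; apply: le_trans (norm_rsum_le _) _.
  by apply: le_asum => i; rewrite mulrC.
move=> h hr.
transitivity (rsum (fun i => rsum (fun a => c i a * mon h a))).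
  by apply: eq_rsum => i; have [_ ->] := ce i.
rewrite rsum_swap.
  by apply: eq_rsum => a; rewrite mulrC -rsumZ//; apply: eq_rsum => i; rewrite mulrC.
apply: le_lt_trans (ltry M); apply: le_trans cle.
apply: le_esum => i _; apply: le_asum => a; rewrite !normrM ler_wpM2l//.
by apply: le_trans (mon_norm _ hr) _; rewrite ger0_norm// exprn_ge0// ltW.
Qed.

Lemma rep_scale d r M k (f : 'rV[R]_d -> R) : rep r M f -> rep r (`|k| * M) (fun h => k * f h).
Proof.
move=> [c [cM e]]; exists (fun a => k * c a); split.
  rewrite (_ : (fun a => _) = (fun a => k * (c a * r ^+ mdeg a))); last first.
    by apply/funext => a; rewrite mulrA.
  by rewrite asumZ EFinM lee_wpmul2l// lee_fin.
move=> h hr; rewrite e// -rsumZ; last exact: asum_ltoo (asum_term cM hr).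
by apply: eq_rsum => a; rewrite mulrA.
Qed.

Lemma rep_add d r M N (f g : 'rV[R]_d -> R) :
  rep r M f -> rep r N g -> rep r (M + N) (fun h => f h + g h).
Proof.
move=> [c [cM e]] [c' [cM' e']]; exists (fun a => c a + c' a); split.
  rewrite (_ : (fun a => _) = (fun a => c a * r ^+ mdeg a + c' a * r ^+ mdeg a)); last first.
    by apply/funext => a; rewrite mulrDl.
  by apply: le_trans (asumD_le _ _) _; rewrite EFinD leeD.
move=> h hr; rewrite e// e'// -rsumD.
- by apply: eq_rsum => a; rewrite mulrDl.
- exact: asum_ltoo (asum_term cM hr).
- exact: asum_ltoo (asum_term cM' hr).
Qed.

Lemma rep_opp d r M (f : 'rV[R]_d -> R) : rep r M f -> rep r M (fun h => - f h).
Proof.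
move=> /(rep_scale (-1)); rewrite normrN1 mul1r; apply: rep_ext => h _.
by rewrite mulN1r.
Qed.

Lemma rep_sub d r M N (f g : 'rV[R]_d -> R) :
  rep r M f -> rep r N g -> rep r (M + N) (fun h => f h - g h).
Proof. by move=> fM /rep_opp; exact: rep_add. Qed.

Lemma rep_mon d r (a : mi d) : rep r (`|r| ^+ mdeg a) (fun h => mon h a).
Proof.
exists (fun b => (b == a)%:R); split.
  rewrite (asum1 (i0 := a)) => [|b /negPf ->]; last by rewrite mul0r.
  by rewrite eqxx mul1r normrX.
move=> h _; rewrite (rsum1 (i0 := a)) => [|b /negPf ->]; last by rewrite mul0r.
by rewrite eqxx mul1r.
Qed.

Lemma mon0 d (h : 'rV[R]_d) : mon h [ffun=> 0%N] = 1.
Proof. by rewrite /mon big1// => i _; rewrite ffunE. Qed.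

Lemma mdeg0 d : mdeg ([ffun=> 0%N] : mi d) = 0%N.
Proof. by rewrite /mdeg big1// => i _; rewrite ffunE. Qed.

Lemma rep_const d r k : rep r `|k| (fun=> k : R) (d := d).
Proof.
have := rep_scale k (rep_mon r ([ffun=> 0%N] : mi d)); rewrite mdeg0 mulr1.
by apply: rep_ext => h _; rewrite mon0 mulr1.
Qed.

Definition mdelta d (i : 'I_d) : mi d := [ffun j => nat_of_bool (j == i)].

Lemma mon_delta d (h : 'rV[R]_d) i : mon h (mdelta i) = h 0 i.
Proof.
rewrite /mon (bigD1 i)//= big1 => [|j /negPf ji]; rewrite ffunE ?eqxx ?ji//.
by rewrite mulr1.
Qed.

Lemma mdeg_delta d (i : 'I_d) : mdeg (mdelta i) = 1%N.
Proof.
rewrite /mdeg (bigD1 i)//= big1 => [|j /negPf ji]; rewrite ffunE ?eqxx ?ji//.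
Qed.

Lemma rep_coord d r (i : 'I_d) : 0 <= r -> rep r r (fun h => h 0 i).
Proof.
move=> r0; have := rep_mon r (mdelta i); rewrite mdeg_delta ger0_norm//.
by apply: rep_ext => h _; rewrite mon_delta.
Qed.

Lemma rep_monM d r M (b : mi d) (f : 'rV[R]_d -> R) : 0 < r ->
  rep r M f -> rep r (r ^+ mdeg b * M) (fun h => mon h b * f h).
Proof.
move=> r0 [c [cM e]].
apply: (@rep_ext _ _ _ (fun h => rsum (fun a => c a * mon h (madd b a)))).
  move=> h hr; rewrite e// -rsumZ; last exact: asum_ltoo (asum_term cM hr).
  by apply: eq_rsum => a; rewrite mon_madd; ring.
apply: (@rep_rsum _ _ _ _ (fun a => r ^+ mdeg b * (c a * r ^+ mdeg a)))=> //.
  move=> a; have := rep_scale (c a) (rep_mon r (madd b a)).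
  rewrite mdeg_madd exprD; apply: rep_le; rewrite !normrM !normrX; lra.
by apply: asumZ_le => //; rewrite exprn_ge0// ltW.
Qed.

Lemma rep_mul d r M N (f g : 'rV[R]_d -> R) : 0 < r ->
  rep r M f -> rep r N g -> rep r (M * N) (fun h => f h * g h).
Proof.
move=> r0 [c [cM e]] gN; have N0 := rep_ge0 gN.
apply: (@rep_ext _ _ _ (fun h => rsum (fun a => c a * (mon h a * g h)))).
  move=> h hr; rewrite e// mulrC -rsumZ; last exact: asum_ltoo (asum_term cM hr).
  by apply: eq_rsum => a; ring.
apply: (@rep_rsum _ _ _ _ (fun a => N * (c a * r ^+ mdeg a)))=> //.
  move=> a; have := rep_scale (c a) (rep_monM a r0 gN).
  by apply: rep_le; rewrite !normrM !normrX (ger0_norm N0) (gtr0_norm r0); lra.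
by rewrite mulrC; apply: asumZ_le.
Qed.

Lemma rep_exp d r M (f : 'rV[R]_d -> R) n : 0 < r ->
  rep r M f -> rep r (M ^+ n) (fun h => f h ^+ n).
Proof.
move=> r0 fM; elim: n => [|n IH].
  by have := @rep_const d r 1; rewrite normr1; apply: rep_ext => h _; rewrite expr0.
rewrite exprS; apply: rep_ext (rep_mul r0 fM IH) => h _; by rewrite exprS.
Qed.

Lemma rep_prod d r (I : Type) (s : seq I) (M : I -> R) (f : I -> 'rV[R]_d -> R) : 0 < r ->
  (forall i, rep r (M i) (f i)) -> rep r (\prod_(i <- s) M i) (fun h => \prod_(i <- s) f i h).
Proof.
move=> r0 fM; elim: s => [|i s IH].
  rewrite big_nil; have := @rep_const d r 1; rewrite normr1.
  by apply: rep_ext => h _; rewrite big_nil.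
by rewrite big_cons; apply: rep_ext (rep_mul r0 (fM i) IH) => h _; rewrite big_cons.
Qed.

Lemma rep_mon_comp d e r s (G : 'rV[R]_d -> 'rV[R]_e) (a : mi e) : 0 < r ->
  (forall i, rep r s (fun h => G h 0 i)) ->
  rep r (s ^+ mdeg a) (fun h => mon (G h) a).
Proof.
move=> r0 Gs; rewrite /mdeg -prodrXr.
by apply: (@rep_prod _ _ _ _ _ (fun i h => G h 0 i ^+ a i)) => // i; apply: rep_exp.
Qed.

(** The norm is submultiplicative, so a monomial of degree [n] in the coordinates of [G] has norm at
    most [s ^+ n], and the substituted series is an instance of [rep_rsum]. The bound [s] includes
    the constant terms: [G] need not vanish at 0. *)
Lemma rep_comp d e r s M (G : 'rV[R]_d -> 'rV[R]_e) (F : 'rV[R]_e -> R) :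
  0 < r -> 0 <= s ->
  (forall i, rep r s (fun h => G h 0 i)) -> rep s M F -> rep r M (fun h => F (G h)).
Proof.
move=> r0 s0 Gs [c [cM ce]].
apply: (@rep_ext _ _ _ (fun h => rsum (fun a => c a * mon (G h) a))).
  move=> h hr; rewrite ce//; apply: rV_norm_le => // i.
  exact: (rep_norm (Gs i)).
apply: (@rep_rsum _ _ _ _ (fun a => c a * s ^+ mdeg a)) => // a.
rewrite normrM normrX (ger0_norm s0); apply: rep_scale; exact: rep_mon_comp.
Qed.

(** The chord bound for the convex function [t |-> (s + t) ^+ n] between 0 and [rho]. *)
Lemma exprD_sub_le (s rho eta : R) n : 0 <= s -> 0 <= eta <= rho -> 0 < rho ->
  (s + eta) ^+ n - s ^+ n <= eta / rho * ((s + rho) ^+ n - s ^+ n).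
Proof.
move=> s0 /andP[e0 er] r0.
have e1 : 0 <= eta / rho by rewrite divr_ge0// ltW.
have ee : eta = eta / rho * rho by rewrite divfK// gt_eqF.
elim: n => [|n IH]; first by rewrite !expr0 !subrr mulr0.
have h1 : s ^+ n <= (s + eta) ^+ n by rewrite lerXn2r ?nnegrE; lra.
have h2 : (s + eta) ^+ n <= (s + rho) ^+ n by rewrite lerXn2r ?nnegrE; lra.
rewrite !exprS.
have k1 : s * ((s + eta) ^+ n - s ^+ n) <= s * (eta / rho * ((s + rho) ^+ n - s ^+ n)).
  by rewrite ler_wpM2l.
have k2 : eta * (s + eta) ^+ n <= eta / rho * rho * (s + rho) ^+ n.
  by rewrite -ee ler_wpM2l.
set q := eta / rho in k1 k2 ee *; set A := (s + eta) ^+ n in k1 k2 *; set B := (s+rho)^+n in k1 k2 *.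
set C := s ^+ n in k1 *.
have -> : (s + eta) * A - s * C = s * (A - C) + eta * A by ring.
have -> : q * ((s + rho) * B - s * C) = s * (q * (B - C)) + q * rho * B by ring.
by rewrite lerD.
Qed.

(** The bounds are those of the numbers [s + eta] and [s]: the telescoping identity for
    [U ^+ n.+1 - V ^+ n.+1] in terms of [U], [V] and [U - V] has nonnegative coefficients, so it
    holds verbatim for the majorants. *)
Lemma rep_exp_diff d r s eta (U V : 'rV[R]_d -> R) n : 0 < r -> 0 <= s -> 0 <= eta ->
  rep r s V -> rep r eta (fun h => U h - V h) ->
  rep r ((s + eta) ^+ n) (fun h => U h ^+ n) /\
  rep r ((s + eta) ^+ n - s ^+ n) (fun h => U h ^+ n - V h ^+ n).
Proof.
move=> r0 s0 e0 Vs UV.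
have Us : rep r (s + eta) U by apply: rep_ext (rep_add Vs UV) => h _; rewrite addrC subrK.
split; first exact: rep_exp.
elim: n => [|n IH].
  rewrite !expr0 subrr; have := @rep_const d r 0; rewrite normr0.
  by apply: rep_ext => h _; rewrite ?expr0 ?subrr.
have h1 := rep_mul r0 Us IH; have h2 := rep_mul r0 UV (rep_exp n r0 Vs).
have -> : (s + eta) ^+ n.+1 - s ^+ n.+1 =
    (s + eta) * ((s + eta) ^+ n - s ^+ n) + eta * s ^+ n by rewrite !exprS; ring.
by apply: rep_ext (rep_add h1 h2) => h _; rewrite !exprS; ring.
Qed.

Lemma rep_prod_diff d r (I : Type) (t : seq I) (P Q : I -> R) (U V : I -> 'rV[R]_d -> R) :
  0 < r ->
  (forall i, rep r (P i) (U i)) -> (forall i, rep r (Q i) (V i)) ->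
  (forall i, rep r (P i - Q i) (fun h => U i h - V i h)) ->
  rep r (\prod_(i <- t) P i - \prod_(i <- t) Q i)
    (fun h => \prod_(i <- t) U i h - \prod_(i <- t) V i h).
Proof.
move=> r0 UP VQ UV; elim: t => [|i t IH].
  rewrite !big_nil subrr; have := @rep_const d r 0; rewrite normr0.
  by apply: rep_ext => h _; rewrite !big_nil subrr.
have h1 := rep_mul r0 (UP i) IH; have h2 := rep_mul r0 (UV i) (rep_prod t r0 VQ).
have := rep_add h1 h2; rewrite !big_cons.
set A := \prod_(_ <- _) _; set B := \prod_(_ <- _) _.
rewrite (_ : P i * (A - B) + (P i - Q i) * B = P i * A - Q i * B); last by ring.
by apply: rep_ext => h _; rewrite !big_cons; ring.
Qed.

(* The factor eta / rho comes from the convexity of s |-> s ^+ n. *)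
Lemma rep_comp_diff d e r s rho eta M (U V : 'rV[R]_d -> 'rV[R]_e) (F : 'rV[R]_e -> R) :
  0 < r -> 0 <= s -> 0 < rho -> 0 <= eta <= rho ->
  (forall i, rep r s (fun h => V h 0 i)) ->
  (forall i, rep r eta (fun h => U h 0 i - V h 0 i)) ->
  rep (s + rho) M F -> rep r (eta / rho * M) (fun h => F (U h) - F (V h)).
Proof.
move=> r0 s0 rho0 eta0 Vs UV [c [cM ce]]; have [e0 er] := andP eta0.
have VV h : `|h| <= r -> `|V h| <= s by move=> hr; apply: rV_norm_le => // i; exact: (rep_norm (Vs i)).
have UU h : `|h| <= r -> `|U h| <= s + eta.
  move=> hr; rewrite -(subrKC (V h) (U h)) (le_trans (ler_normD _ _))// lerD ?VV//.
  apply: rV_norm_le => // i; have := rep_norm (UV i) hr.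
  by rewrite !mxE.
have s1 : 0 <= s + rho by rewrite addr_ge0// ltW.
apply: (@rep_ext _ _ _ (fun h => rsum (fun a => c a * (mon (U h) a - mon (V h) a)))).
  move=> h hr; rewrite !ce.
  - rewrite -rsumB.
    + by apply: eq_rsum => a; rewrite mulrBr.
    + by apply: asum_ltoo (asum_term cM _); rewrite (le_trans (UU _ hr))// lerD2l.
    + by apply: asum_ltoo (asum_term cM _); rewrite (le_trans (VV _ hr))// lerDl ltW.
  - by rewrite (le_trans (VV _ hr))// lerDl ltW.
  - by rewrite (le_trans (UU _ hr))// lerD2l.
apply: (@rep_rsum _ _ _ _ (fun a => eta / rho * (c a * (s + rho) ^+ mdeg a))) => // [a|]; last first.
  by apply: asumZ_le => //; rewrite divr_ge0// ltW.
have -> : `|eta / rho * (c a * (s + rho) ^+ mdeg a)| = `|c a| * (eta / rho * (s + rho) ^+ mdeg a).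
  by rewrite !normrM !normrX normfV (ger0_norm e0) (gtr0_norm rho0) (ger0_norm s1); ring.
apply: rep_scale.
apply: (@rep_le _ _ ((s + eta) ^+ mdeg a - s ^+ mdeg a)).
  apply: le_trans (exprD_sub_le _ s0 eta0 rho0) _.
  by rewrite ler_wpM2l ?divr_ge0 ?(ltW rho0)// gerBl exprn_ge0.
rewrite /mdeg -!prodrXr.
apply: rep_prod_diff => // i.
- by have [] := rep_exp_diff (a i) r0 s0 e0 (Vs i) (UV i).
- exact: rep_exp.
- by have [] := rep_exp_diff (a i) r0 s0 e0 (Vs i) (UV i).
Qed.

End PowerSeries.

(** * Division of power series by a coordinate *)

Section Division.
Context {R : realType}.

Lemma mdeg_eq0 d (a : mi d) : mdeg a = 0%N -> a = [ffun=> 0%N].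
Proof.
move=> /eqP; rewrite /mdeg sum_nat_eq0 => /forallP h; apply/ffunP => i.
by rewrite ffunE; apply/eqP; exact: (implyP (h i)).
Qed.

Lemma mon_at0 d (a : mi d) : mon (0 : 'rV[R]_d) a = (a == [ffun=> 0%N])%:R.
Proof.
have [->|a0] := eqVneq a [ffun=> 0%N]; first by rewrite mon0.
have [i ai] : exists i, (0 < a i)%N.
  apply/existsP; apply: contraNT a0; rewrite negb_exists => /forallP h.
  by apply/eqP/ffunP => i; rewrite ffunE; have := h i; rewrite -eqn0Ngt => /eqP.
by rewrite /mon (bigD1 i)//= mxE expr0n (gtn_eqF ai) mul0r.
Qed.

(** Without constant term, every monomial carries at least one factor of the radius. Shrinking the
    radius thus makes the norm of a function vanishing at 0 as small as desired, which is used for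
    composition and for continuity. *)
Lemma rep_shrink d r M theta (f : 'rV[R]_d -> R) : 0 <= r -> 0 <= theta <= 1 -> f 0 = 0 ->
  rep r M f -> rep (theta * r) (theta * M) f.
Proof.
move=> r0 /andP[t0 t1] f0 [c [cM e]].
have c0 : c [ffun=> 0%N] = 0.
  move: f0; rewrite e ?normr0// (rsum1 (i0 := [ffun=> 0%N])) ?mon0 ?mulr1//.
  by move=> a a0; rewrite mon_at0 (negPf a0) mulr0.
exists c; split; last first.
  by move=> h hr; apply: e; apply: le_trans hr _; rewrite ler_piMl.
apply: le_trans (asumZ_le t0 cM); apply: le_asum => a.
have [->|a0] := eqVneq a [ffun=> 0%N]; first by rewrite c0 !mul0r mulr0.
rewrite exprMn !normrM (ger0_norm t0) mulrCA ler_wpM2r ?normr_ge0 ?mulr_ge0//.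
rewrite ger0_norm ?exprn_ge0//.
case E : (mdeg a) => [|n]; first by rewrite (mdeg_eq0 E) eqxx in a0.
by rewrite exprS ler_piMr// exprn_ile1.
Qed.

(** Exponent of the monomial divided by [h 0 i]; the subtraction is truncated only if [a i = 0]. *)
Definition mdown d (i : 'I_d) (a : mi d) : mi d := [ffun j => (a j - (j == i))%N].

Lemma mdownK d (i : 'I_d) (a : mi d) : (0 < a i)%N -> madd (mdelta i) (mdown i a) = a.
Proof.
move=> ai; apply/ffunP => j; rewrite !ffunE.
by have [->|] := eqVneq j i; rewrite /= ?subn0//= subnKC.
Qed.

Lemma mdeg_down d (i : 'I_d) (a : mi d) : (0 < a i)%N -> mdeg a = (mdeg (mdown i a)).+1.
Proof. by move=> ai; rewrite -{1}(mdownK ai) mdeg_madd mdeg_delta. Qed.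

Lemma mon_down d (h : 'rV[R]_d) (i : 'I_d) (a : mi d) : (0 < a i)%N ->
  mon h a = h 0 i * mon h (mdown i a).
Proof. by move=> ai; rewrite -{1}(mdownK ai) mon_madd mon_delta. Qed.

Definition zero_at d (i : 'I_d) (h : 'rV[R]_d) : 'rV[R]_d :=
  \row_j if j == i then 0 else h 0 j.

Lemma mon_zero_at d (i : 'I_d) h a : mon (zero_at i h) a = (a i == 0%N)%:R * mon h a.
Proof.
rewrite /mon (bigD1 i)//= [in RHS](bigD1 i)//= mxE eqxx expr0n.
have [->|] := eqVneq (a i) 0%N; last by rewrite !mul0r.
rewrite !mul1r; apply: eq_bigr => j ji.
by rewrite mxE (negPf ji).
Qed.

(** [phi] selects the monomials that are divided by [h 0 i]: all multiples of [h 0 i] in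
    [rep_divide], one class of a partition of the nonconstant monomials in [rep_hadamard]. *)
Lemma rep_quotient d r M (i : 'I_d) (c : mi d -> R) (phi : pred (mi d)) : 0 < r ->
  (forall a, phi a -> (0 < a i)%N) ->
  (asum (fun a => c a * r ^+ mdeg a)%R <= M%:E)%E ->
  rep r (r^-1 * M) (fun h => rsum (fun a => (phi a)%:R * c a * mon h (mdown i a))).
Proof.
move=> r0 phi0 cM.
apply: (@rep_rsum _ _ _ _ _ (fun a => r^-1 * (c a * r ^+ mdeg a))) => // [a|].
  have := rep_scale ((phi a)%:R * c a) (rep_mon r (mdown i a)); apply: rep_le.
  have [/phi0 ai|_] := boolP (phi a); last by rewrite mul0r normr0 mul0r.
  rewrite (mdeg_down ai) mul1r !normrM !normrX.
  by rewrite normfV exprS (gtr0_norm r0) (mulrCA r^-1) mulKf// gt_eqF.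
by apply: asumZ_le => //; rewrite invr_ge0 ltW.
Qed.

(** The monomials free of [h 0 i] sum to the restriction of [f] to [h 0 i = 0]; all others are
    divisible by [h 0 i]. *)
Lemma rep_divide d r M (i : 'I_d) (f : 'rV[R]_d -> R) : 0 < r -> rep r M f ->
  exists2 q, rep r (r^-1 * M) q & forall h, `|h| <= r -> f h = f (zero_at i h) + h 0 i * q h.
Proof.
move=> r0 [c [cM e]].
have qM := rep_quotient (phi := fun a => (0 < a i)%N) r0 (fun a h => h) cM.
eexists; first exact: qM.
move=> h hr.
have zr : `|zero_at i h| <= r.
  apply: rV_norm_le => [|j]; first exact: ltW.
  rewrite mxE; case: ifP => _; first by rewrite normr0 ltW.
  by apply: le_trans hr; exact: rV_coord_le.
rewrite !e// -rsumZ; last first.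
  apply: (@le_lt_trans _ _ (asum (fun a => r^-1 * (c a * r ^+ mdeg a)))); last first.
    by apply: asum_ltoo (asumZ_le _ cM); rewrite invr_ge0 ltW.
  apply: le_asum => a; have [ai|_] := ltnP 0 (a i); last by rewrite !mul0r normr0.
  rewrite mul1r (mdeg_down ai) !normrM (mulrCA `|r^-1|) ler_wpM2l//.
  rewrite normfV normrX exprS mulKf ?normr_eq0 ?gt_eqF//.
  by apply: mon_norm; apply: le_trans hr _; exact: ler_norm.
rewrite -rsumD.
- apply: eq_rsum => a; rewrite mon_zero_at.
  have [ai|] := ltnP 0 (a i); last first.
    by rewrite leqn0 => /eqP ->; rewrite /= !mul0r mulr0 addr0 mul1r.
  by rewrite (gtn_eqF ai) (mon_down h ai) /= mul0r mulr0 add0r mul1r; ring.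
- exact: asum_ltoo (asum_term cM zr).
- apply: (@asum_ltoo _ _ _ M); apply: le_trans (asum_term cM hr); apply: le_asum => a.
  have [ai|_] := ltnP 0 (a i); last by rewrite !mul0r mulr0 normr0.
  by rewrite (mon_down h ai) mul1r mulrCA lexx.
Qed.

Lemma rsum_sum (I : choiceType) (J : Type) (s : seq J) (f : J -> I -> R) :
  (forall j, (asum (f j) < +oo)%E) ->
  (asum (fun i => \sum_(j <- s) f j i)%R < +oo)%E /\
  rsum (fun i => \sum_(j <- s) f j i) = \sum_(j <- s) rsum (f j).
Proof.
move=> fo; elim: s => [|j s [IH1 IH2]].
  have e : (fun i : I => \sum_(j <- [::]) f j i) = (fun=> 0).
    by apply/funext => i; rewrite big_nil.
  by rewrite e big_nil /rsum /asum maxxx oppr0 maxxx subrr esum1// => i _; rewrite normr0.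
have e : (fun i : I => \sum_(j <- j :: s) f j i) = (fun i => f j i + \sum_(j <- s) f j i).
  by apply/funext => i; rewrite big_cons.
rewrite e big_cons rsumD// IH2; split=> //.
by apply: le_lt_trans (asumD_le _ _) _; rewrite lte_add_pinfty.
Qed.

Lemma rep_hadamard d r M (f : 'rV[R]_d -> R) : 0 < r -> rep r M f ->
  exists2 q : 'I_d -> 'rV[R]_d -> R, forall i, rep r (r^-1 * M) (q i) &
    forall h, `|h| <= r -> f h = f 0 + \sum_i h 0 i * q i h.
Proof.
move=> r0 [c [cM e]].
(* Each nonconstant monomial is charged to a single coordinate that occurs in it, the one selected
   by [pick], so that the sum over [i] counts it once. *)
pose phi i (a : mi d) := [pick j | (0 < a j)%N] == Some i.
have phi0 i a : phi i a -> (0 < a i)%N.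
  by rewrite /phi; case: pickP => // j aj /eqP[<-].
exists (fun i h => rsum (fun a => (phi i a)%:R * c a * mon h (mdown i a))).
  by move=> i; apply: rep_quotient => // a; exact: phi0.
move=> h hr.
have qfin i : (asum (fun a => (phi i a)%:R * c a * mon h (mdown i a))%R < +oo)%E.
  apply: (@le_lt_trans _ _ (asum (fun a => r^-1 * (c a * r ^+ mdeg a)))); last first.
    by apply: asum_ltoo (asumZ_le _ cM); rewrite invr_ge0 ltW.
  apply: le_asum => a; have [/phi0 ai|_] := boolP (phi i a); last by rewrite !mul0r normr0.
  rewrite mul1r (mdeg_down ai) !normrM (mulrCA `|r^-1|) ler_wpM2l//.
  rewrite normfV normrX exprS mulKf ?normr_eq0 ?gt_eqF//.
  by apply: mon_norm; apply: le_trans hr _; exact: ler_norm.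
have qfin' i : (asum (fun a => h 0 i * ((phi i a)%:R * c a * mon h (mdown i a)))%R < +oo)%E.
  by rewrite asumZ -(asum_fin (qfin i)) -EFinM ltry.
have [s1 s2] := rsum_sum (index_enum 'I_d) qfin'.
under eq_bigr do rewrite -rsumZ//.
rewrite -s2 e// [f 0]e ?normr0 ?ltW// -rsumD//; last first.
  by apply: asum_ltoo (asum_term cM _); rewrite normr0 ltW.
apply: eq_rsum => a; rewrite mon_at0.
have [->|a0] := eqVneq a [ffun=> 0%N].
  rewrite mon0 big1 ?addr0// => i _.
  have [/phi0|_] := boolP (phi i _); first by rewrite ffunE.
  by rewrite !mul0r mulr0.
have [i ia] : exists i, phi i a.
  rewrite /phi; case: pickP => [i _|h0]; first by exists i; rewrite eqxx.
  by move/eqP: a0; case; apply/ffunP => i; rewrite ffunE; have := h0 i; case: (a i).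
rewrite (bigD1 i)//= big1 => [|j ji]; last first.
  have [pj|_] := boolP (phi j a); last by rewrite !mul0r mulr0.
  by move: ji; move: ia pj; rewrite /phi => /eqP -> /eqP[->]; rewrite eqxx.
rewrite ia mulr0 add0r addr0 (mon_down h (phi0 _ _ ia)) /= mul1r mulrCA.
by [].
Qed.

End Division.

(** * Analytic functions *)

Section LocalAnalyticity.
Context {R : realType}.

Definition anal d (x : 'rV[R]_d) (f : 'rV[R]_d -> R) : Prop :=
  exists r M, 0 < r /\ rep r M (fun h => f (x + h)).

Definition analv d e (x : 'rV[R]_d) (f : 'rV[R]_d -> 'rV[R]_e) : Prop :=
  forall i, anal x (fun z => f z 0 i).

(* On a matrix type, unification exposes the entrywise neighbourhood filter,
   for which no [Filter] instance is found; these lemmas avoid that. *)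
Lemma cvg_atP (V W : normedModType R) (f : V -> W) (x : V) (l : W) :
  f y @[y --> x] --> l <-> (forall e, 0 < e -> \forall y \near x, `|l - f y| <= e).
Proof. by split; move/cvgrPdist_le. Qed.

Lemma near_at (V : normedModType R) (x : V) (P : set V) :
  (\forall y \near x, P y) <-> exists2 r : R, 0 < r & forall h, `|h| < r -> P (x + h).
Proof.
split.
  move=> /nbhs_ballP[r /= r0 h]; exists r => // k kr; apply: h.
  by rewrite -ball_normE /= opprD addNKr normrN.
move=> [r r0 h]; apply/nbhs_ballP; exists r => //= y; rewrite -ball_normE /= => yr.
by rewrite -(subrKC x y); apply: h; rewrite distrC.
Qed.

Lemma near_forall (V : normedModType R) (I : finType) (x : V) (P : I -> set V) :
  (forall i, \forall y \near x, P i y) -> \forall y \near x, forall i, P i y.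
Proof. by move=> h; exact: filter_forall. Qed.

Lemma near_ball d (x : 'rV[R]_d) (P : set 'rV[R]_d) :
  (\forall y \near x, P y) <-> exists2 r : R, 0 < r & forall h, `|h| < r -> P (x + h).
Proof. exact: near_at. Qed.

Lemma anal_ext d (x : 'rV[R]_d) f g :
  (\forall y \near x, f y = g y) -> anal x f -> anal x g.
Proof.
move=> /near_ball[s s0 fg] [r [M [r0 fM]]].
have r'0 : 0 < Num.min r (s / 2) by rewrite lt_min r0 divr_gt0.
exists (Num.min r (s / 2)), M; split=> //.
have : rep (Num.min r (s / 2)) M (fun h => f (x + h)).
  by apply: rep_radius fM; [exact: ltW|rewrite ge_min lexx].
apply: rep_ext => h hr; apply: fg; apply: le_lt_trans hr _.
by rewrite gt_min; apply/orP; right; lra.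
Qed.

Lemma anal_eq d (x : 'rV[R]_d) f g : f =1 g -> anal x f -> anal x g.
Proof. by move=> /funext ->. Qed.

Lemma anal_common d (x : 'rV[R]_d) (I : finType) (f : I -> 'rV[R]_d -> R) :
  (forall i, anal x (f i)) ->
  exists r M, 0 < r /\ forall i, rep r M (fun h => f i (x + h)).
Proof.
move=> /choice[r /choice[M rM]].
exists (\big[Num.min/1]_i r i), (\sum_i M i); split.
  by apply/bigmin_gtP; split=> // i _; case: (rM i).
move=> i; have [r0 h] := rM i.
apply: (@rep_le _ _ _ (M i)).
  rewrite (bigD1 i)//= lerDl sumr_ge0// => j _.
  by have [_ h'] := rM j; exact: rep_ge0 h'.
apply: rep_radius h; last exact: bigmin_le_cond.
by apply: ltW; apply/bigmin_gtP; split=> // j _; case: (rM j).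
Qed.

Lemma anal_const d (x : 'rV[R]_d) (k : R) : anal x (fun=> k).
Proof. by exists 1, `|k|; split=> //; exact: rep_const. Qed.

Lemma anal_coord d (x : 'rV[R]_d) i : anal x (fun z => z 0 i).
Proof.
exists 1, (`|x 0 i| + 1); split=> //.
apply: rep_ext (rep_add (rep_const _ _ (x 0 i)) (rep_coord i ler01)) => h _.
by rewrite mxE.
Qed.

Lemma anal_pair d (x : 'rV[R]_d) f g : anal x f -> anal x g ->
  exists r M, [/\ 0 < r, rep r M (fun h => f (x + h)) & rep r M (fun h => g (x + h))].
Proof.
move=> fx gx; have [|r [M [r0 h]]] := @anal_common _ x bool (fun b => if b then f else g).
  by case.
by exists r, M; split=> //; [apply: (h true)|apply: (h false)].
Qed.

Lemma anal_add d (x : 'rV[R]_d) f g : anal x f -> anal x g -> anal x (fun z => f z + g z).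
Proof.
move=> fx gx; have [r [M [r0 fM gM]]] := anal_pair fx gx.
by exists r, (M + M); split=> //; exact: rep_add fM gM.
Qed.

Lemma anal_mul d (x : 'rV[R]_d) f g : anal x f -> anal x g -> anal x (fun z => f z * g z).
Proof.
move=> fx gx; have [r [M [r0 fM gM]]] := anal_pair fx gx.
by exists r, (M * M); split=> //; exact: rep_mul fM gM.
Qed.

Lemma anal_opp d (x : 'rV[R]_d) f : anal x f -> anal x (fun z => - f z).
Proof. by move=> [r [M [r0 h]]]; exists r, M; split=> //; exact: rep_opp. Qed.

Lemma anal_sub d (x : 'rV[R]_d) f g : anal x f -> anal x g -> anal x (fun z => f z - g z).
Proof. by move=> fx /anal_opp; exact: anal_add. Qed.

Lemma anal_exp d (x : 'rV[R]_d) f n : anal x f -> anal x (fun z => f z ^+ n).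
Proof. by move=> [r [M [r0 h]]]; exists r, (M ^+ n); split=> //; exact: rep_exp. Qed.

Lemma anal_sum d (x : 'rV[R]_d) (I : Type) (s : seq I) (f : I -> 'rV[R]_d -> R) :
  (forall i, anal x (f i)) -> anal x (fun z => \sum_(i <- s) f i z).
Proof.
move=> fx; elim: s => [|i s IH].
  by apply: anal_eq (anal_const x 0) => y; rewrite big_nil.
by apply: anal_eq (anal_add (fx i) IH) => y; rewrite big_cons.
Qed.

(** The increments [G (x + h) - G x] vanish at [h = 0], so on a small polydisc [rep_shrink] brings
    their norm below the radius [s] of [F]. *)
Lemma anal_comp d e (x : 'rV[R]_d) (G : 'rV[R]_d -> 'rV[R]_e) F :
  analv x G -> anal (G x) F -> anal x (fun z => F (G z)).
Proof.
move=> Gx [s [M [s0 FM]]].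
have /anal_common[r [N [r0 GN]]] : forall i, anal x (fun z => G z 0 i - G x 0 i).
  by move=> i; apply: anal_sub (anal_const _ _); exact: Gx.
set K := Num.max N 1.
have K0 : 0 < K by rewrite lt_max ltr01 orbT.
set theta := Num.min 1 (s / K).
have t0 : 0 < theta by rewrite lt_min ltr01 divr_gt0.
have t1 : theta <= 1 by rewrite ge_min lexx.
have tK : theta * K <= s by rewrite -ler_pdivlMr// ge_min lexx orbT.
have GN' i : rep (theta * r) s (fun h => (G (x + h) - G x) 0 i).
  apply: (@rep_le _ _ _ (theta * K)) => //.
  apply: (@rep_ext _ _ _ _ (fun h => G (x + h) 0 i - G x 0 i)) => [h _|].
    by rewrite !mxE.
  apply: rep_shrink; rewrite ?addr0 ?subrr ?t1 ?(ltW t0) ?(ltW r0)//.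
  by apply: rep_le (GN i); rewrite le_max lexx.
exists (theta * r), M; split; first by rewrite mulr_gt0.
have := rep_comp (mulr_gt0 t0 r0) (ltW s0) GN' FM.
by apply: rep_ext => h _; rewrite subrKC.
Qed.

Lemma analv_comp d e k (x : 'rV[R]_d) (G : 'rV[R]_d -> 'rV[R]_e) (F : 'rV[R]_e -> 'rV[R]_k) :
  analv x G -> analv (G x) F -> analv x (fun z => F (G z)).
Proof. by move=> Gx Fx i; apply: (anal_comp (F := fun y => F y 0 i)) Gx (Fx i). Qed.

(** Recentring at [x + h] is the substitution [k |-> h + k]; for [k] up to half the distance to the
    boundary its coordinates have norm at most [r]. *)
Lemma rep_anal d r M (f : 'rV[R]_d -> R) (x h : 'rV[R]_d) : `|h| < r ->
  rep r M (fun k => f (x + k)) -> anal (x + h) f.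
Proof.
move=> hr fM; have h0 : 0 <= `|h| by [].
exists ((r - `|h|) / 2), M; split; first by lra.
have s0 : 0 < (r - `|h|) / 2 by lra.
have hc i : rep ((r - `|h|) / 2) r (fun k => (h + k) 0 i).
  apply: (@rep_ext _ _ _ _ (fun k => h 0 i + k 0 i)) => [k _|]; first by rewrite mxE.
  apply: (@rep_le _ _ _ (`|h 0 i| + (r - `|h|) / 2)); last first.
    by apply: rep_add (rep_const _ _ _) (rep_coord _ _); exact: ltW.
  by have := rV_coord_le h i; lra.
have r0 : 0 <= r by lra.
have := rep_comp s0 r0 hc fM; apply: rep_ext.
by move=> k _; rewrite addrA.
Qed.

Lemma anal_near d (x : 'rV[R]_d) f : anal x f -> \forall y \near x, anal y f.
Proof.
move=> [r [M [r0 fM]]]; apply/near_ball; exists r => // h hr.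
exact: rep_anal hr fM.
Qed.

Lemma anal_continuous d (x : 'rV[R]_d) f : anal x f -> {for x, continuous f}.
Proof.
move=> [r [M [r0 fM]]]; apply/cvg_atP => /= e e0; apply/near_ball.
set K := Num.max (M + `|f x|) 1.
have K0 : 0 < K by rewrite lt_max ltr01 orbT.
set theta := Num.min 1 (e / K).
have t0 : 0 < theta by rewrite lt_min ltr01 divr_gt0.
have t1 : theta <= 1 by rewrite ge_min lexx.
have tK : theta * K <= e by rewrite -ler_pdivlMr// ge_min lexx orbT.
exists (theta * r); first by rewrite mulr_gt0.
move=> h hr; rewrite distrC; apply: le_trans tK.
have /rep_norm : rep (theta * r) (theta * K) (fun h => f (x + h) - f x).
  apply: rep_shrink; rewrite ?addr0 ?subrr ?t1 ?(ltW t0) ?(ltW r0)//.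
  apply: rep_le (rep_sub fM (rep_const _ _ (f x))).
  by rewrite le_max lexx.
by apply; exact: ltW.
Qed.

Lemma analv_row_mx d e k (x : 'rV[R]_d) (F : 'rV[R]_d -> 'rV[R]_e) (G : 'rV[R]_d -> 'rV[R]_k) :
  analv x F -> analv x G -> analv x (fun z => row_mx (F z) (G z)).
Proof.
move=> Fx Gx i; case: (split_ordP i) => j ->.
  by apply: anal_eq (Fx j) => z; rewrite row_mxEl.
by apply: anal_eq (Gx j) => z; rewrite row_mxEr.
Qed.

Lemma analv_scalar d (x : 'rV[R]_d) (f : 'rV[R]_d -> R) : anal x f ->
  analv x (fun z => (f z)%:M : 'rV[R]_1).
Proof.
by move=> fx i; apply: anal_eq fx => z; rewrite (ord1 i) mxE eqxx mulr1n.
Qed.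

Lemma analv_lsub d e (x : 'rV[R]_(d + e)) : analv x (fun z => lsubmx z).
Proof.
by move=> i; apply: anal_eq (anal_coord x (lshift e i)) => z; rewrite mxE.
Qed.

Lemma analv_rsub d e (x : 'rV[R]_(d + e)) : analv x (fun z => rsubmx z).
Proof.
by move=> i; apply: anal_eq (anal_coord x (rshift d i)) => z; rewrite mxE.
Qed.

Lemma analv_add d e (x : 'rV[R]_d) (f g : 'rV[R]_d -> 'rV[R]_e) :
  analv x f -> analv x g -> analv x (fun z => f z + g z).
Proof.
move=> fx gx i; apply: anal_eq (anal_add (fx i) (gx i)).
by move=> y; rewrite mxE.
Qed.

Lemma analv_scale d e (x : 'rV[R]_d) (k : 'rV[R]_d -> R) (g : 'rV[R]_d -> 'rV[R]_e) :
  anal x k -> analv x g -> analv x (fun z => k z *: g z).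
Proof.
move=> fx gx i; apply: anal_eq (anal_mul fx (gx i)).
by move=> y; rewrite mxE.
Qed.

Lemma analv_const d e (x : 'rV[R]_d) (k : 'rV[R]_e) : analv x (fun=> k).
Proof. by move=> i; exact: anal_const. Qed.

Lemma analv_ext d e (x : 'rV[R]_d) (f g : 'rV[R]_d -> 'rV[R]_e) :
  (\forall y \near x, f y = g y) -> analv x f -> analv x g.
Proof.
by move=> fg fx i; apply: anal_ext (fx i); near=> y; rewrite (near fg y).
Unshelve. all: by end_near. Qed.

Lemma analv_near d e (x : 'rV[R]_d) (f : 'rV[R]_d -> 'rV[R]_e) :
  analv x f -> \forall y \near x, analv y f.
Proof. by move=> fx; apply: near_forall => i; exact: anal_near. Qed.

Lemma rV_coord_cvg d (T : Type) (F : set_system T) {FF : Filter F} (f : T -> 'rV[R]_d) (l : 'rV[R]_d) :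
  f @ F --> l -> forall i, (fun z => f z 0 i) @ F --> l 0 i.
Proof.
move=> fl i; apply: (cvg_comp f (fun M : 'rV[R]_d => M 0 i) fl).
exact: coord_continuous.
Qed.

Lemma rV_cvg d (T : Type) (F : set_system T) {FF : Filter F} (f : T -> 'rV[R]_d) (l : 'rV[R]_d) :
  (forall i, (fun z => f z 0 i) @ F --> l 0 i) -> f @ F --> l.
Proof.
move=> fl; apply/cvgrPdist_le => e e0.
have h : \forall y \near F, forall i, `|l 0 i - f y 0 i| <= e.
  by apply: filter_forall => i; have /cvgrPdist_le := fl i; exact.
near=> y; apply: rV_norm_le => [|i]; first exact: ltW.
by rewrite !mxE; move: i; near: y.
Unshelve. all: by end_near. Qed.

Lemma analv_continuous d e (x : 'rV[R]_d) (f : 'rV[R]_d -> 'rV[R]_e) :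
  analv x f -> {for x, continuous f}.
Proof.
move=> fx; apply/cvg_atP => r r0; apply/near_ball.
have /near_ball[s s0 sP] : \forall y \near x, forall i, `|f x 0 i - f y 0 i| <= r.
  by apply: near_forall => i; have /cvg_atP/(_ _ r0) := anal_continuous (fx i).
exists s => // h hs; apply: rV_norm_le => [|i]; first exact: ltW.
by rewrite !mxE; exact: sP.
Qed.

End LocalAnalyticity.

(** * Derivatives of analytic functions *)

Section Derivatives.
Context {R : realType}.

Lemma is_derive_coords (V : normedModType R) d (x v : V) (f : V -> 'rV[R]_d) (l : 'rV[R]_d) :
  (forall i, is_derive x v (fun z => f z 0 i) (l 0 i)) -> is_derive x v f l.
Proof.
move=> h; have dv : derivable f x v.
  by apply/derivable_mxP => i j; rewrite (ord1 i); have [] := h j.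
apply: DeriveDef => //; rewrite derive_mx//; apply/rowP => j; rewrite mxE.
by have [_ ->] := h j.
Qed.

Lemma is_derive_coord (V : normedModType R) d (x v : V) (f : V -> 'rV[R]_d) (l : 'rV[R]_d) :
  is_derive x v f l -> forall i, is_derive x v (fun z => f z 0 i) (l 0 i).
Proof.
move=> [dv e] i; have := (derivable_mxP _ _ _).1 dv 0 i => h.
by apply: DeriveDef => //; rewrite -e derive_mx// mxE.
Qed.

(** From Hadamard's formula [f (x + u) = f x + \sum_i u 0 i * q i u] with continuous [q i]. The
    coefficients [c] are chosen before the inner map [H], so that taking [H = id] identifies them
    with the partial derivatives in [anal_chain]. *)
Lemma anal_chain0 d (x : 'rV[R]_d) (f : 'rV[R]_d -> R) : anal x f ->
  exists c : 'rV[R]_d,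
  forall (V : normedModType R) (y v : V) (H : V -> 'rV[R]_d) (H' : 'rV[R]_d),
    H y = x -> is_derive y v H H' ->
    is_derive y v (fun z => f (H z)) (\sum_i H' 0 i * c 0 i).
Proof.
move=> [r [M [r0 fM]]]; have [q qM qe] := rep_hadamard r0 fM.
exists (\row_i q i 0) => V y v H H' Hx Hd.
have Hq : h^-1 *: (H (h *: v + y) - H y) @[h --> 0^'] --> H'.
  by have [dv <-] := Hd; exact: dv.
have H0 : H (h *: v + y) - H y @[h --> 0^'] --> (0 : 'rV[R]_d).
  have : h *: (h^-1 *: (H (h *: v + y) - H y)) @[h --> 0^'] --> (0 : R) *: H'.
    by apply: cvgZ => //; exact: nbhs_dnbhs.
  rewrite scale0r; apply: cvg_trans; apply: near_eq_cvg; near=> h.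
  rewrite scalerA divff ?scale1r//; near: h; exact: nbhs_dnbhs_neq.
suff h : h^-1 *: (f (H (h *: v + y)) - f (H y)) @[h --> 0^'] -->
    \sum_i H' 0 i * (\row_i q i 0 : 'rV[R]_d) 0 i.
  by apply: DeriveDef; [apply/cvg_ex; eexists; exact: h|exact/cvg_lim].
have : \sum_i (h^-1 *: (H (h *: v + y) - H y)) 0 i * q i (H (h *: v + y) - H y)
    @[h --> 0^'] --> \sum_i H' 0 i * (\row_i q i 0 : 'rV[R]_d) 0 i.
  apply: cvg_big => [|i _]; first exact: add_continuous.
  apply: cvgM.
    exact: (rV_coord_cvg Hq).
  rewrite mxE; apply: (cvg_comp _ (q i) H0).
  apply: (@anal_continuous R d 0 (q i)).
  exists r, (r^-1 * M); split=> //; apply: rep_ext (qM i) => h _; by rewrite add0r.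
apply: cvg_trans; apply: near_eq_cvg; near=> h.
have hr : `|H (h *: v + y) - H y| <= r.
  near: h; move/cvgrPdist_le : H0 => /(_ r r0); apply: filterS => h.
  by rewrite sub0r normrN.
have := qe _ hr; rewrite addr0 Hx subrKC => ->.
rewrite (addrC (f x)) addrK scaler_sumr; apply: eq_bigr => i _.
set u := H _ - x; have -> : (h^-1 *: u) 0 i = h^-1 * u 0 i by rewrite mxE.
by rewrite -mulrA.
Unshelve. all: by end_near. Qed.

Lemma anal_chain d (V : normedModType R) (y v : V) (H : V -> 'rV[R]_d) (H' : 'rV[R]_d) f :
  anal (H y) f -> is_derive y v H H' ->
  is_derive y v (fun z => f (H z)) (\sum_i H' 0 i * partial i f (H y)).
Proof.
move=> /anal_chain0[c hc] Hd.
have pc i : partial i f (H y) = c 0 i.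
  have [_ e] := hc 'rV[R]_d (H y) (delta_mx 0 i) id _ erefl (is_derive_id _ _).
  rewrite /partial e (bigD1 i)//= big1 => [|j ji]; first by rewrite !mxE !eqxx mul1r addr0.
  by rewrite mxE (negPf ji) andbF mul0r.
under eq_bigr do rewrite pc.
exact: hc.
Qed.

(** The divided difference is itself analytic in [h] and [t]: substitute [h + t *: delta_mx 0 i] and
    divide by the coordinate [t]. Its value at [t = 0] is the partial derivative, which is therefore
    analytic without any termwise differentiation. Half the radius keeps the sum in the polydisc. *)
Lemma rep_increment d (x : 'rV[R]_d) r M (f : 'rV[R]_d -> R) i : 0 < r ->
  rep r M (fun h => f (x + h)) ->
  exists2 q : 'rV[R]_(d + 1) -> R, rep (r / 2) ((r / 2)^-1 * M) q &
    forall h t, `|h| < r / 2 -> `|t| < r / 2 ->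
      f (x + (h + t *: delta_mx 0 i)) = f (x + h) + t * q (row_mx h t%:M).
Proof.
move=> r0 fM.
set s := r / 2; have s0 : 0 < s by rewrite divr_gt0.
pose G (w : 'rV[R]_(d + 1)) : 'rV[R]_d := lsubmx w + w 0 (rshift d 0) *: delta_mx 0 i.
have Gr j : rep s r (fun w => G w 0 j).
  apply: (@rep_ext _ _ _ _ (fun w : 'rV[R]_(d + 1) =>
     w 0 (lshift 1 j) + (j == i)%:R * w 0 (rshift d 0))) => [w _|].
    by rewrite !mxE eqxx /= mulrC.
  apply: (@rep_le _ _ _ (s + `|(j == i)%:R| * s)); last first.
    by apply: rep_add; [|apply: rep_scale]; apply: rep_coord; exact: ltW.
  by case: (j == i); rewrite /= ?normr1 ?normr0 /s; lra.
have KM : rep s M (fun w => f (x + G w)) by apply: rep_comp Gr fM; [|exact: ltW].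
have [q qM qe] := rep_divide (rshift d 0) s0 KM.
exists q => // h t hs ts.
have : `|row_mx h t%:M : 'rV[R]_(d + 1)| <= s.
  apply: ltW; apply: rV_norm_lt => // j; case: (split_ordP j) => k ->.
    by rewrite row_mxEl; apply: le_lt_trans hs; exact: rV_coord_le.
  by rewrite row_mxEr (ord1 k) mxE eqxx mulr1n.
move=> /qe.
have -> : G (row_mx h t%:M) = h + t *: delta_mx 0 i.
  by rewrite /G row_mxKl row_mxEr mxE eqxx mulr1n.
have -> : G (zero_at (rshift d 0) (row_mx h t%:M)) = h.
  apply/rowP => j; rewrite /G !mxE eqxx mul0r addr0 eq_lrshift.
  by rewrite (unsplitK (inl _)).
by rewrite row_mxEr mxE eqxx mulr1n.
Qed.

Lemma increment_derive d (x : 'rV[R]_d) s N (f : 'rV[R]_d -> R) q i h : 0 < s ->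
  rep s N q -> `|h| < s ->
  (forall h t, `|h| < s -> `|t| < s ->
      f (x + (h + t *: delta_mx 0 i)) = f (x + h) + t * q (row_mx h t%:M)) ->
  is_derive (x + h) (delta_mx 0 i) f (q (row_mx h 0)).
Proof.
move=> s0 qM hs qe.
suff qd : t^-1 *: (f (t *: delta_mx 0 i + (x + h)) - f (x + h)) @[t --> 0^'] --> q (row_mx h 0).
  by apply: DeriveDef; [apply/cvg_ex; eexists; exact: qd|exact/cvg_lim].
have : q (row_mx h t%:M) @[t --> (0 : R)] --> q (row_mx h 0).
  have -> : (0 : 'rV[R]_1) = (0 : R)%:M by apply/rowP => j; rewrite !mxE mul0rn.
  have e0 : `|row_mx h (0 : R)%:M : 'rV[R]_(d + 1)| < s.
    apply: rV_norm_lt => // j; case: (split_ordP j) => k ->.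
      by rewrite row_mxEl; apply: le_lt_trans hs; exact: rV_coord_le.
    by rewrite row_mxEr (ord1 k) mxE eqxx mulr1n normr0.
  have : rep s N (fun w => q (0 + w)) by apply: rep_ext qM => w _; rewrite add0r.
  move=> /(rep_anal e0); rewrite add0r => /anal_continuous qc.
  suff fc : (fun t : R => row_mx h t%:M : 'rV[R]_(d + 1)) t @[t --> (0 : R)] -->
      (row_mx h 0%:M : 'rV[R]_(d + 1)) by exact: (cvg_comp _ q fc qc).
  apply/cvg_atP => e egt0; apply/near_at; exists e => // k ke.
  rewrite add0r opp_row_mx add_row_mx subrr; apply: ltW.
  apply: rV_norm_lt => // j; case: (split_ordP j) => j' ->.
    by rewrite row_mxEl mxE normr0.
  by rewrite row_mxEr !mxE (ord1 j') eqxx !mulr1n sub0r normrN.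
move=> /cvg_atP qc; apply/cvgrPdist_le => e egt0.
have := qc _ egt0 => {}qc; near=> t.
have t0 : t != 0 by near: t; exact: nbhs_dnbhs_neq.
have ts : `|t| < s by near: t; exact: dnbhs0_lt.
have -> : t *: delta_mx 0 i + (x + h) = x + (h + t *: delta_mx 0 i) by rewrite addrC addrA.
rewrite qe//.
rewrite addrAC subrr add0r /GRing.scale/= mulrA mulVf// mul1r.
by near: t; exact: nbhs_dnbhs.
Unshelve. all: by end_near. Qed.

Lemma anal_partial d (x : 'rV[R]_d) f i : anal x f -> anal x (partial i f).
Proof.
move=> [r [M [r0 fM]]]; have [q qM qe] := rep_increment i r0 fM.
set s := r / 2 in qM qe; have s0 : 0 < s by rewrite divr_gt0.
exists (s / 2), (s^-1 * M); split; first by rewrite divr_gt0.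
apply: (@rep_ext _ _ _ _ (fun h => q (row_mx h 0))) => [h hs|].
  have hs' : `|h| < s by apply: le_lt_trans hs _; rewrite ltr_pdivrMr//; lra.
  by have [_ <-] := increment_derive s0 qM hs' qe.
apply: (@rep_radius _ _ s (s / 2)); [by rewrite divr_ge0 ?(ltW s0)| |].
  by rewrite ler_pdivrMr//; lra.
apply: (rep_comp s0 (ltW s0) _ qM).
move=> j; case: (split_ordP j) => j' ->.
  by apply: rep_ext (rep_coord j' (ltW s0)) => h _; rewrite row_mxEl.
apply: (@rep_le _ _ _ `|0|); first by rewrite normr0 ltW.
by apply: rep_ext (rep_const _ _ 0) => h _; rewrite row_mxEr mxE.
Qed.

(* The increments are themselves given by summable power series, hence so is
   the derivative of the sum. *)
Lemma rep_rsum_derive d (I : choiceType) r (m : I -> R) (F G : I -> 'rV[R]_d -> R) i : 0 < r ->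
  (forall k, rep r `|m k| (F k)) -> (asum m < +oo)%E ->
  (forall k h, `|h| < r / 2 -> is_derive h (delta_mx 0 i) (F k) (G k h)) ->
  forall h, `|h| < r / 2 ->
    is_derive h (delta_mx 0 i) (fun h => rsum (fun k => F k h)) (rsum (fun k => G k h)).
Proof.
move=> r0 Fm mo FG h hr.
have /choice[q qP] k : exists q : 'rV[R]_(d + 1) -> R, rep (r / 2) ((r / 2)^-1 * `|m k|) q /\
    forall h t, `|h| < r / 2 -> `|t| < r / 2 ->
      F k (0 + (h + t *: delta_mx 0 i)) = F k (0 + h) + t * q (row_mx h t%:M).
  have [|q q1 q2] := @rep_increment _ 0 _ `|m k| (F k) i r0; last by exists q.
  by apply: rep_ext (Fm k) => z _; rewrite add0r.
set s := r / 2 in FG hr qP; have s0 : 0 < s by rewrite divr_gt0.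
have mqo : (asum (fun k => s^-1 * m k)%R <= (s^-1 * fine (asum m))%:E)%E.
  by apply: asumZ_le; rewrite ?invr_ge0 ?(ltW s0)// asum_fin.
have qM : rep s (s^-1 * fine (asum m)) (fun z => rsum (fun k => q k z)).
  apply: (rep_rsum s0 _ mqo) => k; rewrite normrM gtr0_norm ?invr_gt0//.
  by have [] := qP k.
have qfin z : `|z| <= s -> (asum (fun k => q k z) < +oo)%E.
  move=> zs; apply: le_lt_trans (asum_ltoo mqo); apply: le_asum => k.
  have [qk _] := qP k; apply: le_trans (rep_norm qk zs) _.
  by rewrite normrM (gtr0_norm (x := s^-1)) ?invr_gt0.
have Ffin z : `|z| <= r -> (asum (fun k => F k z) < +oo)%E.
  move=> zr; apply: le_lt_trans mo; apply: le_asum => k.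
  exact: rep_norm (Fm k) zr.
have emb z t : `|z| < s -> `|t| < s -> `|row_mx z t%:M : 'rV[R]_(d + 1)| <= s.
  move=> zs ts; apply: ltW; apply: rV_norm_lt => // j; case: (split_ordP j) => k ->.
    by rewrite row_mxEl; apply: le_lt_trans zs; exact: rV_coord_le.
  by rewrite row_mxEr (ord1 k) mxE eqxx mulr1n.
have -> : rsum (fun k => G k h) = rsum (fun k => q k (row_mx h 0)).
  apply: eq_rsum => k; have [_ <-] := FG k h hr; have [q1 q2] := qP k.
  by have [_] := increment_derive s0 q1 hr q2; rewrite add0r.
rewrite -[X in is_derive X]add0r; apply: (increment_derive s0 qM hr) => z t zs ts.
rewrite -rsumZ ?qfin ?emb// -rsumD.
- by apply: eq_rsum => k; have [_ ->] := qP k.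
- by apply: Ffin; rewrite add0r ltW// (lt_trans zs)// /s; lra.
- by rewrite asumZ -(asum_fin (qfin _ (emb _ _ zs ts))) -EFinM ltry.
Qed.

End Derivatives.

(** * Comparison with the power series of [analytic_on] *)

Section Conversion.
Context {R : realType}.

Definition mi_of d k (a : {ffun 'I_d -> 'I_k}) : mi d := [ffun i => nat_of_ord (a i)].

Lemma mi_of_inj d k : injective (@mi_of d k).
Proof.
move=> a b /ffunP ab; apply/ffunP => i; apply: val_inj.
by have := ab i; rewrite !ffunE.
Qed.

(** [analytic_on] sums over growing cubes of multi-indices. A finite set [X] that nearly exhausts
    the total is contained in every large enough cube. *)
Lemma cube_cvg_ge0 d (p : mi d -> R) : (forall a, 0 <= p a) -> (asum p < +oo)%E ->
  (fun k : nat => \sum_(a : {ffun 'I_d -> 'I_k}) p (mi_of a)) @ \oo --> fine (asum p).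
Proof.
move=> p0 po; apply/cvgrPdist_le => e e0.
have : ((fine (asum p) - e)%:E < asum p)%E.
  by rewrite -[ltRHS](asum_fin po) lte_fin ltrBlDr ltrDl.
move=> /ereal_sup_gt[_ [X [finX _] <-]].
rewrite fsbig_finite//= sumEFin lte_fin => Xe.
pose K := (\max_(a <- fset_set X) \max_i a i).+1.
near=> k.
have Kk : (K <= k)%N by near: k; exact: nbhs_infty_ge.
pose t := [seq mi_of a | a : {ffun 'I_d -> 'I_k}].
have tu : uniq t by rewrite map_inj_uniq ?enum_uniq//; exact: mi_of_inj.
have tE : \sum_(a : {ffun 'I_d -> 'I_k}) p (mi_of a) = \sum_(a <- t) p a.
  by rewrite /t big_map big_enum.
have Xt : {subset fset_set X <= t}.
  move=> a aX.
  have ak i : (a i < k)%N.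
    apply: leq_trans Kk; rewrite /K ltnS.
    apply: leq_trans (leq_bigmax_seq _ aX isT).
    exact: (leq_bigmax i).
  apply/mapP; exists [ffun i => Ordinal (ak i)]; first by rewrite mem_enum.
  by apply/ffunP => i; rewrite !ffunE.
have le1 : \sum_(a <- fset_set X) `|p a| <= \sum_(a <- t) p a.
  rewrite [leRHS](bigID (mem (fset_set X)))/= -[leLHS]addr0 lerD ?sumr_ge0//.
  rewrite -[leRHS]big_filter [leRHS](perm_big (fset_set X)); last first.
    apply: uniq_perm; rewrite ?filter_uniq ?fset_uniq//.
    move=> a; rewrite mem_filter /=; have := Xt a.
    by case: (a \in _) => //= ->.
  by apply: ler_sum => a _; rewrite ger0_norm.
have le2 : \sum_(a <- t) p a <= fine (asum p).
  rewrite -lee_fin asum_fin//; apply: esum_ge.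
  exists [set` t]; first by split=> //; exact: finite_seq.
  rewrite -fsbig_seq//= sumEFin lee_fin; apply: ler_sum => a _; exact: ler_norm.
rewrite tE ger0_norm; last by rewrite subr_ge0.
by lra.
Unshelve. all: by end_near. Qed.

Lemma cube_cvg d (g : mi d -> R) : (asum g < +oo)%E ->
  (fun k : nat => \sum_(a : {ffun 'I_d -> 'I_k}) g (mi_of a)) @ \oo --> rsum g.
Proof.
move=> go; have [p0 q0 po qo e] := posneg g.
rewrite (_ : (fun k => _) = (fun k : nat =>
  \sum_(a : {ffun 'I_d -> 'I_k}) Num.max (g (mi_of a)) 0 -
  \sum_(a : {ffun 'I_d -> 'I_k}) Num.max (- g (mi_of a)) 0)); last first.
  by apply/funext => k; rewrite -sumrB; apply: eq_bigr => a _; exact: e.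
apply: cvgB.
  by apply: (cube_cvg_ge0 p0); exact: le_lt_trans go.
by apply: (cube_cvg_ge0 q0); exact: le_lt_trans go.
Qed.

Lemma analytic_on_anal d e (S : set 'rV[R]_d) (f : 'rV[R]_d -> 'rV[R]_e) x :
  analytic_on S f -> S x -> (\forall y \near x, S y) -> analv x f.
Proof.
move=> fS Sx /near_ball[s s0 xS] j.
have [c [r [r0 rc cf]]] := fS x Sx.
(* [s] keeps [x + h] in [S]. The halves are taken because [rep] is about a closed polydisc, whereas
   the expansion holds for [|h| < r] only. *)
exists (Num.min (s / 2) (r / 2)).
set t := Num.min _ _.
have t0 : 0 < t by rewrite lt_min !divr_gt0.
have ts : t <= s / 2 by rewrite ge_min lexx.
have tr : t <= r / 2 by rewrite ge_min lexx orbT.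
have co : (asum (fun a : mi d => `|c a| * r ^+ mdeg a)%R < +oo)%E by exact: rc.
have cb : (asum (fun a : mi d => c a 0 j * t ^+ mdeg a)%R <=
    (fine (asum (fun a : mi d => `|c a| * r ^+ mdeg a)))%:E)%E.
  rewrite asum_fin//; apply: le_asum => a; rewrite !normrM normr_id ler_pM//.
    exact: rV_coord_le.
  by rewrite !ger0_norm ?exprn_ge0 ?(ltW t0) ?(ltW r0)// lerXn2r ?nnegrE ?(ltW t0) ?(ltW r0)//; lra.
exists (fine (asum (fun a : mi d => `|c a| * r ^+ mdeg a))); split=> //.
exists (fun a => c a 0 j); split=> // h ht.
have hr : `|h| < r by lra.
have hs : `|h| < s by lra.
pose proof (rV_coord_cvg (i := j) (cf h hr (xS _ hs))) as h1.
have h2 := cube_cvg (asum_ltoo (asum_term cb ht)).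
suff e' : (fun k : nat => (\sum_(a : {ffun 'I_d -> 'I_k})
      (\prod_i h 0 i ^+ a i) *: c [ffun i => nat_of_ord (a i)]) 0 j) =
    (fun k : nat => \sum_(a : {ffun 'I_d -> 'I_k}) c (mi_of a) 0 j * mon h (mi_of a)).
  by rewrite e' in h1; rewrite -(cvg_lim _ h1) // -(cvg_lim _ h2).
apply/funext => k; rewrite summxE; apply: eq_bigr => a _.
rewrite mxE mulrC; congr (_ * _); apply: eq_bigr => i _; by rewrite ffunE.
Qed.

(** [S] may have boundary points, such as those with [e = 0], and nothing is required of [f] outside
    [S]; the power series is that of [F]. *)
Lemma anal_analytic_on d e (S : set 'rV[R]_d) (f : 'rV[R]_d -> 'rV[R]_e) :
  (forall x, S x -> exists2 F, analv x F & \forall y \near x, S y -> f y = F y) ->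
  analytic_on S f.
Proof.
move=> h x Sx; have [F Fx /near_ball[s s0 fF]] := h x Sx.
have [r [M [r0 FM]]] := anal_common Fx.
have /choice[c cP] := FM.
pose t := Num.min (s / 2) r.
have t0 : 0 < t by rewrite lt_min r0 divr_gt0.
have ts : t <= s / 2 by rewrite ge_min lexx.
have tr : t <= r by rewrite ge_min lexx orbT.
exists (fun a : mi d => \row_j c j a), t; split=> //.
  apply: (@le_lt_trans _ _ (asum (fun a : mi d => \sum_j `|c j a| * t ^+ mdeg a))).
    apply: le_esum => a _ /=; rewrite lee_fin.
    rewrite [leRHS]ger0_norm; last first.
      by apply: sumr_ge0 => j _; rewrite mulr_ge0// exprn_ge0// ltW.
    rewrite normrM normr_id -mulr_suml.
    rewrite [X in _ * X]ger0_norm ?exprn_ge0 ?(ltW t0)// ler_wpM2r ?exprn_ge0 ?(ltW t0)//.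
    apply: rV_norm_le => [|j]; first by apply: sumr_ge0.
    by rewrite mxE (bigD1 j)//= lerDl sumr_ge0.
  have cfin j : (asum (fun a : mi d => `|c j a| * t ^+ mdeg a)%R < +oo)%E.
    have [cM _] := cP j; apply: (@asum_ltoo _ _ _ M); apply: le_trans cM.
    apply: le_asum => a; rewrite !normrM normr_id ler_wpM2l//.
    by rewrite !ger0_norm ?exprn_ge0 ?(ltW t0) ?(ltW r0)// lerXn2r ?nnegrE ?(ltW t0) ?(ltW r0).
  by have [] := rsum_sum (index_enum 'I_e) cfin.
move=> k kt Sk; rewrite fF//; last by lra.
apply: rV_cvg => j.
have [cM ->] := cP j; last by rewrite ltW// (lt_le_trans kt).
have kr : `|k| <= r by rewrite ltW// (lt_le_trans kt).
have := cube_cvg (asum_ltoo (asum_term cM kr)).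
suff -> : (fun n : nat => \sum_(a : {ffun 'I_d -> 'I_n}) c j (mi_of a) * mon k (mi_of a)) =
    (fun n : nat => (\sum_(a : {ffun 'I_d -> 'I_n})
      (\prod_i k 0 i ^+ a i) *: (\row_j c j (mi_of a) : 'rV[R]_e)) 0 j) by [].
apply/funext => n; rewrite summxE; apply: eq_bigr => a _.
rewrite !mxE mulrC; congr (_ * _); apply: eq_bigr => i _; by rewrite ffunE.
Qed.

End Conversion.

(** * Picard iteration and local flows *)

Section FixedPoint.
Context {R : realType}.

Lemma series_cvg_ge0 (p : nat -> R) : (forall n, 0 <= p n) -> (asum p < +oo)%E ->
  (fun n => \sum_(k < n) p k) @ \oo --> fine (asum p).
Proof.
move=> p0 po.
have e : asum p = (\sum_(k <oo) (p k)%:E)%E.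
  rewrite nneseries_esumT => [|n]; last by rewrite lee_fin.
  by apply: eq_esum => n _; rewrite ger0_norm.
have : (fun n => (\sum_(k < n) p k)%:E) @ \oo --> (fine (asum p))%:E.
  rewrite asum_fin// e.
  rewrite (_ : (fun n => _) = (fun n => \sum_(0 <= k < n) (p k)%:E)%E); last first.
    by apply/funext => n; rewrite sumEFin big_mkord.
  by apply: is_cvg_nneseries => n _ _; rewrite lee_fin.
exact: fine_cvg.
Qed.

Lemma series_cvg (f : nat -> R) : (asum f < +oo)%E ->
  (fun n => \sum_(k < n) f k) @ \oo --> rsum f.
Proof.
move=> fo; have [p0 q0 po qo e] := posneg f.
rewrite (_ : (fun k => _) = (fun n =>
  \sum_(k < n) Num.max (f k) 0 - \sum_(k < n) Num.max (- f k) 0)); last first.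
  by apply/funext => n; rewrite -sumrB; apply: eq_bigr => k _; exact: e.
apply: cvgB.
  by apply: (series_cvg_ge0 p0); exact: le_lt_trans fo.
by apply: (series_cvg_ge0 q0); exact: le_lt_trans fo.
Qed.

Lemma asum_geometric (c : R) : 0 <= c -> (asum (fun n => c / 2 ^+ n)%R <= (2 * c)%:E)%E.
Proof.
move=> c0.
have e n : \sum_(k < n) c / 2 ^+ k = 2 * c - 2 * c / 2 ^+ n.
  elim: n => [|n IH]; first by rewrite big_ord0 expr0 divr1 subrr.
  rewrite big_ord_recr /= IH exprS invfM.
  by field; rewrite expf_neq0.
have -> : asum (fun n => c / 2 ^+ n) = (\sum_(k <oo) (c / 2 ^+ k)%:E)%E.
  rewrite nneseries_esumT => [|n]; last by rewrite lee_fin divr_ge0// exprn_ge0.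
  by apply: eq_esum => n _; rewrite ger0_norm// divr_ge0// exprn_ge0.
apply: lime_le.
  by apply: is_cvg_nneseries => n _ _; rewrite lee_fin divr_ge0// exprn_ge0.
apply: nearW => n; rewrite sumEFin big_mkord e lee_fin gerBl.
by rewrite divr_ge0 ?mulr_ge0// exprn_ge0.
Qed.

(* Picard iteration.  The increments of the iterates are built directly, so
   that Q need not be linear: [Q m u] may be any function obtained from u by
   choosing a power series expansion of norm at most m. *)
Section Iteration.
Variables (D e : nat) (r s M : R) (B : 'rV[R]_D -> 'rV[R]_e).
Variables (H : 'I_e -> 'rV[R]_(D + e) -> R) (Q : R -> ('rV[R]_D -> R) -> 'rV[R]_D -> R).
Hypotheses (r0 : 0 < r) (rs : r <= s / 2) (rM : 8 * (r * M) <= s).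
Hypotheses (BM : forall i, rep r (s / 4) (fun z => B z 0 i)).
Hypotheses (HM : forall i, rep s M (H i)).
Hypotheses (QM : forall m u, rep r m u -> rep r (r * m) (Q m u)).

(** The scheme for [U = B + Q (H (z, U))]: the first component is the iterate [U_n], the second the
    increment [w_n = H (z, U_n) - H (z, U_(n-1))], starting with [w_0 = H (z, B)]. Each step adds
    [Q w_n] to the iterate. *)
Fixpoint picard (n : nat) : ('rV[R]_D -> 'rV[R]_e) * ('I_e -> 'rV[R]_D -> R) :=
  if n is n'.+1 then
    let U := (picard n').1 in
    let U' := fun z => U z + \row_i Q (M / 2 ^+ n') ((picard n').2 i) z in
    (U', fun i z => H i (row_mx z (U' z)) - H i (row_mx z (U z)))
  else (B, fun i z => H i (row_mx z (B z))).

(** Since [8 * (r * M) <= s], the steps [r * M / 2 ^+ n] add up to at most [s / 4]; with the [s / 4]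
    of [B] this leaves the iterates in the polydisc of radius [s / 2]. The other half of [s] is the
    margin with which [rep_comp_diff] bounds the next increment by a quarter of [M / 2 ^+ n], more
    than the half that is needed. *)
Lemma picard_bounds n :
  (forall i, rep r (s / 2 - s / 4 / 2 ^+ n) (fun z => (picard n).1 z 0 i)) /\
  (forall i, rep r (M / 2 ^+ n) ((picard n).2 i)).
Proof.
move: r0 rs rM => r1 rs1 rM1; have s0 : 0 < s by lra.
have pair (U : 'rV[R]_D -> 'rV[R]_e) t : r <= t -> (forall i, rep r t (fun z => U z 0 i)) ->
    forall j, rep r t (fun z => row_mx z (U z) 0 j).
  move=> rt Ut j; case: (split_ordP j) => k ->.
    apply: rep_le rt _.
    by apply: rep_ext (rep_coord k (ltW r0)) => z _; rewrite row_mxEl.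
  by apply: rep_ext (Ut k) => z _; rewrite row_mxEr.
elim: n => [|n [IH1 IH2]].
  rewrite expr0 !divr1; split=> i /=; first by apply: rep_le (BM i); lra.
  apply: (rep_comp (s := s) r0 (ltW s0)) (HM i) => //; apply: pair => [|j]; first by lra.
  by apply: rep_le (BM j); lra.
have p0 : 0 < 2 ^+ n :> R by rewrite exprn_gt0.
have p1 : 0 < (2 ^+ n)^-1 :> R by rewrite invr_gt0.
set P := (2 ^+ n)^-1 in IH1 IH2 p1 *.
have P2 : (2 ^+ n.+1)^-1 = P / 2 :> R by rewrite exprS invfM mulrC.
have Qn i : rep r (r * M * P) (fun z => (\row_i Q (M / 2 ^+ n) ((picard n).2 i) z : 'rV[R]_e) 0 i).
  apply: (@rep_ext _ _ _ _ (Q (M / 2 ^+ n) ((picard n).2 i))) => [z _|]; first by rewrite mxE.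
  by rewrite -mulrA; exact: QM.
have rMP : 8 * (r * M * P) <= s * P by rewrite mulrA ler_wpM2r// ltW.
have sP : 0 < s * P by rewrite mulr_gt0.
have P1 : P <= 1 by rewrite invf_le1// exprn_ege1// ler1n.
have sP1 : s * P <= s by rewrite ler_piMr// ltW.
rewrite P2; split=> i /=.
  apply: (@rep_ext _ _ _ _ (fun z => (picard n).1 z 0 i +
     (\row_i Q (M / 2 ^+ n) ((picard n).2 i) z : 'rV[R]_e) 0 i)) => [z _|]; first by rewrite [in RHS]mxE.
  by apply: rep_le (rep_add (IH1 i) (Qn i)); lra.
have M0 : 0 <= M by exact: rep_ge0 (HM i).
have rMP0 : 0 <= r * M * P by rewrite !mulr_ge0// ltW.
apply: (@rep_le _ _ _ (r * M * P / (s / 2) * M)).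
  rewrite invf_div (_ : r * M * P * (2 / s) * M = (8 * (r * M) / s) * (M * P / 4)); last first.
    by field; rewrite gt_eqF.
  rewrite (_ : M * (P / 2) = 2 * (M * P / 4)); last by lra.
  have MP : 0 <= M * P / 4 by rewrite !mulr_ge0 ?invr_ge0// ltW.
  rewrite ler_wpM2r//; apply: (@le_trans _ _ 1); last by lra.
  by rewrite ler_pdivrMr// mul1r.
apply: (@rep_comp_diff _ _ _ _ (s / 2)) => //.
- by rewrite divr_ge0// ltW.
- by rewrite divr_gt0.
- by rewrite rMP0/=; lra.
- apply: pair => // j; apply: rep_le (IH1 j); rewrite gerBl.
  by rewrite !mulr_ge0 ?invr_ge0// ltW.
- move=> j; case: (split_ordP j) => k ->.
    apply: rep_le rMP0 _; have := @rep_const R D r 0; rewrite normr0.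
    by apply: rep_ext => z _; rewrite !row_mxEl subrr.
  apply: rep_ext (Qn k) => z _; rewrite !row_mxEr [in RHS]mxE.
  by rewrite addrAC subrr add0r.
- by rewrite (_ : s / 2 + s / 2 = s)//; lra.
Qed.

(** As [Q] need not be linear, the fixed point equation is expressed through the common increments
    [w n]: both sides are sums over them, and each application recovers its equation term by term.
    The sum for [H] telescopes, and its limit is identified by continuity of [H]. *)
Lemma fixpoint_rep : exists (U : 'rV[R]_D -> 'rV[R]_e) (w : nat -> 'I_e -> 'rV[R]_D -> R),
  [/\ forall n i, rep r (M / 2 ^+ n) (w n i),
      forall i, rep r (s / 2) (fun z => U z 0 i),
      forall i z, `|z| <= r -> U z 0 i = B z 0 i + rsum (fun n => Q (M / 2 ^+ n) (w n i) z) &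
      forall i z, `|z| <= r -> H i (row_mx z (U z)) = rsum (fun n => w n i z)].
Proof.
move: r0 rs rM => r1 rs1 rM1; have s0 : 0 < s by lra.
have le2 : s / 4 + 2 * (r * M) <= s / 2 by lra.
have rs' : r < s by lra.
have ss : s / 2 < s by lra.
pose w n := (picard n).2.
have wM n i : rep r (M / 2 ^+ n) (w n i) by have [_] := picard_bounds n; exact.
have QwM n i : rep r (r * M / 2 ^+ n) (Q (M / 2 ^+ n) (w n i)) by rewrite -mulrA; exact: QM.
pose U (z : 'rV[R]_D) : 'rV[R]_e := B z + \row_i rsum (fun n => Q (M / 2 ^+ n) (w n i) z).
(* Nonnegativity of [M] is read off a component of [H]; for [e = 0] there is no component to
   treat. *)
have M0 (i : 'I_e) : 0 <= M by exact: rep_ge0 (HM i).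
have rM0 (i : 'I_e) : 0 <= r * M by apply: mulr_ge0; [exact: ltW|exact: (M0 i)].
exists U, w; split=> //.
- move=> i; apply: (@rep_ext _ _ _ _ (fun z => B z 0 i + rsum (fun n => Q (M / 2 ^+ n) (w n i) z))).
    by move=> z _; rewrite !mxE.
  apply: (@rep_le _ _ _ (s / 4 + 2 * (r * M))); first exact: le2.
  apply: rep_add => //; apply: rep_rsum (asum_geometric (rM0 i)) => // n.
  by rewrite ger0_norm// mulr_ge0 ?(rM0 i)// invr_ge0 exprn_ge0.
- by move=> i z zr; rewrite !mxE.
move=> i z zr.
have Qfin j : (asum (fun n => Q (M / 2 ^+ n) (w n j) z) < +oo)%E.
  apply: (@asum_ltoo _ _ _ (2 * (r * M))); apply: le_trans (asum_geometric (rM0 i)).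
  by apply: le_asum => n; rewrite [leRHS]ger0_norm ?(rep_norm (QwM _ _))// mulr_ge0 ?(rM0 i)// invr_ge0 exprn_ge0.
have wfin : (asum (fun n => w n i z) < +oo)%E.
  apply: (@asum_ltoo _ _ _ (2 * M)); apply: le_trans (asum_geometric (M0 i)).
  by apply: le_asum => n; rewrite [leRHS]ger0_norm ?(rep_norm (wM _ _))// mulr_ge0 ?(M0 i)// invr_ge0 exprn_ge0.
have Un n : (picard n).1 z = B z + \row_j \sum_(k < n) Q (M / 2 ^+ k) (w k j) z.
  elim: n => [|n IH] /=.
    by apply/rowP => j; rewrite !mxE big_ord0 addr0.
  rewrite IH -addrA; congr (_ + _); apply/rowP => j.
  by rewrite !mxE big_ord_recr.
have Hn n : \sum_(k < n.+1) w k i z = H i (row_mx z ((picard n).1 z)).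
  elim: n => [|n IH]; first by rewrite big_ord1.
  by rewrite big_ord_recr IH /w /= subrKC.
have Ucvg : (fun n => (picard n).1 z) @ \oo --> U z.
  apply: rV_cvg => j.
  rewrite (_ : (fun n => _) = (fun n => B z 0 j + \sum_(k < n) Q (M / 2 ^+ k) (w k j) z)); last first.
    by apply/funext => n; rewrite Un !mxE.
  rewrite !mxE; apply: cvgD; first exact: cvg_cst.
  exact: series_cvg.
have Us : `|U z| <= s / 2.
  apply: rV_norm_le => [|j]; first by rewrite divr_ge0// ltW.
  rewrite !mxE; have U_rep : rep r (s / 2) (fun z => B z 0 j + rsum (fun n => Q (M / 2 ^+ n) (w n j) z)).
    apply: (@rep_le _ _ _ (s / 4 + 2 * (r * M))); first exact: le2.
    apply: rep_add => //; apply: rep_rsum (asum_geometric (rM0 i)) => // n.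
    by rewrite ger0_norm// mulr_ge0 ?(rM0 i)// invr_ge0 exprn_ge0.
  exact: rep_norm U_rep zr.
have zUs : `|row_mx z (U z)| < s.
  apply: rV_norm_lt => // j; case: (split_ordP j) => k ->.
    by rewrite row_mxEl; apply: le_lt_trans (rV_coord_le _ _) _; exact: le_lt_trans zr rs'.
  by rewrite row_mxEr; apply: le_lt_trans (rV_coord_le _ _) _; exact: le_lt_trans Us ss.
have : rep s M (fun k => H i (0 + k)) by apply: rep_ext (HM i) => k _; rewrite add0r.
move=> /(rep_anal zUs); rewrite add0r => /anal_continuous Hc.
have zUcvg : (fun n => row_mx z ((picard n).1 z) : 'rV[R]_(D + e)) @ \oo --> (row_mx z (U z) : 'rV[R]_(D + e)).
  apply: rV_cvg => j; case: (split_ordP j) => k ->.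
    rewrite row_mxEl; under eq_fun do rewrite row_mxEl; exact: cvg_cst.
  rewrite row_mxEr; under eq_fun do rewrite row_mxEr; exact: rV_coord_cvg.
have h1 := cvg_comp _ (H i) zUcvg Hc.
have h2 : (fun n => \sum_(k < n.+1) w k i z) @ \oo --> rsum (fun n => w n i z).
  by have := series_cvg wfin; rewrite -(cvg_shiftS _ _).
rewrite (_ : (fun n => _) = (H i \o (fun n => row_mx z ((picard n).1 z)))) in h2; last first.
  by apply/funext => n; rewrite Hn.
by rewrite -(cvg_lim _ h1)// -(cvg_lim _ h2).
Qed.

End Iteration.

Lemma is_derive_mon D (h : 'rV[R]_D) i (a : mi D) :
  is_derive h (delta_mx 0 i) (fun z => mon z (madd (mdelta i) a)) ((a i).+1%:R * mon h a).
Proof.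
pose K := \prod_(j < D | j != i) h 0 j ^+ a j.
have gd : is_derive (h 0 i) 1 (fun x : R => x ^+ (a i).+1 * K) ((a i).+1%:R * mon h a).
  have -> : (a i).+1%:R * mon h a = (a i).+1%:R * h 0 i ^+ (a i) * K.
    by rewrite /mon (bigD1 i)//= mulrA.
  rewrite (_ : (fun x : R => _) = K \*: (@GRing.exp R ^~ (a i).+1)); last first.
    by apply/funext => x; rewrite mulrC.
  rewrite (_ : _ * K = K *: ((a i).+1%:R *: h 0 i ^+ a i *: (1 : R))); last first.
    by rewrite /GRing.scale/= mulr1 mulrC.
  apply: is_deriveZ; apply: DeriveDef; last exact: exp_derive.
  exact: exprn_derivable.
have [gd1 gd2] := gd.
have e : (fun t : R => t^-1 *: (mon (t *: delta_mx 0 i + h) (madd (mdelta i) a) - mon h (madd (mdelta i) a))) =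
    (fun t : R => t^-1 *: ((t *: 1 + h 0 i) ^+ (a i).+1 * K - h 0 i ^+ (a i).+1 * K)).
  apply/funext => t; congr (_ *: (_ - _)); rewrite !mon_madd !mon_delta.
    rewrite /mon (bigD1 i)//= !mxE !eqxx mulrA -exprS; congr (_ * _).
    by apply: eq_bigr => j ji; rewrite !mxE (negPf ji) andbF mulr0 add0r.
  by rewrite /mon (bigD1 i)//= mulrA -exprS.
by apply: DeriveDef; [rewrite /derivable /= e|rewrite /derive /= e].
Qed.

(** Termwise integration in [h 0 i] from 0: the division by [(a i).+1] does not increase the norm,
    and the extra factor [h 0 i] contributes [r]. Vanishing on [h 0 i = 0] will encode the initial
    condition. *)
Lemma antiderivative D r m (i : 'I_D) (u : 'rV[R]_D -> R) : 0 < r -> rep r m u ->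
  exists v, [/\ rep r (r * m) v,
    forall h, `|h| < r / 2 -> is_derive h (delta_mx 0 i) v (u h) &
    forall h : 'rV[R]_D, h 0 i = 0 -> v h = 0].
Proof.
move=> r0 [c [cM ce]].
pose F (a : mi D) (h : 'rV[R]_D) := c a / (a i).+1%:R * mon h (madd (mdelta i) a).
have FM a : rep r `|r * (c a * r ^+ mdeg a)| (F a).
  apply: rep_le (rep_scale (c a / (a i).+1%:R) (rep_mon r (madd (mdelta i) a))).
  rewrite mdeg_madd mdeg_delta add1n !normrM !normrX exprS mulrCA.
  rewrite ler_wpM2l// ler_wpM2r ?exprn_ge0// ler_piMr// normfV invf_le1 normr_nat ?ltr0n//.
  by rewrite ler1n.
have FMo := asumZ_le (ltW r0) cM.
exists (fun h => rsum (fun a => F a h)); split.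
- exact: rep_rsum FMo.
- move=> h hr; rewrite ce; last by apply: ltW; lra.
  apply: (@rep_rsum_derive R D _ r _ F (fun a z => c a * mon z a) i r0 FM (asum_ltoo FMo)) hr => a z zr.
  rewrite (_ : c a * mon z a = (c a / (a i).+1%:R) *: ((a i).+1%:R * mon z a)); last first.
    by rewrite /GRing.scale/= mulrA divfK// pnatr_eq0.
  by apply: is_deriveZ; exact: is_derive_mon.
- move=> h hi0; rewrite (_ : (fun a => F a h) = (fun=> 0)).
    by rewrite /rsum /asum maxxx oppr0 maxxx subrr.
  by apply/funext => a; rewrite /F mon_madd mon_delta hi0 mul0r mulr0.
Qed.

End FixedPoint.

(** * Analytic local flows and local inverses *)

Section LocalSolutions.
Context {R : realType}.

Definition tcons d (t : R) (y : 'rV[R]_d) : 'rV[R]_(1 + d) := row_mx t%:M y.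

Lemma jointE d (V : Type) (f : R -> 'rV[R]_d -> V) t y : joint f (tcons t y) = f t y.
Proof. by rewrite /joint /tcons row_mxKl row_mxKr mxE eqxx mulr1n. Qed.

Lemma tconsE d (z : 'rV[R]_(1 + d)) : z = tcons (lsubmx z 0 0) (rsubmx z).
Proof.
rewrite -[LHS]hsubmxK /tcons; congr row_mx.
by apply/rowP => i; rewrite (ord1 i) [RHS]mxE eqxx mulr1n.
Qed.

Lemma tcons_fst d t (y : 'rV[R]_d) : tcons t y 0 (lshift d 0) = t.
Proof. by rewrite row_mxEl mxE eqxx mulr1n. Qed.

Lemma tcons_lsub d t (y : 'rV[R]_d) : lsubmx (tcons t y) 0 0 = t.
Proof. by rewrite row_mxKl mxE eqxx mulr1n. Qed.

Lemma tcons_rsub d t (y : 'rV[R]_d) : rsubmx (tcons t y) = y.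
Proof. by rewrite row_mxKr. Qed.

Lemma tconsB d t s (y z : 'rV[R]_d) : tcons t y - tcons s z = tcons (t - s) (y - z).
Proof. by rewrite /tcons opp_row_mx add_row_mx -raddfB. Qed.

Lemma tconsD d t s (y z : 'rV[R]_d) : tcons t y + tcons s z = tcons (t + s) (y + z).
Proof. by rewrite /tcons add_row_mx -raddfD. Qed.

Lemma tcons_norm_lt d t (y : 'rV[R]_d) r : (`|tcons t y| < r) = (`|t| < r) && (`|y| < r).
Proof.
apply/idP/andP => [h|[tr yr]].
  have r0 : 0 < r by apply: le_lt_trans h.
  split.
    by apply: le_lt_trans h; have := rV_coord_le (tcons t y) (lshift d 0);
       rewrite row_mxEl mxE eqxx mulr1n.
  apply: rV_norm_lt => // i; apply: le_lt_trans h.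
  by have := rV_coord_le (tcons t y) (rshift 1 i); rewrite row_mxEr.
have r0 : 0 < r by apply: le_lt_trans tr.
apply: rV_norm_lt => // j; case: (split_ordP j) => k ->.
  by rewrite row_mxEl (ord1 k) mxE eqxx mulr1n.
by rewrite row_mxEr; apply: le_lt_trans yr; exact: rV_coord_le.
Qed.

Lemma near_tcons d t (y : 'rV[R]_d) (P : set 'rV[R]_(1 + d)) :
  (\forall z \near tcons t y, P z) <->
  exists2 r : R, 0 < r & forall s x, `|s - t| < r -> `|x - y| < r -> P (tcons s x).
Proof.
split.
  move=> /near_ball[r r0 h]; exists r => // s x sr xr.
  rewrite -(subrKC (tcons t y) (tcons s x)); apply: h.
  by rewrite tconsB tcons_norm_lt sr.
move=> [r r0 h]; apply/near_ball; exists r => // z.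
rewrite (tconsE z) tconsD tcons_norm_lt => /andP[z1 z2].
by apply: h; rewrite addrAC subrr add0r.
Qed.

Lemma analv_tcons d e (x : 'rV[R]_e) (t : 'rV[R]_e -> R) (y : 'rV[R]_e -> 'rV[R]_d) :
  anal x t -> analv x y -> analv x (fun z => tcons (t z) (y z)).
Proof. by move=> tx yx; apply: analv_row_mx => //; exact: analv_scalar. Qed.

Lemma analv_joint d e k (x : 'rV[R]_e) (F : R -> 'rV[R]_d -> 'rV[R]_k)
    (t : 'rV[R]_e -> R) (y : 'rV[R]_e -> 'rV[R]_d) :
  anal x t -> analv x y -> analv (tcons (t x) (y x)) (joint F) ->
  analv x (fun z => F (t z) (y z)).
Proof.
move=> tx yx Fx; have := analv_comp (analv_tcons tx yx) Fx.
by apply: analv_ext; apply/near_ball; exists 1 => // h _; rewrite jointE.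
Qed.

Lemma anal_fst d (x : 'rV[R]_(1 + d)) : anal x (fun z => lsubmx z 0 0).
Proof. exact: analv_lsub. Qed.

Lemma is_derive_tcons d (t : R) (y : 'rV[R]_d) :
  is_derive t 1 (fun s => tcons s y) (delta_mx 0 (lshift d 0)).
Proof.
apply: is_derive_coords => j; case: (split_ordP j) => k ->.
  rewrite (_ : (fun z => _) = id).
    by rewrite mxE eqxx (ord1 k) eqxx; exact: is_derive_id.
  by apply/funext => z; rewrite row_mxEl (ord1 k) mxE eqxx mulr1n.
rewrite (_ : (fun z => _) = cst (y 0 k)).
  by rewrite mxE eqxx eq_rlshift; exact: is_derive_cst.
by apply/funext => z; rewrite row_mxEr.
Qed.

Lemma picard_radius (s M : R) : 0 < s -> 0 <= M -> exists r,
  [/\ 0 < r, r <= s / 4 & 8 * (r * M) <= s].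
Proof.
move=> s0 M0; exists (Num.min (s / 4) (s / (8 * (M + 1)))); set r := Num.min _ _.
have r1 : r <= s / (8 * (M + 1)) by rewrite ge_min lexx orbT.
have r0 : 0 < r by rewrite lt_min !divr_gt0//; lra.
split=> //; first by rewrite ge_min lexx.
rewrite ler_pdivlMr in r1; last by lra.
apply: le_trans r1; nra.
Qed.

(** Picard iteration for the integral equation, with initial time 0, in power series in time and
    initial value jointly: existence and analytic dependence on the initial value come together. [Q]
    is integration in [t]; [U] and the initial value are measured from [x0]. *)
Lemma local_flow d (f : 'rV[R]_d -> 'rV[R]_d) x0 : analv x0 f ->
  exists F : R -> 'rV[R]_d -> 'rV[R]_d, analv (tcons 0 x0) (joint F) /\
  exists2 delta, 0 < delta & forall (t : R) y, `|t| < delta -> `|y - x0| < delta ->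
    F 0 y = y /\ is_derive t 1 (F ^~ y) (f (F t y)).
Proof.
move=> /anal_common[s [M0 [s0 fM0]]].
pose M := `|M0|; have fM i : rep s M (fun h => f (x0 + h) 0 i).
  by apply: rep_le (fM0 i); exact: ler_norm.
have [r [r0 rs rM]] := picard_radius s0 (normr_ge0 M0).
pose H i (w : 'rV[R]_((1 + d) + d)) := f (x0 + rsubmx w) 0 i.
have HM i : rep s M (H i).
  apply: (rep_comp s0 (ltW s0) _ (fM i)) => j.
  by apply: rep_ext (rep_coord (rshift (1 + d) j) (ltW s0)) => h _; rewrite mxE.
pose i0 : 'I_(1 + d) := lshift d 0.
(* [Q] has to be a total function of the bound and of the function, so an antiderivative is chosen
   for each pair, with a dummy value where no expansion exists. *)
have /choice[Q0 Q0P] (mu : R * ('rV[R]_(1 + d) -> R)) : exists v, rep r mu.1 mu.2 ->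
   [/\ rep r (r * mu.1) v,
    forall h, `|h| < r / 2 -> is_derive h (delta_mx 0 i0) v (mu.2 h) &
    forall h : 'rV[R]_(1 + d), h 0 i0 = 0 -> v h = 0].
  have [h|h] := pselect (rep r mu.1 mu.2); last by exists (fun=> 0) => /h.
  by have [v vP] := antiderivative i0 r0 h; exists v.
pose Q m u := Q0 (m, u).
have BM (i : 'I_d) : rep r (s / 4) (fun z : 'rV[R]_(1 + d) => rsubmx z 0 i).
  apply: (rep_le rs); apply: rep_ext (rep_coord (rshift 1 i) (ltW r0)) => h _.
  by rewrite mxE.
have rs2 : r <= s / 2 by lra.
have [|U [w [wM UM Ueq Hw]]] := fixpoint_rep (Q := Q) r0 rs2 rM BM HM.
  by move=> m u /(Q0P (m, u))[].
have M0' : 0 <= M by exact: normr_ge0.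
have Ui0 (z : 'rV[R]_(1 + d)) : `|z| <= r -> z 0 i0 = 0 -> U z = rsubmx z.
  move=> zr zi; apply/rowP => i; rewrite Ueq// [X in _ + X](_ : _ = 0) ?addr0//.
  rewrite (_ : (fun n => _) = (fun=> 0)); first by rewrite /rsum /asum maxxx oppr0 maxxx subrr.
  by apply/funext => n; have [_ _] := Q0P (_, _) (wM n i); apply.
have Uder (z : 'rV[R]_(1 + d)) i : `|z| < r / 2 ->
    is_derive z (delta_mx 0 i0) (fun z => U z 0 i) (f (x0 + U z) 0 i).
  move=> zr.
  have -> : f (x0 + U z) 0 i = 0 + rsum (fun n => w n i z).
    rewrite add0r -Hw; first by rewrite /H row_mxKr.
    by apply: ltW; apply: lt_le_trans zr _; lra.
  apply: (@near_eq_is_derive _ _ _ (fun z => rsubmx z 0 i + rsum (fun n => Q (M / 2 ^+ n) (w n i) z))).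
    apply/near_ball; exists (r - `|z|); first by lra.
    move=> h hr; rewrite Ueq//; apply: (le_trans (ler_normD _ _)); lra.
  apply: is_deriveD.
    have -> : (fun z : 'rV[R]_(1 + d) => rsubmx z 0 i) = (fun z => z 0 (rshift 1 i)).
      by apply/funext => y; rewrite mxE.
    have := is_derive_coord (is_derive_id z (delta_mx 0 i0)) (rshift 1 i).
    by rewrite mxE eq_rlshift.
  apply: (@rep_rsum_derive R _ _ r (fun n => r * (M / 2 ^+ n)) _ (w ^~ i)) => //.
  - move=> n; have [h _ _] := Q0P (_, _) (wM n i).
    by rewrite ger0_norm// !mulr_ge0 ?(ltW r0)// invr_ge0 exprn_ge0.
  - rewrite asumZ.
    by rewrite -(asum_fin (asum_ltoo (asum_geometric M0'))) -EFinM ltry.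
  - by move=> n h hr; have [_ h' _] := Q0P (_, _) (wM n i); exact: h'.
pose F t y := x0 + U (tcons t (y - x0)).
have Uan (z : 'rV[R]_(1 + d)) : `|z| < r -> analv z U.
  move=> zr i; rewrite -[z]add0r; apply: (rep_anal zr).
  by apply: rep_ext (UM i) => k _; rewrite add0r.
exists F; split.
  have e : joint F = (fun z => x0 + U (tcons (lsubmx z 0 0) (rsubmx z - x0))) by [].
  rewrite e; apply: analv_add; first exact: analv_const.
  apply: (analv_comp (G := fun z => tcons (lsubmx z 0 0) (rsubmx z - x0))).
    apply: analv_tcons; first exact: anal_fst.
    by apply: analv_add; [exact: analv_rsub|exact: analv_const].
  apply: Uan; rewrite /tcons row_mxKl row_mxKr mxE eqxx mulr1n subrr tcons_norm_lt.
  by rewrite !normr0 r0.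
exists (r / 2); first by rewrite divr_gt0.
move=> t y tr yr; split.
  rewrite /F Ui0 ?row_mxKr ?subrKC//.
    by apply: ltW; rewrite tcons_norm_lt normr0 r0; lra.
  by rewrite row_mxEl mxE eqxx.
apply: is_derive_coords => i.
have zr : `|tcons t (y - x0)| < r / 2 by rewrite tcons_norm_lt tr.
rewrite (_ : (fun z => _) = (fun s => x0 0 i + U (tcons s (y - x0)) 0 i)); last first.
  by apply/funext => u; rewrite mxE.
rewrite -[f _ 0 i]add0r; apply: is_deriveD.
have zr' : `|tcons t (y - x0)| < r by apply: lt_trans zr _; lra.
have := @anal_chain R _ _ t 1 (fun s => tcons s (y - x0)) _ (fun z => U z 0 i) (Uan _ zr' i) (is_derive_tcons t (y - x0)).
rewrite (bigD1 i0)//= big1 => [|j /negPf ji].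
  rewrite mxE eqxx eqxx mul1r addr0.
  by have [_] := Uder _ i zr; rewrite /partial => ->.
by rewrite mxE ji andbF mul0r.
Qed.

(** This is the fixed point problem [Z = y - k *: K e Z]. Multiplication by the coordinate [k] takes
    the place of the integral in [local_flow]: it has norm [r] as well. *)
Lemma local_inverse d (K : R -> 'rV[R]_d -> 'rV[R]_d) x0 : analv (tcons 0 x0) (joint K) ->
  exists Z : R -> R -> 'rV[R]_d -> 'rV[R]_d,
    analv (tcons 0 (tcons 0 x0)) (joint (fun e => joint (Z e))) /\
  exists2 delta, 0 < delta & forall (e k : R) y,
    `|e| < delta -> `|k| < delta -> `|y - x0| < delta ->
    Z e k y + k *: K e (Z e k y) = y.
Proof.
move=> /anal_common[s [M0 [s0 fM0]]].
pose M := `|M0|.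
have KM i : rep s M (fun h => joint K (tcons 0 x0 + h) 0 i).
  by apply: rep_le (fM0 i); exact: ler_norm.
have [r [r0 rs rM]] := picard_radius s0 (normr_ge0 M0).
pose i0 : 'I_(1 + (1 + d)) := lshift (1 + d) 0.
pose i1 : 'I_(1 + (1 + d)) := rshift 1 (lshift d 0).
pose H i (w : 'rV[R]_((1 + (1 + d)) + d)) :=
  - joint K (tcons 0 x0 + tcons (w 0 (lshift d i0)) (rsubmx w)) 0 i.
have HM i : rep s M (H i).
  apply: rep_opp; apply: (rep_comp s0 (ltW s0) _ (KM i)) => j.
  case: (split_ordP j) => k ->.
    apply: rep_ext (rep_coord (lshift d i0) (ltW s0)) => h _.
    by rewrite row_mxEl (ord1 k) mxE eqxx mulr1n.
  apply: rep_ext (rep_coord (rshift (1 + (1 + d)) k) (ltW s0)) => h _.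
  by rewrite row_mxEr mxE.
pose Q (m : R) (u : 'rV[R]_(1 + (1 + d)) -> R) (z : 'rV[R]_(1 + (1 + d))) := z 0 i1 * u z.
have BM (i : 'I_d) : rep r (s / 4) (fun z : 'rV[R]_(1 + (1 + d)) => rsubmx (rsubmx z) 0 i).
  apply: (rep_le rs); apply: rep_ext (rep_coord (rshift 1 (rshift 1 i)) (ltW r0)) => h _.
  by rewrite !mxE.
have rs2 : r <= s / 2 by lra.
have [|U [w [wM UM Ueq Hw]]] := fixpoint_rep (Q := Q) r0 rs2 rM BM HM.
  by move=> m u uM; apply: rep_mul => //; apply: rep_coord; exact: ltW.
have M0' : 0 <= M by exact: normr_ge0.
exists (fun e k y => x0 + U (tcons e (tcons k (y - x0)))); split.
  have e : joint (fun e => joint (fun k y => x0 + U (tcons e (tcons k (y - x0))))) =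
     (fun z => x0 + U (tcons (lsubmx z 0 0) (tcons (lsubmx (rsubmx z) 0 0)
       (rsubmx (rsubmx z) - x0)))) by [].
  rewrite e; apply: analv_add; first exact: analv_const.
  apply: (analv_comp (G := fun z : 'rV[R]_(1 + (1 + d)) => tcons (lsubmx z 0 0)
     (tcons (lsubmx (rsubmx z) 0 0) (rsubmx (rsubmx z) - x0)))).
    apply: analv_tcons; first exact: anal_fst.
    apply: analv_tcons.
      have := anal_comp (analv_rsub (tcons 0 (tcons 0 x0))) (anal_fst _).
      exact.
    apply: analv_add; last exact: analv_const.
    exact: (analv_comp (analv_rsub (tcons 0 (tcons 0 x0))) (analv_rsub _)).
  rewrite /tcons !(row_mxKl, row_mxKr) !mxE eqxx mulr1n subrr => i.
  have zr : `|tcons 0 (tcons 0 (0 : 'rV[R]_d))| < r by rewrite !tcons_norm_lt !normr0 r0.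
  rewrite -[X in anal X]add0r; apply: (rep_anal zr).
  by apply: rep_ext (UM i) => k _; rewrite add0r.
exists r => // e k y er kr yr.
have zr : `|tcons e (tcons k (y - x0))| <= r by apply: ltW; rewrite !tcons_norm_lt er kr yr.
apply/rowP => i; rewrite !mxE Ueq//.
have wfin : (asum (fun n => w n i (tcons e (tcons k (y - x0)))) < +oo)%E.
  apply: (@asum_ltoo _ _ _ (2 * M)); apply: le_trans (asum_geometric M0').
  apply: le_asum => n; rewrite [leRHS]ger0_norm ?(rep_norm (wM _ _))//.
  by rewrite mulr_ge0// invr_ge0 exprn_ge0.
rewrite /Q; have -> : tcons e (tcons k (y - x0)) 0 i1 = k.
  by rewrite /i1 row_mxEr row_mxEl mxE eqxx mulr1n.
rewrite rsumZ// -Hw// /H row_mxKr row_mxEl /i0 tcons_fst.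
rewrite tconsD add0r jointE !row_mxKr.
rewrite (_ : (y - x0) 0 i = y 0 i - x0 0 i); last by rewrite !mxE.
by ring.
Qed.

End LocalSolutions.

(** * Uniqueness and the global flow *)

Section Uniqueness.
Context {R : realType}.

(** Compactness of the closed ball in its near-covering form; monotonicity in the step size passes
    from one admissible [a] to all smaller ones, as that form requires. *)
Lemma uniform_on_balls d (P : R -> 'rV[R]_d -> Prop) :
  (forall x a b, 0 < b -> b <= a -> P a x -> P b x) ->
  (forall x, exists2 a, 0 < a & forall y, `|y - x| < a -> P a y) ->
  forall r, exists2 a, 0 < a & forall x, `|x| <= r -> P a x.
Proof.
move=> Pmono Ploc r.
have cK : compact [set x : 'rV[R]_d | `|x| <= r].
  apply: bounded_closed_compact.
    exists r; split; first exact: num_real.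
    by move=> M rM x /= xr; apply: le_trans xr (ltW rM).
  have := @closed_closed_ball_ R _ (0 : 'rV[R]_d) r.
  by congr closed; apply/seteqP; split=> x /=; rewrite /closed_ball_ /= sub0r normrN.
have Pnear : \forall a \near (0 : R)^'+, [set x : 'rV[R]_d | `|x| <= r] `<=` P a.
  apply: ((@compact_near_coveringP _ _).1 cK) => x _.
  have [a a0 ha] := Ploc x.
  exists ([set y | `|y - x| < a], [set b | 0 < b < a]) => /=.
    split; first by apply/near_ball; exists a => // h ha'; rewrite /= addrAC subrr add0r.
    by near=> b; apply/andP; split.
  by move=> [y b] /= [ya /andP[b0 ba]]; apply: Pmono (ha y ya) => //; exact: ltW.
have [a [a0 aP]] : exists a, 0 < a /\ [set x : 'rV[R]_d | `|x| <= r] `<=` P a.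
  near (0 : R)^'+ => a; exists a; split=> //; near: a; exact: Pnear.
by exists a.
Unshelve. all: by end_near. Qed.

(** The maximum norm is not differentiable; the Euclidean norm, which dominates it, replaces it in
    the energy estimate. *)
Lemma energy_norm d (a : 'rV[R]_d) : `|a| <= Num.sqrt (\sum_i a 0 i ^+ 2).
Proof.
apply: rV_norm_le => [|i]; first exact: sqrtr_ge0.
rewrite -sqrtr_sqr ler_wsqrtr// (bigD1 i)//= lerDl.
by apply: sumr_ge0 => j _; exact: sqr_ge0.
Qed.

Lemma within_coord d (A : set R) (x : R -> 'rV[R]_d) i :
  {within A, continuous x} -> {within A, continuous (fun t => x t 0 i)}.
Proof.
by move=> cx t; apply: rV_coord_cvg; exact: cx.
Qed.

(* The weighted energy is monotone because |d/dt |x-y|^2| <= C |x-y|^2. *)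
Lemma ode_unique d (a b K : R) (x y x' y' : R -> 'rV[R]_d) :
  a <= b ->
  {within `[a, b], continuous x} -> {within `[a, b], continuous y} ->
  (forall u, u \in `]a, b[ -> is_derive u 1 x (x' u)) ->
  (forall u, u \in `]a, b[ -> is_derive u 1 y (y' u)) ->
  (forall u, u \in `]a, b[ -> `|x' u - y' u| <= K * `|x u - y u|) ->
  (x a = y a -> x b = y b) /\ (x b = y b -> x a = y a).
Proof.
move=> ab cx cy dx dy Kxy.
wlog K0 : K Kxy / 0 <= K.
  move=> h; apply: (h `|K|) => // u uab; apply: le_trans (Kxy u uab) _.
  by rewrite ler_wpM2r// ler_norm.
pose D t := \sum_i (x t 0 i - y t 0 i) ^+ 2.
pose D' t := \sum_i 2 * (x t 0 i - y t 0 i) * (x' t 0 i - y' t 0 i).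
pose C := 2 * d%:R * K.
have D0 t : 0 <= D t by apply: sumr_ge0 => i _; exact: sqr_ge0.
have D0eq t : D t <= 0 -> x t = y t.
  move=> Dt; have : D t == 0 by rewrite eq_le Dt D0.
  rewrite psumr_eq0; last by move=> i _; exact: sqr_ge0.
  move=> /allP h; apply/rowP => i; apply/eqP; rewrite -subr_eq0 -sqrf_eq0.
  by apply: h; rewrite mem_index_enum.
have D'D t : t \in `]a, b[ -> `|D' t| <= C * D t.
  move=> tab; rewrite /D' /C; apply: le_trans (ler_norm_sum _ _ _) _.
  have -> : 2 * d%:R * K * D t = \sum_(i < d) 2 * K * D t.
    by rewrite sumr_const card_ord -mulr_natr; ring.
  apply: ler_sum => i _; rewrite !normrM gtr0_norm// -!mulrA ler_wpM2l//.
  have h1 := energy_norm (x t - y t).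
  have h2 := rV_coord_le (x t - y t) i.
  have h3 := rV_coord_le (x' t - y' t) i.
  have h4 := Kxy t tab.
  have De : \sum_i (x t - y t) 0 i ^+ 2 = D t by apply: eq_bigr => j _; rewrite !mxE.
  rewrite De in h1; rewrite !mxE in h2 h3.
  set q := Num.sqrt (D t) in h1.
  have qD : q * q = D t by rewrite -expr2 sqr_sqrtr.
  have q0 : 0 <= q := sqrtr_ge0 _.
  rewrite -qD; apply: (@le_trans _ _ (q * (K * q))); last by rewrite mulrCA.
  apply: ler_pM => //; first exact: le_trans h1.
  by apply: le_trans h3 (le_trans h4 _); rewrite ler_wpM2l.
have cD : {within `[a, b], continuous D}.
  rewrite (_ : D = fun t => \sum_i (x t 0 i - y t 0 i) * (x t 0 i - y t 0 i)) // => t.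
  apply: cvg_big => [|i _]; first exact: add_continuous.
  have hx := within_coord (i:=i) cx; have hy := within_coord (i:=i) cy.
  by apply: cvgM; (apply: cvgB; [exact: hx|exact: hy]).
have dD t : t \in `]a, b[ -> is_derive t 1 D (D' t).
  move=> tab; have dxt := is_derive_coord (dx t tab); have dyt := is_derive_coord (dy t tab).
  rewrite /D (_ : (fun _ => _) = \sum_i (fun t => (x t 0 i - y t 0 i) ^+ 2)); last first.
    by apply/funext => z; rewrite fct_sumE.
  apply: is_derive_sum => i.
  have dxy := is_deriveB (dxt i) (dyt i).
  rewrite (_ : (fun t => _) = ((fun t => x t 0 i) \- (fun t => y t 0 i)) ^+ 2); last first.
    by apply/funext => z; rewrite exprfctE.
  apply: is_derive_eq; rewrite /GRing.scale /= expr1; ring.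
(* [sg = 1] gives a nonincreasing function, which propagates a zero of [D] from [a] to [b];
   [sg = -1] gives a nondecreasing one, which propagates it from [b] to [a]. *)
have main (sg : R) :
  {within `[a, b], continuous (fun t => D t * expR (- (sg * C * t)))} /\
  forall t, t \in `]a, b[ -> is_derive t 1 (fun t => D t * expR (- (sg * C * t)))
     ((D' t - sg * C * D t) * expR (- (sg * C * t))).
  have de (t : R) : is_derive t 1 (fun t => expR (- (sg * C * t))) (- (sg * C) * expR (- (sg * C * t))).
    rewrite (_ : (fun t => _) = expR \o (fun t => - (sg * C) *: t)); last first.
      by apply/funext => z /=; rewrite /GRing.scale/= mulNr.
    have d1 : is_derive t 1 (fun t : R => - (sg * C) *: t) (- (sg * C)).
      have := is_deriveZ (- (sg * C)) (is_derive_id t (1 : R)).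
      by rewrite /GRing.scale/= mulr1.
    have d2 := is_derive_expR (- (sg * C) *: t).
    have e1 : - (sg * C) *: t = - (sg * C * t) by rewrite /GRing.scale/= mulNr.
    have := is_derive1_comp d2 d1; rewrite e1 [expR _ * _]mulrC; exact.
  split.
    move=> t; apply: cvgM; first exact: cD.
    have : {within `[a, b], continuous (fun t => expR (- (sg * C * t)))}.
      apply: derivable_within_continuous => z _; by have [] := de z.
    exact.
  move=> t tab; have dM := is_deriveM (dD t tab) (de t).
  apply: (is_derive_eq dM); rewrite /GRing.scale/=; ring.
have aab : a \in `[a, b] by rewrite in_itv/= lexx.
have bab : b \in `[a, b] by rewrite in_itv/= lexx andbT.
split=> e; apply: D0eq.
- have [cphi dphi] := main 1.
  have := @ler0_derive1_le_cc _ _ a b _ _ cphi b a bab aab ab.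
  have -> : D a = 0 by rewrite /D big1// => i _; rewrite e subrr expr0n.
  rewrite mul0r pmulr_lle0 ?expR_gt0//; apply.
  + by move=> t tab; have [] := dphi t tab.
  + move=> t tab; rewrite derive1E; have [_ ->] := dphi t tab.
    rewrite pmulr_lle0 ?expR_gt0// mul1r subr_le0.
    exact: le_trans (ler_norm _) (D'D t tab).
- have [cphi dphi] := main (-1).
  have := @ger0_derive1_le_cc _ _ a b _ _ cphi a b aab bab ab.
  have -> : D b = 0 by rewrite /D big1// => i _; rewrite e subrr expr0n.
  rewrite mul0r pmulr_lle0 ?expR_gt0//; apply.
  + by move=> t tab; have [] := dphi t tab.
  + move=> t tab; rewrite derive1E; have [_ ->] := dphi t tab.
    rewrite pmulr_lge0 ?expR_gt0// mulN1r mulNr opprK -lerBlDr sub0r.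
    by have := D'D t tab; rewrite ler_norml => /andP[].
Qed.

Lemma rep_lipschitz d r M (f : 'rV[R]_d -> R) h h' : 0 < r -> rep r M f ->
  `|h| <= r / 4 -> `|h'| <= r / 4 -> `|f h - f h'| <= (2 * M / r) * `|h - h'|.
Proof.
move=> r0 fM hr hr'.
have hh : `|h - h'| <= r / 2.
  by apply: le_trans (ler_normB _ _) _; lra.
(* The difference estimate is used for constant maps on the zero-dimensional space, where a power
   series is just a number. *)
have := @rep_comp_diff R 0 d 1 (r / 2) (r / 2) `|h - h'| M (fun=> h) (fun=> h') f.
move=> /(_ ltr01) H.
have /rep_norm : rep 1 (`|h - h'| / (r / 2) * M) (fun _ : 'rV[R]_0 => f h - f h').
  apply: H.
  - by rewrite divr_ge0 ?(ltW r0).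
  - by rewrite divr_gt0.
  - by rewrite normr_ge0.
  - move=> i; apply: rep_le (rep_const _ _ _).
    by apply: le_trans (rV_coord_le _ _) _; lra.
  - move=> i; apply: rep_le (rep_const _ _ _).
    by have := rV_coord_le (h - h') i; rewrite !mxE.
  - by rewrite (_ : r / 2 + r / 2 = r)//; lra.
move=> /(_ 0); rewrite normr0 => /(_ ler01) /le_trans; apply.
rewrite le_eqVlt; apply/orP; left; apply/eqP.
by field; rewrite gt_eqF.
Qed.

Lemma analv_lipschitz d e (z : 'rV[R]_d) (f : 'rV[R]_d -> 'rV[R]_e) : analv z f ->
  exists r K, [/\ 0 < r, 0 <= K, forall h h', `|h| <= r -> `|h'| <= r ->
     `|f (z + h) - f (z + h')| <= K * `|h - h'| & forall h, `|h| <= r -> `|f (z + h)| <= K].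
Proof.
move=> /anal_common[r [M0 [r0 fM0]]].
pose M := `|M0|; have M0' : 0 <= M by exact: normr_ge0.
have fM i : rep r M (fun h => f (z + h) 0 i) by apply: rep_le (fM0 i); exact: ler_norm.
have K0 : 0 <= 2 * M / r by rewrite divr_ge0 ?mulr_ge0// ltW.
exists (r / 4), (Num.max (2 * M / r) M).
split; [by rewrite divr_gt0|by rewrite le_max K0| |].
  move=> h h' hr hr'.
  apply: (@le_trans _ _ (2 * M / r * `|h - h'|)); last first.
    by rewrite ler_wpM2r// le_max lexx.
  apply: rV_norm_le => [|i]; first by rewrite mulr_ge0.
  by rewrite !mxE; exact: (rep_lipschitz r0 (fM i)).
move=> h hr; apply: rV_norm_le => [|i]; first by rewrite le_max K0.
have hr' : `|h| <= r by apply: le_trans hr _; lra.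
by apply: le_trans (rep_norm (fM i) hr') _; rewrite le_max lexx orbT.
Qed.

Definition joint3 d e (G : R -> R -> R -> 'rV[R]_d -> 'rV[R]_e) :
    'rV[R]_(1 + (1 + (1 + d))) -> 'rV[R]_e :=
  joint (fun a => joint (fun b => joint (G a b))).

Definition tcons3 d (a b c : R) (x : 'rV[R]_d) : 'rV[R]_(1 + (1 + (1 + d))) :=
  tcons a (tcons b (tcons c x)).

Lemma joint3E d e (G : R -> R -> R -> 'rV[R]_d -> 'rV[R]_e) a b c x :
  joint3 G (tcons3 a b c x) = G a b c x.
Proof. by rewrite /joint3 /tcons3 !jointE. Qed.

Lemma tcons3B d a b c (x : 'rV[R]_d) a' b' c' x' :
  tcons3 a b c x - tcons3 a' b' c' x' = tcons3 (a - a') (b - b') (c - c') (x - x').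
Proof. by rewrite /tcons3 !tconsB. Qed.

Lemma tcons3_norm_lt d a b c (x : 'rV[R]_d) r :
  (`|tcons3 a b c x| < r) = [&& `|a| < r, `|b| < r, `|c| < r & `|x| < r].
Proof. by rewrite /tcons3 !tcons_norm_lt. Qed.

(** Points closer than [delta] are covered by the local estimate, distant ones by boundedness, since
    then [2 / delta <= 2 / delta ^+ 2 * |x - y|]. In [P] a single [delta] is the size of the
    neighbourhood and, through its inverse, both the bound and the Lipschitz constant, which makes
    [P] monotone as [uniform_on_balls] requires. *)
Lemma uniform_lipschitz d e (G : R -> R -> R -> 'rV[R]_d -> 'rV[R]_e) :
  (forall x, analv (tcons3 0 0 0 x) (joint3 G)) ->
  forall r, exists delta K, 0 < delta /\ forall a b c x y,
    `|a| < delta -> `|b| < delta -> `|c| < delta -> `|x| <= r -> `|y| <= r ->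
    `|G a b c x - G a b c y| <= K * `|x - y|.
Proof.
move=> Gan r.
pose P (delta : R) (x : 'rV[R]_d) := forall a b c, `|a| < delta -> `|b| < delta -> `|c| < delta ->
  `|G a b c x| <= delta^-1 /\
  forall y, `|y - x| < delta -> `|G a b c x - G a b c y| <= delta^-1 * `|x - y|.
have [||delta d0 Pd] := @uniform_on_balls d P _ _ r.
- move=> x s t t0 ts Ps a b c at_ bt ct.
  have st : s^-1 <= t^-1 by rewrite lef_pV2 ?posrE// (lt_le_trans t0).
  have [h1 h2] := Ps a b c (lt_le_trans at_ ts) (lt_le_trans bt ts) (lt_le_trans ct ts).
  split; first exact: le_trans h1 st.
  move=> y yt; apply: le_trans (h2 y (lt_le_trans yt ts)) _.
  by rewrite ler_wpM2r.
- move=> x; have [s [K [s0 K0 h1 h2]]] := analv_lipschitz (Gan x).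
  pose delta := Num.min (s / 2) (K + 1)^-1.
  have K1 : 0 < K + 1 by rewrite ltr_wpDl.
  have d0 : 0 < delta by rewrite lt_min divr_gt0//= invr_gt0.
  have ds : delta <= s / 2 by rewrite ge_min lexx.
  have dK : K <= delta^-1.
    apply: (@le_trans _ _ (K + 1)); first by rewrite lerDl.
    by rewrite -[leLHS]invrK lef_pV2 ?posrE ?invr_gt0// ge_min lexx orbT.
  exists delta => // y yx a b c ad bd cd.
  have e1 y' : G a b c y' = joint3 G (tcons3 0 0 0 x + tcons3 a b c (y' - x)).
    by rewrite -joint3E; congr joint3; rewrite /tcons3 !tconsD !add0r subrKC.
  have n1 y' : `|y' - x| < s -> `|tcons3 a b c (y' - x)| <= s.
    by move=> ys; apply: ltW; rewrite tcons3_norm_lt ys; apply/and4P; split=> //; lra.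
  split; first by rewrite e1; apply: le_trans (h2 _ (n1 _ _)) dK; lra.
  move=> y' y'y; rewrite !e1.
  have y's : `|y' - x| < s.
    by rewrite -(subrK y y') -addrA; apply: le_lt_trans (ler_normD _ _) _; lra.
  apply: le_trans (h1 _ _ (n1 _ _) (n1 _ _)) _ => //; first lra.
  apply: (@le_trans _ _ (K * `|y - y'|)); last by rewrite ler_wpM2r.
  rewrite ler_wpM2l// tcons3B !subrr opprB addrA subrK.
  have [->|yy] := eqVneq y y'.
    rewrite subrr normr0 (_ : tcons3 _ _ _ _ = 0) ?normr0//.
    by rewrite -(subrr (tcons3 0 0 0 (0 : 'rV[R]_d))) tcons3B !subrr.
  (* [tcons3_norm_lt] characterises strict inequalities only, hence the extra [eta]. *)
  apply/ler_addgt0Pr => eta eta0; apply: ltW.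
  rewrite tcons3_norm_lt !normr0 ltrDl eta0 !andbT.
  by rewrite ltr_wpDl.
exists delta, (Num.max delta^-1 (2 * delta^-1 * delta^-1)); split=> // a b c x y ad bd cd xr yr.
have [bx lx] := Pd x xr a b c ad bd cd.
have [by_ _] := Pd y yr a b c ad bd cd.
have [yx|yx] := ltP `|y - x| delta.
  by apply: le_trans (lx y yx) _; rewrite ler_wpM2r// le_max lexx.
apply: (@le_trans _ _ (2 * delta^-1)).
  by apply: le_trans (ler_normB _ _) _; lra.
apply: (@le_trans _ _ (2 * delta^-1 * delta^-1 * `|x - y|)); last first.
  by rewrite ler_wpM2r// le_max lexx orbT.
have di : 0 < delta^-1 by rewrite invr_gt0.
rewrite -mulrA ler_peMr ?mulr_ge0 ?(ltW di)//.
by rewrite ler_pdivlMl// mulr1 distrC.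
Qed.

Lemma analv_comp_bounded_curve (a b : R) d (x : R -> 'rV[R]_d) :
  a <= b -> {within `[a, b], continuous x} ->
  exists r, forall u, u \in `[a, b] -> `|x u| <= r.
Proof.
move=> ab cx; have [|c _ h] := @EVT_max R (fun u => `|x u|) a b ab.
  by move=> t; apply: cvg_norm; exact: cx.
by exists `|x c|.
Qed.

End Uniqueness.

(** * The flow of an analytic vector field *)

Section Flow.
Context {R : realType} {d : nat}.
Variable f : 'rV[R]_d -> 'rV[R]_d.
Hypothesis fan : forall x, analv x f.

Lemma field_lipschitz r : exists K, forall x y, `|x| <= r -> `|y| <= r ->
  `|f x - f y| <= K * `|x - y|.
Proof.
have [|delta [K [d0 h]]] := @uniform_lipschitz R d d (fun _ _ _ => f) _ r.
  move=> x; apply: (analv_comp (analv_rsub _)).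
  apply: (analv_comp (analv_rsub _)); apply: (analv_comp (analv_rsub _)).
  exact: fan.
by exists K => x y; apply: (h 0 0 0); rewrite normr0.
Qed.

(** For [t < 0] the common value lies at the right end of the interval, so the backward half of
    [ode_unique] is used. *)
Lemma evolves_unique t x w w' :
  evolves (fun=> f) setT 0 t x w -> evolves (fun=> f) setT 0 t x w' -> w = w'.
Proof.
set a := Num.min 0 t; set b := Num.max 0 t.
have ab : a <= b by rewrite ge_min le_max lexx.
move=> [X [X0 Xt cX dX _]] [Y [Y0 Yt cY dY _]].
have [r1 h1] := analv_comp_bounded_curve ab cX; have [r2 h2] := analv_comp_bounded_curve ab cY.
have [K hK] := field_lipschitz (Num.max r1 r2).
have := @ode_unique R d a b K X Y (fun u => f (X u)) (fun u => f (Y u)) ab cX cY dX dY.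
case.
  move=> u uab; apply: hK; rewrite le_max; first by rewrite h1// subset_itv_oo_cc.
  by rewrite h2 ?orbT// subset_itv_oo_cc.
rewrite -Xt -Yt /a /b; have [t0|t0] := leP 0 t => f1 f2.
  by apply: f1; rewrite X0 Y0.
by apply: f2; rewrite X0 Y0.
Qed.

(** Made total by [xget], with value [x] where no solution reaches time [t]. *)
Definition flow (t : R) (x : 'rV[R]_d) : 'rV[R]_d :=
  xget x [set w | evolves (fun=> f) setT 0 t x w].

Lemma flowP t x w : evolves (fun=> f) setT 0 t x w -> flow t x = w.
Proof.
move=> h; apply: (@evolves_unique t x) => //.
by rewrite /flow; case: xgetP => // /(_ w).
Qed.

Lemma is_derive_shift (V : normedModType R) (g : R -> V) (t u : R) l :
  is_derive (t + u) 1 g l -> is_derive u 1 (fun s => g (t + s)) l.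
Proof.
move=> [dg <-].
have e : (fun h : R => h^-1 *: (g (t + (h *: 1 + u)) - g (t + u))) =
    (fun h : R => h^-1 *: (g (h *: 1 + (t + u)) - g (t + u))).
  by apply/funext => h; rewrite addrCA.
by apply: DeriveDef; [rewrite /derivable /= e|rewrite /derive /= e].
Qed.

Lemma evolvesI (v : R -> 'rV[R]_d -> 'rV[R]_d) (Om : set 'rV[R]_d) (s t : R) (x : R -> 'rV[R]_d) :
  (forall u, u \in `[Num.min s t, Num.max s t] -> is_derive u 1 x (v u (x u)) /\ Om (x u)) ->
  evolves v Om s t (x s) (x t).
Proof.
move=> h; exists x; split=> //.
- apply: continuous_in_subspaceT => u /set_mem uab; apply: differentiable_continuous.
  by rewrite -derivable1_diffP; have [[]] := h u uab.
- by move=> u uab; have [] := h u (subset_itv_oo_cc uab).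
- by move=> u /h[].
Qed.

(** By uniqueness the chosen values agree near [(0, x0)] with the analytic local solution. The last
    clause runs this solution backwards: the field being autonomous, [u |-> F (t + u) y] is a
    solution starting at [F t y]. *)
Lemma flow_local x0 : analv (tcons 0 x0) (joint flow) /\
  exists2 delta, 0 < delta & forall (t : R) y, `|t| < delta -> `|y - x0| < delta ->
    [/\ is_derive t 1 (flow ^~ y) (f (flow t y)), flow 0 y = y,
        evolves (fun=> f) setT 0 t y (flow t y) & flow (- t) (flow t y) = y].
Proof.
have [F [Fan [delta d0 Fd]]] := local_flow (fan x0).
have itv0 (t u : R) : `|t| < delta -> u \in `[Num.min 0 t, Num.max 0 t] -> `|u| < delta.
  rewrite in_itv/= ltr_norml ltr_norml; have [t0|t0] := leP 0 t; lra.
have Fev t y : `|t| < delta -> `|y - x0| < delta -> evolves (fun=> f) setT 0 t y (F t y).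
  move=> td yd; have [F0 _] := Fd t y td yd; rewrite -[X in evolves _ _ _ _ X]F0.
  apply: (@evolvesI _ _ _ _ (F ^~ y)) => u uab; split=> //.
  by have [] := Fd u y (itv0 _ _ td uab) yd.
have Fflow t y : `|t| < delta -> `|y - x0| < delta -> flow t y = F t y.
  by move=> td yd; apply: flowP; exact: Fev.
split.
  apply: analv_ext Fan; apply/near_tcons; exists delta => // s y; rewrite subr0 => sd yd.
  by rewrite !jointE Fflow.
exists delta => // t y td yd; split.
- rewrite Fflow//; apply: (@near_eq_is_derive _ _ _ (F ^~ y)).
    apply/near_at; exists (delta - `|t|); first by lra.
    by move=> h hd; rewrite Fflow//; apply: le_lt_trans (ler_normD _ _) _; lra.
  by have [] := Fd t y td yd.
- by rewrite Fflow ?normr0//; have [] := Fd t y td yd.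
- by rewrite Fflow//; exact: Fev.
- apply: flowP; rewrite Fflow//.
  have := @evolvesI (fun=> f) setT 0 (- t) (fun u => F (t + u) y).
  have F0y : F 0 y = y by have [] := Fd t y td yd.
  rewrite /= subrr F0y addr0; apply => u uab; split=> //.
  have td' : `|t + u| < delta.
    move: td uab; rewrite in_itv/= !ltr_norml; have [t0|t0] := leP 0 (- t); lra.
  have [_ dF] := Fd (t + u) y td' yd.
  exact: (@is_derive_shift _ (F ^~ y)).
Qed.

End Flow.

(** * The interpolating vector field *)

Section PowerDivision.
Context {R : realType}.

Lemma near_tcons3 d (x0 : 'rV[R]_d) (P : set 'rV[R]_(1 + (1 + (1 + d)))) :
  (\forall z \near tcons3 0 0 0 x0, P z) <->
  exists2 r : R, 0 < r & forall a b c x, `|a| < r -> `|b| < r -> `|c| < r -> `|x - x0| < r ->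
    P (tcons3 a b c x).
Proof.
split.
  move=> /near_ball[r r0 h]; exists r => // a b c x ar br cr xr.
  rewrite -(subrKC (tcons3 0 0 0 x0) (tcons3 a b c x)); apply: h.
  by rewrite tcons3B !subr0 tcons3_norm_lt ar br cr.
move=> [r r0 h]; apply/near_ball; exists r => // z.
rewrite (tconsE z) (tconsE (rsubmx z)) (tconsE (rsubmx (rsubmx z))).
rewrite -/(tcons3 _ _ _ _) tcons3_norm_lt => /and4P[z1 z2 z3 z4].
rewrite /tcons3 !tconsD !add0r; apply: h => //.
by rewrite addrAC subrr add0r.
Qed.

Lemma joint_near d e (F : R -> 'rV[R]_d -> 'rV[R]_e) t x u : 0 < u ->
  analv (tcons t x) (joint F) ->
  exists2 s, 0 < s & forall h y, `|h - t| < s -> `|y - x| < s -> `|F h y - F t x| <= u.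
Proof.
move=> u0 /analv_continuous /cvg_atP c.
have /near_tcons[s s0 hs] := c u u0.
exists s => // h y ht yx; have := hs h y ht yx.
by rewrite jointE distrC /joint /tcons row_mxKl row_mxKr mxE eqxx mulr1n.
Qed.

Lemma joint_cvg d (B : R -> 'rV[R]_d -> R) t0 xi : anal (tcons t0 xi) (joint B) ->
  B h xi @[h --> t0] --> B t0 xi.
Proof.
move=> /anal_continuous /cvg_atP c; apply/cvg_atP => u u0.
have /near_tcons[r r0 h] := c u u0.
apply/near_at; exists r => // k kr.
have := h (t0 + k) xi; rewrite jointE -[B (lsubmx _ _ _) _]/(joint B _) jointE => H; apply: H; first by rewrite addrAC subrr add0r.
by rewrite subrr normr0.
Qed.

(** Each induction step divides by [e] once: the bound forces [A 0] to vanish near [x0], so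
    [A = e * B], and [B] inherits the bound with exponent one lower, by cancellation for [e != 0]
    and by continuity at [e = 0]. *)
Lemma anal_divide_power d (A : R -> 'rV[R]_d -> R) x0 n :
  anal (tcons 0 x0) (joint A) ->
  (exists C delta, 0 < delta /\ forall e xi, `|e| < delta -> `|xi - x0| < delta ->
     `|A e xi| <= C * `|e| ^+ n) ->
  exists B : R -> 'rV[R]_d -> R, anal (tcons 0 x0) (joint B) /\
    exists2 delta, 0 < delta & forall e xi, `|e| < delta -> `|xi - x0| < delta ->
      A e xi = e ^+ n * B e xi.
Proof.
elim: n A => [|n IH] A Aan.
  by move=> _; exists A; split=> //; exists 1 => // e xi _ _; rewrite expr0 mul1r.
move=> [C [delta [d0 AC]]].
have [r [M [r0 AM]]] := Aan.
have [q qM qe] := rep_divide (lshift d 0) r0 AM.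
pose B e xi := q (tcons e (xi - x0)).
have [s [s0 sr sd]] : exists s, [/\ 0 < s, s <= r & s <= delta].
  by exists (Num.min r delta); rewrite lt_min r0 d0 !ge_min !lexx orbT.
have A0 xi : `|xi - x0| < delta -> A 0 xi = 0.
  move=> xid; apply/eqP; rewrite -normr_le0.
  have d0' : `|0 : R| < delta by rewrite normr0.
  by apply: le_trans (AC 0 xi d0' xid) _; rewrite normr0 expr0n mulr0.
have AB e xi : `|e| < s -> `|xi - x0| < s -> A e xi = e * B e xi.
  move=> es xis.
  have hr : `|tcons e (xi - x0)| <= r.
    by apply: ltW; apply: lt_le_trans sr; rewrite tcons_norm_lt es.
  have := qe _ hr; rewrite tcons_fst tconsD add0r subrKC jointE => ->.
  have -> : zero_at (lshift d 0) (tcons e (xi - x0)) = tcons 0 (xi - x0).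
    apply/rowP => j; rewrite mxE; case: (split_ordP j) => k ->.
      by rewrite (ord1 k) eqxx tcons_fst.
    by rewrite eq_rlshift !row_mxEr.
  rewrite tconsD addr0 subrKC jointE A0 ?add0r//.
  exact: lt_le_trans xis sd.
have Ban : anal (tcons 0 x0) (joint B).
  apply: (@anal_ext _ _ _ (fun z => q (z - tcons 0 x0))).
    by apply/near_ball; exists 1 => // h _; rewrite {1}(tconsE (_ + h)) tconsB subr0.
  exists r, (r^-1 * M); split=> //; apply: rep_ext qM => h _.
  by rewrite addrAC subrr add0r.
have [|B1 [B1an [delta1 d1 B1e]]] := IH B Ban.
  (* The limit [e -> 0] is taken at every [xi] near [x0], hence analyticity at [(0, xi)] and not at
     [(0, x0)] alone. *)
  have /near_tcons[t t0 Bt] := anal_near Ban.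
  exists C, (Num.min s t); split; first by rewrite lt_min s0.
  have Bne e xi : e != 0 -> `|e| < s -> `|xi - x0| < s -> `|B e xi| <= C * `|e| ^+ n.
    move=> e0 es xis; have := AC e xi (lt_le_trans es sd) (lt_le_trans xis sd).
    by rewrite (AB _ _ es xis) normrM exprS mulrCA ler_pM2l ?normr_gt0.
  move=> e xi; rewrite !lt_min => /andP[es et] /andP[xis xit].
  have [->|e0] := eqVneq e 0; last exact: Bne.
  have cB : B h xi @[h --> (0 : R)] --> B 0 xi.
    apply: joint_cvg; apply: Bt => //; by rewrite subrr normr0.
  have cC : C * `|h| ^+ n - `|B h xi| @[h --> (0 : R)^'] --> C * `|0 : R| ^+ n - `|B 0 xi|.
    apply: cvgB.
      have cn : `|h| @[h --> (0 : R)^'] --> `|0 : R| by apply: cvg_norm; exact: nbhs_dnbhs.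
      apply: cvgM; first exact: cvg_cst.
      apply: (cvg_comp _ (fun x : R => x ^+ n) cn); exact: exprn_continuous.
    by apply: cvg_norm; apply: cvg_trans cB; apply: cvg_app; exact: nbhs_dnbhs.
  have : 0 <= C * `|0 : R| ^+ n - `|B 0 xi|.
    rewrite -(cvg_lim _ cC)//; apply: limr_ge; first by apply/cvg_ex; eexists; exact: cC.
    near=> h; rewrite subr_ge0; apply: Bne => //.
      by near: h; exact: nbhs_dnbhs_neq.
    by near: h; exact: dnbhs0_lt.
  by rewrite subr_ge0.
exists B1; split=> //; exists (Num.min s delta1); first by rewrite lt_min s0.
move=> e xi; rewrite !lt_min => /andP[es et] /andP[xis xit].
by rewrite (AB _ _ es xis) (B1e _ _ et xit) exprS mulrA.
Unshelve. all: by end_near. Qed.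

(** The quotients given by [anal_divide_power] depend on the base point. Taking a limit at [e = 0]
    defines one function that coincides locally with all of them. *)
Definition divpow d n (A : R -> 'rV[R]_d -> 'rV[R]_d) (e : R) (xi : 'rV[R]_d) : 'rV[R]_d :=
  \row_i if e == 0 then lim (h ^- n * A h xi 0 i @[h --> 0^']) else e ^- n * A e xi 0 i.

Lemma divpowP d n (A : R -> 'rV[R]_d -> 'rV[R]_d) x0 :
  analv (tcons 0 x0) (joint A) ->
  (exists C delta, 0 < delta /\ forall e xi, `|e| < delta -> `|xi - x0| < delta ->
     `|A e xi| <= C * `|e| ^+ n) ->
  analv (tcons 0 x0) (joint (divpow n A)) /\
  exists2 delta, 0 < delta & forall e xi, `|e| < delta -> `|xi - x0| < delta ->
      A e xi = e ^+ n *: divpow n A e xi.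
Proof.
move=> Aan [C [delta [d0 AC]]].
have /choice[B BP] i : exists B : R -> 'rV[R]_d -> R, anal (tcons 0 x0) (joint B) /\
    \forall z \near tcons 0 x0, joint A z 0 i = lsubmx z 0 0 ^+ n * joint B z.
  have [||B [Ban [t t0 Be]]] := @anal_divide_power d (fun e xi => A e xi 0 i) x0 n.
  - exact: Aan.
  - exists C, delta; split=> // e xi ed xid.
    by apply: le_trans (AC e xi ed xid); exact: rV_coord_le.
  exists B; split=> //; apply/near_tcons; exists t => // e xi; rewrite subr0 => et xit.
  by rewrite !jointE Be// /tcons row_mxKl mxE eqxx mulr1n.
have h1 : \forall z \near tcons 0 x0, forall i, joint A z 0 i = lsubmx z 0 0 ^+ n * joint (B i) z.
  by apply: near_forall => i; case: (BP i).
have h2 : \forall z \near tcons 0 x0, forall i, anal z (joint (B i)).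
  by apply: near_forall => i; apply: anal_near; case: (BP i).
have /near_tcons[s s0 BA] : \forall z \near tcons 0 x0,
    (forall i, joint A z 0 i = lsubmx z 0 0 ^+ n * joint (B i) z) /\ forall i, anal z (joint (B i)).
  by move: h1 h2; exact: filterS2.
have BE e xi : `|e| < s -> `|xi - x0| < s -> divpow n A e xi = \row_i B i e xi.
  move=> es xis; apply/rowP => i; rewrite !mxE.
  have AB e' : `|e'| < s -> A e' xi 0 i = e' ^+ n * B i e' xi.
    move=> es'; have [|h _] := BA e' xi _ xis; first by rewrite subr0.
    by have := h i; rewrite !jointE /tcons row_mxKl mxE eqxx mulr1n.
  have [e0|e0] := eqVneq e 0; last by rewrite AB// mulKf// expf_neq0.
  rewrite e0; apply/cvg_lim => //.
  have t0' : `|0 - 0 : R| < s by rewrite subrr normr0.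
  have [_ /(_ i) /joint_cvg Bc] := BA 0 xi t0' xis.
  apply: (@cvg_trans _ (B i h xi @[h --> (0 : R)^'])); last first.
    by apply: cvg_trans Bc; apply: cvg_app; exact: nbhs_dnbhs.
  apply: near_eq_cvg; near=> h; rewrite AB.
    rewrite mulKf// expf_neq0//; near: h; exact: nbhs_dnbhs_neq.
  by near: h; exact: dnbhs0_lt.
split.
  move=> i; have [Ban _] := BP i; apply: anal_ext Ban.
  apply/near_tcons; exists s => // e xi; rewrite subr0 => es xis.
  by rewrite !jointE BE// mxE.
exists s => // e xi es xis; rewrite BE//; apply/rowP => i; rewrite !mxE.
have [|h _] := BA e xi _ xis; first by rewrite subr0.
by have := h i; rewrite !jointE /tcons row_mxKl mxE eqxx mulr1n.
Unshelve. all: by end_near. Qed.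

End PowerDivision.

(** * Inversion of maps close to the identity *)

Section Resolvent.
Context {R : realType} {d : nat}.
Variable K : R -> 'rV[R]_d -> 'rV[R]_d.
Hypothesis Kan : forall x, analv (tcons 0 x) (joint K).

(* Junk value y where no solution exists. *)
Definition resolvent (e k : R) (y : 'rV[R]_d) : 'rV[R]_d :=
  xget y [set w | w + k *: K e w = y /\ `|w - y| <= 1].

(** For small [k] the map [w |-> k *: K e w] has Lipschitz constant below 1 on the ball of radius
    [|x0| + 2]. The solution within distance 1 of [y] is therefore unique, and it is the analytic
    one of [local_inverse]. *)
Lemma resolvent_local x0 :
  analv (tcons 0 (tcons 0 x0)) (joint (fun e => joint (resolvent e))) /\
  exists2 delta, 0 < delta & forall (e k : R) y w,
    `|e| < delta -> `|k| < delta -> `|y - x0| < delta ->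
    w + k *: K e w = y -> `|w - y| <= 1 -> resolvent e k y = w.
Proof.
(* The radius [|x0| + 2] accommodates [|w - y| <= 1] and [|y - x0| < 1]. *)
have [|dl [L [dl0 hL]]] := @uniform_lipschitz R d d (fun e _ _ => K e) _ (`|x0| + 2).
  move=> x; have e : joint3 (fun e _ _ => K e) = (fun z => K (lsubmx z 0 0) (rsubmx (rsubmx (rsubmx z)))).
    by [].
  rewrite e; apply: (@analv_joint R d _ d _ K (fun z => lsubmx z 0 0)
    (fun z => rsubmx (rsubmx (rsubmx z)))); first exact: anal_fst.
    exact: (analv_comp (analv_rsub _) (analv_comp (analv_rsub _) (analv_rsub _))).
  rewrite tcons_lsub !tcons_rsub; exact: Kan.
have L1 : 0 < `|L| + 1 by rewrite ltr_wpDl.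
have [s [s0 sdl s1 sL]] : exists s, [/\ 0 < s, s <= dl, s <= 1 & s <= (`|L| + 1)^-1].
  exists (Num.min dl (Num.min 1 (`|L| + 1)^-1)).
  by rewrite !lt_min dl0 ltr01 invr_gt0 L1 !ge_min !lexx !orbT.
have uniq (e k : R) y w w' : `|e| < s -> `|k| < s -> `|y - x0| < s ->
    w + k *: K e w = y -> `|w - y| <= 1 ->
    w' + k *: K e w' = y -> `|w' - y| <= 1 -> w = w'.
  move=> es ks ys ww wy ww' wy'.
  have bnd v : `|v - y| <= 1 -> `|v| <= `|x0| + 2.
    move=> vy; have := ler_normD (v - y) y; have := ler_normD (y - x0) x0.
    by rewrite !subrK; lra.
  have h : `|w - w'| <= s * (L * `|w - w'|).
    have e1 : w - w' = (w + k *: K e w) - (w' + k *: K e w') - k *: (K e w - K e w').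
      by rewrite scalerBr opprD addrACA addrK.
    rewrite {1}e1 ww ww' subrr sub0r normrN normrZ.
    have hKL : `|K e w - K e w'| <= L * `|w - w'|.
      by apply: (hL e 0 0); rewrite ?normr0 ?bnd//; exact: lt_le_trans es sdl.
    apply: ler_pM; [exact: normr_ge0|exact: normr_ge0|exact: ltW|]. exact: hKL.
  have ww0 : `|w - w'| <= 0.
    rewrite leNgt; apply/negP => w0.
    have : s * (L * `|w - w'|) < `|w - w'|.
      rewrite mulrA gtr_pMl//; apply: (@le_lt_trans _ _ ((`|L| + 1)^-1 * `|L|)).
        apply: (@le_trans _ _ (s * `|L|)); first by rewrite ler_pM2l// ler_norm.
        by rewrite ler_wpM2r.
      by rewrite ltr_pdivrMl// mulr1 ltrDl.
    by rewrite ltNge h.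
  apply/rowP => i; apply/eqP; rewrite -subr_eq0 -normr_le0.
  by have := rV_coord_le (w - w') i; rewrite !mxE => hh; exact: le_trans hh ww0.
have [Z [Zan [dz dz0 hZ]]] := local_inverse (Kan x0).
have Z0 : Z 0 0 x0 = x0.
  by have := hZ 0 0 x0; rewrite !subrr !normr0 scale0r addr0 dz0; apply.
have h2 : (0 : R) < 2^-1 by rewrite invr_gt0.
have [s2 s20 hs2] := joint_near h2 Zan.
have Zy (e k : R) y : `|e| < s2 -> `|k| < s2 -> `|y - x0| < s2 -> `|Z e k y - x0| <= 2^-1.
  move=> es ks ys; have := hs2 e (tcons k y); rewrite !jointE Z0 subr0 => /(_ es); apply.
  by rewrite tconsB subr0 tcons_norm_lt ks.
(* [Z e k y] and [y] both stay within 1/2 of [x0], hence within the distance 1 of each other that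
   [resolvent] allows. *)
pose t := Num.min s (Num.min dz (Num.min s2 2^-1)).
have t0 : 0 < t by rewrite !lt_min s0 dz0 s20.
have ts : t <= s by rewrite ge_min lexx.
have tdz : t <= dz by rewrite !ge_min lexx !orbT.
have ts2 : t <= s2 by rewrite !ge_min lexx !orbT.
have t2 : t <= 2^-1 by rewrite !ge_min lexx !orbT.
have ZR (e k : R) y : `|e| < t -> `|k| < t -> `|y - x0| < t ->
    Z e k y + k *: K e (Z e k y) = y /\ `|Z e k y - y| <= 1.
  move=> et kt yt; split.
    by apply: hZ; [exact: lt_le_trans et tdz|exact: lt_le_trans kt tdz|exact: lt_le_trans yt tdz].
  have := Zy e k y (lt_le_trans et ts2) (lt_le_trans kt ts2) (lt_le_trans yt ts2) => zx.
  by have := ler_distD x0 (Z e k y) y; rewrite (distrC x0); have := ltW yt; lra.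
have RP (e k : R) y w : `|e| < t -> `|k| < t -> `|y - x0| < t ->
    w + k *: K e w = y -> `|w - y| <= 1 -> resolvent e k y = w.
  move=> et kt yt ww wy; rewrite /resolvent; case: xgetP => [v _ [v1 v2]|/(_ w)]; last by case.
  apply: (uniq e k y) => //; first exact: lt_le_trans et ts.
    exact: lt_le_trans kt ts.
  exact: lt_le_trans yt ts.
split; last by exists t.
apply: analv_ext Zan; apply/near_tcons; exists t => // e z; rewrite subr0 (tconsE z) tconsB tcons_norm_lt subr0.
move=> et /andP[kt yt]; rewrite !jointE; apply/esym.
by have [z1 z2] := ZR e _ _ et kt yt; apply: RP.
Qed.

End Resolvent.

Lemma le_half_mul2 (R : realType) (c r : R) : c <= r / 2 -> 2 * c <= r.
Proof. lra. Qed.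

(** * The interpolating curve and its generator *)

Section Interpolation.
Context {R : realType} {d : nat}.
Variables (f : 'rV[R]_d -> 'rV[R]_d) (Phi : R -> 'rV[R]_d -> 'rV[R]_d) (p : nat) (e0 : R).
Hypothesis fan : forall x, analv x f.
Hypothesis Phian : forall x, analv (tcons 0 x) (joint Phi).
Hypothesis e0_gt0 : 0 < e0.
Hypothesis Phierr : forall r, exists C, forall (e : R) z w, `|e| <= e0 -> `|z| <= r ->
  evolves (fun=> f) setT 0 e z w -> `|Phi e z - w| <= C * `|e| ^+ p.+1.

Local Notation F := (flow f).

Definition defect (e : R) (xi : 'rV[R]_d) : 'rV[R]_d := F (- e) (Phi e xi) - xi.

Definition remainder : R -> 'rV[R]_d -> 'rV[R]_d := divpow p.+1 defect.

(** Only [e ^+ p] is put here; the last factor of [e ^+ p.+1] is supplied by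
    [k = e * chi (t / e)]. *)
Definition shift_field (e : R) (xi : 'rV[R]_d) : 'rV[R]_d := e ^+ p *: remainder e xi.

(* The vector field generating x = F(t, xi + k e^p r(e, xi)) when k varies
   with unit speed, divided by e^p. *)
Definition generator (e t k : R) (x : 'rV[R]_d) : 'rV[R]_d :=
  \row_i \sum_j remainder e (resolvent shift_field e k (F (- t) x)) 0 j *
     partial (rshift 1 j) (fun z => joint F z 0 i) (tcons t (F (- t) x)).

Lemma flow0 x : F 0 x = x.
Proof.
have [_ [dl dl0 h]] := flow_local fan x.
by have [] := h 0 x; rewrite ?subrr ?normr0.
Qed.

(** The order condition at [e = 0], where its right-hand side vanishes. *)
Lemma Phi0 x : Phi 0 x = x.
Proof.
have [C hC] := Phierr `|x|.
have [_ [dl dl0 h]] := flow_local fan x.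
have [|| _ _ ev _] := h 0 x; rewrite ?subrr ?normr0//.
rewrite flow0 in ev.
have := hC 0 x x; rewrite normr0 expr0n mulr0 => /(_ (ltW e0_gt0) (lexx _) ev).
by move=> h1; apply/rowP => i; apply/eqP; rewrite -subr_eq0 -normr_le0;
  have := rV_coord_le (Phi 0 x - x) i; rewrite !mxE => /le_trans; apply.
Qed.

Lemma defect_anal x0 : analv (tcons 0 x0) (joint defect).
Proof.
have e : joint defect = (fun z => F (- lsubmx z 0 0) (joint Phi z) - rsubmx z).
  by apply/funext => z; rewrite (tconsE z) !jointE tcons_lsub tcons_rsub.
rewrite e; have hs : analv (tcons 0 x0) (fun z => - rsubmx z).
  by move=> i; apply: anal_eq (anal_opp (analv_rsub (tcons 0 x0) i)) => z; rewrite [RHS]mxE.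
apply: (analv_add _ hs).
apply: (@analv_joint R d _ d _ F (fun z => - lsubmx z 0 0) (joint Phi)).
- exact: anal_opp (anal_fst _).
- exact: Phian.
- rewrite jointE Phi0 tcons_lsub oppr0.
  by have [] := flow_local fan x0.
Qed.

(** [xi] equals [F (- e) (F e xi)], so the defect compares the values of [F (- e)] at [Phi e xi] and
    at [F e xi]; local Lipschitz continuity of the flow reduces it to the order condition. *)
Lemma defect_bound x0 : exists C delta, 0 < delta /\ forall e xi, `|e| < delta ->
  `|xi - x0| < delta -> `|defect e xi| <= C * `|e| ^+ p.+1.
Proof.
have [Fan [dl dl0 hF]] := flow_local fan x0.
have [r [L [r0 L0 hL _]]] := analv_lipschitz Fan.
have [s1 s10 hs1] := joint_near r0 (Phian x0).
have [s2 s20 hs2] := joint_near r0 Fan.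
rewrite Phi0 in hs1; rewrite flow0 in hs2.
have [C hC] := Phierr (`|x0| + 1).
have [s [[s0 sdl s1' ss1] ss2 sr se0]] : exists s, [/\ [/\ 0 < s, s <= dl, s <= 1 & s <= s1],
    s <= s2, s <= r & s <= e0].
  exists (Num.min dl (Num.min 1 (Num.min s1 (Num.min s2 (Num.min r e0))))).
  by rewrite !lt_min dl0 ltr01 s10 s20 r0 e0_gt0 !ge_min !lexx !orbT.
exists (L * C), s; split=> // e xi es xis.
have edl : `|e| < dl by exact: lt_le_trans es sdl.
have xdl : `|xi - x0| < dl by exact: lt_le_trans xis sdl.
have [_ _ ev fl] := hF e xi edl xdl.
rewrite /defect -[X in _ - X]fl -mulrA.
have e1 w : F (- e) w = joint F (tcons 0 x0 + tcons (- e) (w - x0)).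
  by rewrite tconsD add0r subrKC jointE.
have xir : `|xi| <= `|x0| + 1.
  by have := ler_normD (xi - x0) x0; rewrite subrK; lra.
have nle w : `|w - x0| <= r -> `|tcons (- e) (w - x0)| <= r.
  move=> wr; apply/ler_addgt0Pr => eta eta0; apply: ltW; rewrite tcons_norm_lt normrN.
  by apply/andP; split; lra.
have k1 : `|Phi e xi - x0| <= r by apply: hs1; rewrite ?subr0; apply: lt_le_trans ss1.
have k2 : `|F e xi - x0| <= r by apply: hs2; rewrite ?subr0; apply: lt_le_trans ss2.
rewrite !e1; apply: le_trans (hL _ _ (nle _ k1) (nle _ k2)) _.
rewrite ler_wpM2l// tconsB subrr opprB addrA subrK.
apply: (@le_trans _ _ `|Phi e xi - F e xi|).
  apply/ler_addgt0Pr => eta eta0; apply: ltW; rewrite tcons_norm_lt normr0.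
  by rewrite ltrDl eta0 andbT ltr_wpDl.
by apply: hC => //; apply: ltW; exact: lt_le_trans se0.
Qed.

Lemma remainder_local x0 : analv (tcons 0 x0) (joint remainder) /\
  exists2 delta, 0 < delta & forall e xi, `|e| < delta -> `|xi - x0| < delta ->
    defect e xi = e ^+ p.+1 *: remainder e xi.
Proof. exact: divpowP (defect_anal x0) (defect_bound x0). Qed.

Lemma shift_field_anal x0 : analv (tcons 0 x0) (joint shift_field).
Proof.
apply: (@analv_scale R _ _ (tcons 0 x0) (fun z => lsubmx z 0 0 ^+ p) (joint remainder)).
  exact: anal_exp (anal_fst _).
by have [] := remainder_local x0.
Qed.

Lemma resolvent0 e x : resolvent shift_field e 0 x = x.
Proof.
rewrite /resolvent; case: xgetP => [v _ [v1 v2]|]; last by [].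
by move: v1; rewrite scale0r addr0.
Qed.

(** At [(0, 0, 0, x0)] the backward flow and the resolvent both return [x0], so the local statements
    at [x0] compose. *)
Lemma generator_anal x0 : analv (tcons3 0 0 0 x0) (joint3 generator).
Proof.
set z0 := tcons3 0 0 0 x0.
pose ez (z : 'rV[R]_(1 + (1 + (1 + d)))) := lsubmx z 0 0.
pose tz (z : 'rV[R]_(1 + (1 + (1 + d)))) := lsubmx (rsubmx z) 0 0.
pose kz (z : 'rV[R]_(1 + (1 + (1 + d)))) := lsubmx (rsubmx (rsubmx z)) 0 0.
pose xz (z : 'rV[R]_(1 + (1 + (1 + d)))) := rsubmx (rsubmx (rsubmx z)).
have eza : anal z0 ez by exact: anal_fst.
have tza : anal z0 tz by exact: (anal_comp (analv_rsub z0) (anal_fst _)).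
have r2 : analv z0 (fun z => rsubmx (rsubmx z)) by exact: (analv_comp (analv_rsub z0) (analv_rsub _)).
have kza : anal z0 kz by exact: (anal_comp r2 (anal_fst _)).
have xza : analv z0 xz by exact: (analv_comp r2 (analv_rsub _)).
have ez0 : ez z0 = 0 by rewrite /ez /z0 tcons_lsub.
have tz0 : tz z0 = 0 by rewrite /tz /z0 tcons_rsub tcons_lsub.
have kz0 : kz z0 = 0 by rewrite /kz /z0 !tcons_rsub tcons_lsub.
have xz0 : xz z0 = x0 by rewrite /xz /z0 !tcons_rsub.
have [Fan _] := flow_local fan x0.
pose yz z := F (- tz z) (xz z).
have yz0 : yz z0 = x0 by rewrite /yz tz0 xz0 oppr0 flow0.
have yza : analv z0 yz.
  apply: (@analv_joint R d _ d _ F (fun z => - tz z) xz) => //; first exact: anal_opp.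
  by rewrite tz0 xz0 oppr0.
have [Ran _] := resolvent_local shift_field_anal x0.
pose wz z := resolvent shift_field (ez z) (kz z) (yz z).
have wza : analv z0 wz.
  apply: (analv_ext _ (analv_comp (analv_tcons eza (analv_tcons kza yza)) _)); last first.
    by rewrite /= ez0 kz0 yz0; exact: Ran.
  by apply/near_ball; exists 1 => // h _; rewrite !jointE.
have wz0 : wz z0 = x0 by rewrite /wz ez0 kz0 yz0 resolvent0.
have [Rma _] := remainder_local x0.
have rza : analv z0 (fun z => remainder (ez z) (wz z)).
  by apply: (@analv_joint R d _ d _ remainder ez wz) => //; rewrite ez0 wz0.
have e : joint3 generator = (fun z => \row_i \sum_j remainder (ez z) (wz z) 0 j *
     partial (rshift 1 j) (fun z => joint F z 0 i) (tcons (tz z) (yz z))) by [].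
rewrite e => i.
apply: (@anal_eq _ _ _ (fun z => \sum_j remainder (ez z) (wz z) 0 j *
     partial (rshift 1 j) (fun z => joint F z 0 i) (tcons (tz z) (yz z)))).
  by move=> z; rewrite mxE.
apply: anal_sum => j; apply: anal_mul; first exact: rza.
apply: (anal_comp (G := fun z => tcons (tz z) (yz z))).
  exact: analv_tcons.
by rewrite tz0 yz0; apply: anal_partial; exact: Fan.
Qed.

(** Chain rule for [F (t, y t)] with [y t = xi + k t *: shift_field e xi]. The time derivative of
    [F] gives [f (X t)]; the derivative in the second argument gives the generator, because [k] has
    derivative [chi' (t / e)] and because [xi] is the resolvent of [y t = F (- t) (X t)]. The end
    point is right because [y e] is [F (- e) (Phi e xi)]. *)
Lemma interpolation_local (chi chi' : R -> R) x0 :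
  (forall tau : R, is_derive tau 1 chi (chi' tau)) ->
  (forall tau, 0 <= chi tau <= 1) -> chi 0 = 0 -> chi 1 = 1 ->
  exists2 delta, 0 < delta & forall (e : R) xi, 0 < e < delta -> `|xi - x0| < delta ->
    let X t := F t (xi + (e * chi (t / e)) *: shift_field e xi) in
    [/\ X 0 = xi, X e = Phi e xi &
      forall t : R, 0 <= t <= e -> `|X t| <= `|xi| + 1 /\
        is_derive t 1 X (f (X t) + e ^+ p *: (chi' (t / e) *:
                           generator e t (e * chi (t / e)) (X t)))].
Proof.
move=> dchi chi01 chi0 chi1.
have [Fan [s1 s10 hF]] := flow_local fan x0.
have [_ [s2 s20 hR]] := resolvent_local shift_field_anal x0.
have [_ [s3 s30 hD]] := remainder_local x0.
have h4 : (0 : R) < 4^-1 by rewrite invr_gt0.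
have [s4 s40 hs4] := joint_near h4 Fan; rewrite flow0 in hs4.
have /near_tcons[s5 s50 hs5] := analv_near Fan.
have s12 : 0 < s1 / 2 by rewrite divr_gt0.
have [s6 s60 hs6] := joint_near s12 (Phian x0); rewrite Phi0 in hs6.
have [s7 [L [s70 L0 _ hK]]] := analv_lipschitz (shift_field_anal x0).
have [c [[c0 c1 c2 c3] [c4 c5 c6 c7] c8]] : exists c, [/\ [/\ 0 < c, c <= s1 / 2, c <= s2 / 2 & c <= s3],
    [/\ c <= s4 / 2, c <= s5 / 2, c <= s6 & c <= s7] & c <= 4^-1].
  exists (Num.min (s1 / 2) (Num.min (s2 / 2) (Num.min s3 (Num.min (s4 / 2) (Num.min (s5 / 2)
    (Num.min s6 (Num.min s7 4^-1))))))).
  by rewrite !lt_min !divr_gt0// s30 s60 s70 h4 !ge_min !lexx !orbT.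
have c1' := le_half_mul2 c1; have c2' := le_half_mul2 c2.
have c4' := le_half_mul2 c4; have c5' := le_half_mul2 c5.
have cc : c <= 2 * c by rewrite ler_peMl ?(ltW c0)// ler1n.
have L1 : 0 < L + 1 by rewrite ltr_wpDl.
(* [s * L <= c] keeps [y t] within [c] of [xi], hence within [2 * c] of [x0]; this is why the radii
   that concern [y t] are halved in the choice of [c]. *)
have [s [s0 sc sL]] : exists s, [/\ 0 < s, s <= c & s * L <= c].
  exists (c / (L + 1)); split; first by rewrite divr_gt0.
    by rewrite ler_pdivrMr// ler_peMr ?(ltW c0)// lerDr.
  by rewrite -mulrA ler_piMr ?(ltW c0)// mulrC ler_pdivrMr// mul1r lerDl.
have sc2 := le_trans sc cc.
exists s => // e xi /andP[ep es] xis X.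
have e_neq0 : e != 0 by rewrite gt_eqF.
have eabs : `|e| < s by rewrite gtr0_norm.
pose k t := e * chi (t / e).
pose y t := xi + k t *: shift_field e xi.
have ks t : `|k t| <= e.
  have /andP[q0 q1] := chi01 (t / e).
  by rewrite /k normrM (gtr0_norm ep) ler_piMr ?(ltW ep)// ger0_norm.
have Kb : `|shift_field e xi| <= L.
  rewrite -[shift_field e xi]jointE.
  have -> : tcons e xi = tcons 0 x0 + tcons e (xi - x0) by rewrite tconsD add0r subrKC.
  apply: hK; apply: ltW; rewrite tcons_norm_lt; apply/andP; split.
    by rewrite (lt_le_trans eabs)// (le_trans sc).
  by rewrite (lt_le_trans xis)// (le_trans sc).
have yxi t : `|y t - xi| <= c.
  rewrite /y [xi + _]addrC addrK normrZ; apply: le_trans sL.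
  by apply: ler_pM; rewrite ?normr_ge0//; apply: le_trans (ks t) (ltW es).
have yx0 t : `|y t - x0| < 2 * c.
  apply: le_lt_trans (ler_distD xi (y t) x0) _; rewrite mulr2n mulrDl !mul1r.
  by apply: ler_ltD (yxi t) _; exact: lt_le_trans xis sc.
have tabs t : 0 <= t <= e -> `|t| < s.
  by move=> /andP[t0 te]; rewrite ger0_norm//; exact: le_lt_trans te es.
have X0 : X 0 = xi by rewrite /X mul0r chi0 mulr0 scale0r addr0 flow0.
have Xe : X e = Phi e xi.
  (* [e * e ^+ p] recombines to [e ^+ p.+1], which turns the shift into the defect. *)
  rewrite /X divff// chi1 mulr1 /shift_field scalerA -exprS -hD; last 2 first.
  - by rewrite (lt_le_trans eabs)// (le_trans sc).
  - by rewrite (lt_le_trans xis)// (le_trans sc).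
  rewrite /defect subrKC.
  have [||_ _ _] := hF (- e) (Phi e xi).
  - by rewrite normrN; exact: lt_le_trans eabs (le_trans sc2 c1').
  - apply: (@le_lt_trans _ _ (s1 / 2)); last by rewrite ltr_pdivrMr// ltr_pMr// ltr1n.
    apply: hs6; rewrite ?subr0; first by rewrite (lt_le_trans eabs)// (le_trans sc).
    by rewrite (lt_le_trans xis)// (le_trans sc).
  - by rewrite opprK.
split=> // t t0e; have ts := tabs t t0e; have y0 := yx0 t.
have ts4 : `|t - 0| < s4 by rewrite subr0; exact: lt_le_trans ts (le_trans sc2 c4').
have ys4 := lt_le_trans y0 c4'.
have Xx0 : `|X t - x0| <= 4^-1 by exact: hs4.
split.
  have h1 := ler_distD x0 (X t) xi; rewrite (distrC x0) in h1.
  have h2 : `|X t - xi| <= 1.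
    have xis4 := le_trans (ltW xis) (le_trans sc c8).
    by apply: le_trans h1 _; move: Xx0 xis4; clear; lra.
  have := ler_normD (X t - xi) xi; rewrite subrK.
  by move: h2; clear; lra.
have ts1 := lt_le_trans ts (le_trans sc2 c1'); have ys1 := lt_le_trans y0 c1'.
have [dF _ _ Fy] := hF t (y t) ts1 ys1.
have resy : resolvent shift_field e (k t) (y t) = xi.
  apply: hR => //.
  - exact: lt_le_trans eabs (le_trans sc2 c2').
  - exact: le_lt_trans (ks t) (lt_le_trans es (le_trans sc2 c2')).
  - exact: lt_le_trans y0 c2'.
  - rewrite distrC; apply: le_trans (yxi t) (le_trans c8 _).
    by rewrite invf_le1// ler1n.
have ts5 : `|t - 0| < s5 by rewrite subr0; exact: lt_le_trans ts (le_trans sc2 c5').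
have ys5 := lt_le_trans y0 c5'.
have Fty := hs5 _ _ ts5 ys5.
have dk : is_derive t 1 k (chi' (t / e)).
  have d1 : is_derive t 1 (fun u : R => e^-1 *: u) e^-1.
    by have := is_deriveZ e^-1 (is_derive_id t (1 : R)); rewrite /GRing.scale/= mulr1.
  have d2 := dchi (e^-1 *: t).
  have d3 := is_deriveZ e (is_derive1_comp d2 d1).
  have -> : k = e \*: (chi \o (fun u : R => e^-1 *: u)).
    by apply/funext => u; rewrite /k /= /GRing.scale/= mulrC mulrC (mulrC u).
  apply: (is_derive_eq d3); rewrite /GRing.scale/= (mulrC e^-1 t).
  by field.
have dy : is_derive t 1 y (chi' (t / e) *: shift_field e xi).
  apply: is_derive_coords => i.
  rewrite (_ : (fun z => _) = (fun z => xi 0 i + shift_field e xi 0 i *: k z)); last first.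
    by apply/funext => u; rewrite !mxE mulrC.
  have dk' := is_deriveD (is_derive_cst (xi 0 i) t (1 : R)) (is_deriveZ (shift_field e xi 0 i) dk).
  by apply: (is_derive_eq dk'); rewrite add0r [RHS]mxE /GRing.scale/= mulrC.
have dH : is_derive t 1 (fun u => tcons u (y u)) (tcons 1 (chi' (t / e) *: shift_field e xi)).
  apply: is_derive_coords => j; case: (split_ordP j) => j' ->.
    rewrite (ord1 j') tcons_fst (_ : (fun z => _) = id); first exact: is_derive_id.
    by apply/funext => u; rewrite tcons_fst.
  rewrite row_mxEr (_ : (fun z => _) = (fun z => y z 0 j')); first exact: is_derive_coord.
  by apply/funext => u; rewrite row_mxEr.
apply: is_derive_coords => i.
have dX := @anal_chain R (1 + d) _ t 1 (fun u => tcons u (y u)) _ (fun z => joint F z 0 i) (Fty i) dH.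
have -> : (fun z => X z 0 i) = (fun z => joint F (tcons z (y z)) 0 i).
  by apply/funext => u; rewrite jointE.
apply: (is_derive_eq dX).
rewrite (@big_split_ord _ _ _ 1 d) big_ord1 /= tcons_fst mul1r.
(* The partial derivative in time is computed along [u |-> (u, y t)] with the second argument
   frozen, where the flow solves its equation. *)
have -> : partial (lshift d 0) (fun z => joint F z 0 i) (tcons t (y t)) = f (X t) 0 i.
  have := @anal_chain R (1 + d) _ t 1 (fun u => tcons u (y t)) _ (fun z => joint F z 0 i) (Fty i)
    (is_derive_tcons t (y t)).
  rewrite (bigD1 (lshift d 0))//= big1 => [|j /negPf ji]; last first.
    by rewrite mxE ji andbF mul0r.
  rewrite mxE !eqxx mul1r addr0 => -[_ <-].
  have [_ <-] := is_derive_coord dF i.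
  by congr ('D_1 _ t); apply/funext => u; rewrite jointE.
rewrite [RHS]mxE; congr (_ + _).
rewrite !mxE mulr_sumr mulr_sumr; apply: eq_bigr => j _.
rewrite row_mxEr -/(k t) Fy resy !mxE.
by rewrite -!mulrA mulrCA.
Qed.

End Interpolation.

(** * Smooth dependence on time *)

Section SmoothStep.
Context {R : realType}.
Implicit Types a b : R -> R.

(** [Dk 0] already demands derivability, so [Dk k] asserts derivatives up to order [k.+1];
    continuity of those of order at most [k] is then automatic. *)
Fixpoint Dk (k : nat) a : Prop :=
  (forall x : R, derivable a x 1) /\ (if k is k'.+1 then Dk k' (derive1 a) else True).

Definition smooth a := forall k, Dk k a.

Lemma smooth_derivable a (x : R) : smooth a -> derivable a x 1.
Proof. by move=> /(_ 0%N)[]. Qed.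

Lemma smooth_is_derive a (x : R) : smooth a -> is_derive x 1 a ((derive1 a) x).
Proof. by move=> h; apply: DeriveDef; [exact: smooth_derivable|rewrite derive1E]. Qed.

Lemma smooth_derive1 a : smooth a -> smooth (derive1 a).
Proof. by move=> h k; have [_] := h k.+1. Qed.

Lemma derive1_fun a a' : (forall x : R, is_derive x 1 a (a' x)) -> (derive1 a) = a'.
Proof. by move=> h; apply/funext => x; rewrite derive1E; have [_] := h x. Qed.

Lemma Dk_step k a a' : (forall x : R, is_derive x 1 a (a' x)) ->
  (if k is k'.+1 then Dk k' a' else True) -> Dk k a.
Proof.
case: k => [|k] h; first by split=> // x; have [] := h x.
by move=> h'; split; [move=> x; have [] := h x|rewrite (derive1_fun h)].
Qed.

Lemma Dk_is_derive k a (x : R) : Dk k a -> is_derive x 1 a ((derive1 a) x).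
Proof. by case: k => [|k] [d _]; apply: DeriveDef; rewrite ?derive1E. Qed.

Lemma Dk_le k a : Dk k.+1 a -> Dk k a.
Proof. by elim: k a => [|k IH] a [d h]; split=> //; exact: IH. Qed.

Lemma Dk_cst k (c : R) : Dk k (fun=> c).
Proof.
elim: k c => [|k IH] c; set u := (X in Dk _ X).
  by apply: (@Dk_step 0 u (fun=> 0)) => // x; exact: is_derive_cst.
by apply: (@Dk_step k.+1 u (fun=> 0)); exact: IH.
Qed.

Lemma Dk_add k a b : Dk k a -> Dk k b -> Dk k (fun x => a x + b x).
Proof.
elim: k a b => [|k IH] a b ha hb; set c := (X in Dk _ X).
  apply: (@Dk_step 0 c (fun x => derive1 a x + derive1 b x)) => // x.
  exact: is_deriveD (Dk_is_derive x ha) (Dk_is_derive x hb).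
apply: (@Dk_step k.+1 c (fun x => derive1 a x + derive1 b x)) => [x|].
  exact: is_deriveD (Dk_is_derive x ha) (Dk_is_derive x hb).
by apply: IH; [case: ha|case: hb].
Qed.

Lemma is_deriveMf a b (x l m : R) : is_derive x 1 a l -> is_derive x 1 b m ->
  is_derive x 1 (fun x => a x * b x) (l * b x + a x * m).
Proof.
move=> ha hb; have h := is_deriveM ha hb; apply: (is_derive_eq h).
by rewrite /GRing.scale/=; ring.
Qed.

Lemma Dk_mul k a b : Dk k a -> Dk k b -> Dk k (fun x => a x * b x).
Proof.
elim: k a b => [|k IH] a b ha hb; set c := (X in Dk _ X).
  apply: (@Dk_step 0 c (fun x => derive1 a x * b x + a x * derive1 b x)) => // x.
  exact: is_deriveMf (Dk_is_derive x ha) (Dk_is_derive x hb).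
apply: (@Dk_step k.+1 c (fun x => derive1 a x * b x + a x * derive1 b x)) => [x|].
  exact: is_deriveMf (Dk_is_derive x ha) (Dk_is_derive x hb).
have [_ ha'] := ha; have [_ hb'] := hb.
exact: Dk_add (IH _ _ ha' (Dk_le hb)) (IH _ _ (Dk_le ha) hb').
Qed.

Lemma Dk_inv k a : (forall x, a x != 0) -> Dk k a -> Dk k (fun x => (a x)^-1).
Proof.
move=> a0; pose c x := (a x)^-1.
have dc k' (x : R) : Dk k' a -> is_derive x 1 c (-1 * (derive1 a x * (c x * c x))).
  move=> ha; apply: (is_derive_eq (is_deriveV (a0 x) (Dk_is_derive x ha))).
  by rewrite /GRing.scale/= /c expr2 invfM; ring.
elim: k => [|k IH] ha.
  by apply: (@Dk_step 0 c (fun x => -1 * (derive1 a x * (c x * c x)))) => // x; exact: dc ha.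
apply: (@Dk_step k.+1 c (fun x => -1 * (derive1 a x * (c x * c x)))) => [x|]; first exact: dc ha.
have ia := IH (Dk_le ha); have [_ ha'] := ha.
exact: Dk_mul (Dk_cst _ _) (Dk_mul ha' (Dk_mul ia ia)).
Qed.

Lemma Dk_affine k a (s c : R) : Dk k a -> Dk k (fun x => a (s * x + c)).
Proof.
have aff (x : R) : is_derive x 1 (fun x => s * x + c) s.
  have := is_deriveD (is_deriveZ s (is_derive_id x (1 : R))) (is_derive_cst c x (1 : R)).
  by rewrite addr0 /GRing.scale/= mulr1.
have dc k' a' (x : R) : Dk k' a' -> is_derive x 1 (fun x => a' (s * x + c)) (s * derive1 a' (s * x + c)).
  by move=> ha; rewrite mulrC; exact: (@is_derive1_comp R a' (fun x => s * x + c) x _ _ (Dk_is_derive (s * x + c) ha) (aff x)).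
elim: k a => [|k IH] a ha; set u := (X in Dk _ X).
  by apply: (@Dk_step 0 u (fun x => s * derive1 a (s * x + c))) => // x; exact: dc ha.
apply: (@Dk_step k.+1 u (fun x => s * derive1 a (s * x + c))) => [x|]; first exact: dc ha.
have [_ ha'] := ha.
exact: Dk_mul (Dk_cst _ _) (IH _ ha').
Qed.

Lemma smooth_mul a b : smooth a -> smooth b -> smooth (fun x => a x * b x).
Proof. by move=> ha hb k; exact: Dk_mul. Qed.

Lemma smooth_shift a (c : R) : smooth a -> smooth (fun x => a (x - c)).
Proof.
move=> ha k; have := @Dk_affine k a 1 (- c) (ha k).
by congr Dk; apply/funext => x; rewrite mul1r.
Qed.

Lemma smooth_id : smooth id.
Proof.
case=> [|k]; first by apply: (@Dk_step 0 id (fun=> 1)) => // x; exact: is_derive_id.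
by apply: (@Dk_step k.+1 id (fun=> 1)); exact: Dk_cst.
Qed.

Lemma smooth_idB (c : R) : smooth (fun x => x - c).
Proof. exact: smooth_shift smooth_id. Qed.

(** The factor [x ^- n] makes the family closed under differentiation up to linear combinations, so
    smoothness follows by induction on the order for all [n] at once. *)
Definition flat_exp (n : nat) (x : R) : R :=
  if 0 < x then x ^- n * expR (- x^-1) else 0.

(** With [y = x^-1] and [m = n.+1], [expR y = expR (y / m) ^+ m] is at least [(y / m) ^+ m], which
    gives the constant [m ^+ m]. *)
Lemma flat_exp_bound n : exists2 C, 0 <= C & forall x, `|flat_exp n x| <= C * `|x|.
Proof.
pose m := n.+1; exists (m%:R ^+ m); first by rewrite exprn_ge0.
move=> x; rewrite /flat_exp; case: ifPn => x0; last first.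
  by rewrite normr0 mulr_ge0// exprn_ge0.
have y0 : 0 < x^-1 by rewrite invr_gt0.
have m0 : 0 < m%:R :> R by rewrite ltr0n.
have h : (x^-1 / m%:R) ^+ m <= expR (x^-1).
  have -> : expR x^-1 = expR (x^-1 / m%:R) ^+ m.
    by rewrite -expRM_natr divfK// gt_eqF.
  apply: lerXn2r; rewrite ?nnegrE ?expR_ge0 ?divr_ge0 ?(ltW y0) ?(ltW m0)//.
  by apply: le_trans (expR_ge1Dx _); rewrite lerDr.
have E0 : 0 < expR (- x^-1) by rewrite expR_gt0.
rewrite gtr0_norm ?mulr_gt0 ?invr_gt0 ?exprn_gt0//.
rewrite (gtr0_norm x0) expRN ler_pdivrMr ?expR_gt0//.
apply: (@le_trans _ _ (m%:R ^+ m * x * (x^-1 / m%:R) ^+ m)); last first.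
  by rewrite ler_wpM2l// mulr_ge0 ?exprn_ge0// ltW.
have -> : (x^-1 / m%:R) ^+ m = x^-1 * x ^- n / m%:R ^+ m.
  by rewrite exprMn !exprVn /m exprS invfM.
have A0 : m%:R ^+ m != 0 :> R by rewrite expf_neq0// gt_eqF.
set A := m%:R ^+ m in A0 *; set B := x ^- n.
rewrite le_eqVlt; apply/orP; left; apply/eqP; field.
by rewrite A0 gt_eqF.
Qed.

(** At 0 the difference quotient of [flat_exp n] is [flat_exp n.+1], which tends to 0 by
    [flat_exp_bound]. *)
Lemma flat_exp_derive n (x : R) :
  is_derive x 1 (flat_exp n) (flat_exp n.+2 x + - n%:R * flat_exp n.+1 x).
Proof.
have [x0|x0|x0] := ltgtP x 0.
- apply: (@near_eq_is_derive _ _ _ (fun=> 0)).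
    near=> y; rewrite /flat_exp ltNge ltW//; near: y; exact: lt_nbhsl.
  by rewrite /flat_exp !ltNge !(ltW x0)/= mulr0 addr0; exact: is_derive_cst.
- apply: (@near_eq_is_derive _ _ _ (fun y : R => y ^- n * expR (- y^-1))).
    near=> y; rewrite /flat_exp ifT//; near: y; exact: lt_nbhsr.
  rewrite /flat_exp x0.
  have xn0 : x != 0 by rewrite gt_eqF.
  have dX m : is_derive x 1 (fun y : R => y ^+ m) (m%:R * x ^+ m.-1).
    apply: DeriveDef; first exact: exprn_derivable.
    by rewrite exp_derive /GRing.scale/= mulr1.
  have d1 : is_derive x 1 (fun y : R => y ^- n) (- n%:R * x ^- n.+1).
    apply: (is_derive_eq (@is_deriveV R (fun y : R => y ^+ n) x _ 1 (expf_neq0 n xn0) (dX n))).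
    rewrite /GRing.scale/=; case: n => [|n /=]; first by rewrite !mul0r mulr0 oppr0 mul0r.
    by rewrite !exprS; field; rewrite xn0 expf_neq0.
  have d2 : is_derive x 1 (fun y : R => expR (- y^-1)) (x ^- 2 * expR (- x^-1)).
    have d3 := is_deriveN (@is_deriveV R id x _ 1 xn0 (is_derive_id x (1 : R))).
    apply: (is_derive_eq (@is_derive1_comp R expR (fun y : R => - y^-1) x _ _ (is_derive_expR (- x^-1)) d3)).
    rewrite /GRing.scale/= mulr1 opprK; ring.
  apply: (is_derive_eq (is_deriveMf d1 d2)).
  by rewrite !exprS !expr0; field; rewrite xn0 expf_neq0.
- rewrite x0 /flat_exp ltxx mulr0 addr0 -/(flat_exp n).
  have [C C0 hC] := flat_exp_bound n.+1.
  have h : t^-1 *: (flat_exp n (t *: 1 + 0) - flat_exp n 0) @[t --> (0 : R)^'] --> (0 : R).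
    apply/cvgrPdist_le => e e0; near=> t.
    have tn0 : t != 0 by near: t; exact: nbhs_dnbhs_neq.
    have te : `|t| < e / (C + 1) by near: t; apply: dnbhs0_lt; rewrite divr_gt0// ltr_wpDl.
    rewrite sub0r normrN /GRing.scale/= mulr1 addr0 {2}/flat_exp ltxx subr0.
    have -> : t^-1 * flat_exp n t = flat_exp n.+1 t.
      by rewrite /flat_exp; case: ifP; rewrite ?mulr0// exprS invfM mulrA.
    apply: le_trans (hC t) _; apply: (@le_trans _ _ ((C + 1) * `|t|)).
      by rewrite ler_wpM2r// lerDl.
    by rewrite mulrC -ler_pdivlMr ?ltr_wpDl// ltW.
  by apply: DeriveDef; [apply/cvg_ex; eexists; exact: h|exact/cvg_lim].
Unshelve. all: by end_near. Qed.

Lemma smooth_flat_exp n : smooth (flat_exp n).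
Proof.
move=> k; elim: k n => [|k IH] n.
  by apply: (@Dk_step 0 _ _ (flat_exp_derive n)).
apply: (@Dk_step k.+1 _ _ (flat_exp_derive n)).
exact: Dk_add (IH _) (Dk_mul (Dk_cst _ _) (IH _)).
Qed.

Lemma flat_exp0_gt0 x : 0 < x -> 0 < flat_exp 0 x.
Proof. by move=> x0; rewrite /flat_exp x0 expr0 invr1 mul1r expR_gt0. Qed.

Lemma flat_exp0_ge0 x : 0 <= flat_exp 0 x.
Proof. by rewrite /flat_exp; case: ifP => // x0; rewrite expr0 invr1 mul1r expR_ge0. Qed.

(** The usual quotient of flat functions, with its transition inside [1/4, 3/4]; the intervals left
    on either side are the room used around the integers. The form [- 1 * x + 3 / 4] fits
    [Dk_affine]. *)
Definition step (x : R) : R :=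
  flat_exp 0 (x - 4^-1) / (flat_exp 0 (x - 4^-1) + flat_exp 0 (- 1 * x + 3 / 4)).

Lemma step_denom (x : R) : 0 < flat_exp 0 (x - 4^-1) + flat_exp 0 (- 1 * x + 3 / 4).
Proof.
have [x0|x0] := ltP 4^-1 x.
  by rewrite ltr_wpDr ?flat_exp0_ge0// flat_exp0_gt0// subr_gt0.
by rewrite ltr_wpDl ?flat_exp0_ge0// flat_exp0_gt0//; lra.
Qed.

Lemma smooth_step : smooth step.
Proof.
move=> k; have h1 := smooth_shift 4^-1 (smooth_flat_exp 0) k.
have h2 := @Dk_affine k _ (- 1) (3 / 4) (smooth_flat_exp 0 k).
apply: (Dk_mul h1 (Dk_inv _ (Dk_add h1 h2))) => x.
by rewrite gt_eqF// step_denom.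
Qed.

Lemma step_itv x : 0 <= step x <= 1.
Proof.
rewrite /step divr_ge0 ?flat_exp0_ge0 ?(ltW (step_denom x))//=.
by rewrite ler_pdivrMr ?step_denom// mul1r lerDl flat_exp0_ge0.
Qed.

Lemma step_eq0 x : x <= 4^-1 -> step x = 0.
Proof. by move=> x0; rewrite /step /flat_exp subr_gt0 ltNge x0/= mul0r. Qed.

Lemma step_eq1 x : 3 / 4 <= x -> step x = 1.
Proof.
move=> x0; have := step_denom x; rewrite /step.
have -> : flat_exp 0 (- 1 * x + 3 / 4) = 0 by rewrite /flat_exp ifF//; apply/negbTE; rewrite -leNgt; lra.
by rewrite addr0 => h; rewrite divff// gt_eqF.
Qed.

Lemma derive1_step_eq0 (x : R) : x < 4^-1 \/ 3 / 4 < x -> derive1 step x = 0.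
Proof.
move=> h; rewrite derive1E.
have [c hc] : exists c : R, \forall y \near x, cst c y = step y.
  case: h => h; [exists 0|exists 1].
    near=> y; rewrite step_eq0// ltW//; near: y; exact: lt_nbhsl.
  near=> y; rewrite step_eq1// ltW//; near: y; exact: lt_nbhsr.
by have [_ ->] := near_eq_is_derive hc (is_derive_cst c x 1).
Unshelve. all: by end_near. Qed.

End SmoothStep.

(** * Calculus of C^k functions on open sets *)

Section CkCalculus.
Context {R : realType} {d : nat}.
Implicit Types (U : set 'rV[R]_d).

Lemma Ck_eq (V : normedModType R) k U (f g : 'rV[R]_d -> V) :
  open U -> (forall x, U x -> f x = g x) -> Ck k U f -> Ck k U g.
Proof.
move=> oU; elim: k f g => [|k IH] f g fg.
all: have nfg x : U x -> \forall y \near x, f y = g y.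
1,3: by move=> Ux; have /= := open_nbhs_nbhs (conj oU Ux); apply: filterS => y /fg.
all: have cg : {in U, continuous f} -> {in U, continuous g}.
1,3: move=> cf x /[dup] xU /set_mem Ux; have := cf x xU.
1,2: move=> /cvg_atP cfx; apply/cvg_atP => e e0; rewrite -(fg x Ux).
1,2: by move: (cfx e e0) (nfg x Ux); apply: filterS2 => y + <-.
  by move=> [cf _]; split=> //; exact: cg.
move=> [cf df]; split; first exact: cg.
move=> i; have [di Ci] := df i; split.
  by move=> x Ux; apply: near_eq_derivable (di x Ux); exact: nfg.
apply: IH Ci => x Ux; rewrite /partial.
by apply: near_eq_derive; exact: nfg.
Qed.

Lemma Ck_add k U (f g : 'rV[R]_d -> R) : open U ->
  Ck k U f -> Ck k U g -> Ck k U (fun x => f x + g x).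
Proof.
move=> oU; elim: k f g => [|k IH] f g [cf df] [cg dg].
all: have cfg : {in U, continuous (fun x => f x + g x)}.
1,3: by move=> x xU; exact: (cvgD (cf x xU) (cg x xU)).
  by [].
split=> // i; have [df1 df2] := df i; have [dg1 dg2] := dg i; split.
  by move=> x Ux; apply: derivableD; [exact: df1|exact: dg1].
apply: (Ck_eq oU) (IH _ _ df2 dg2) => x Ux.
by rewrite /partial deriveD//; [exact: df1|exact: dg1].
Qed.

Lemma Ck_scale k U (c : R) (f : 'rV[R]_d -> R) : open U ->
  Ck k U f -> Ck k U (fun x => c * f x).
Proof.
move=> oU; elim: k f => [|k IH] f [cf df].
all: have cfg : {in U, continuous (fun x => c * f x)}.
1,3: by move=> x xU; exact: (cvgM (cvg_cst c) (cf x xU)).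
  by [].
split=> // i; have [df1 df2] := df i; split.
  by move=> x Ux; apply: derivableZ; exact: df1.
apply: (Ck_eq oU) (IH _ df2) => x Ux.
by rewrite /partial deriveZ//; exact: df1.
Qed.

Lemma Ck_sum k U (I : Type) (s : seq I) (f : I -> 'rV[R]_d -> R) : open U ->
  (forall i, Ck k U (f i)) -> Ck k U (fun x => \sum_(i <- s) f i x).
Proof.
move=> oU hf; elim: s => [|i s IH].
  have c0 : Ck k U (fun=> 0 : R).
    have c1 : {in U, continuous (fun _ : 'rV[R]_d => 0 : R)}.
      by move=> x _; exact: cst_continuous.
    elim: k {hf} => [|k IH]; first by split.
    split; first exact: c1.
    move=> i; split; first by move=> x _; exact: derivable_cst.
    by apply: (Ck_eq oU) IH => x Ux; rewrite /partial derive_cst.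
  by apply: (Ck_eq oU) c0 => x _; rewrite big_nil.
by apply: (Ck_eq oU) (Ck_add oU (hf i) IH) => x _; rewrite big_cons.
Qed.

Lemma Ck_row k U e (f : 'I_e -> 'rV[R]_d -> R) : open U ->
  (forall i, Ck k U (f i)) -> Ck k U (fun x => \row_i f i x : 'rV[R]_e).
Proof.
move=> oU; elim: k f => [|k IH] f hf.
all: have cf : {in U, continuous (fun x => \row_i f i x : 'rV[R]_e)}.
1,3: move=> x xU; apply/cvg_atP => u u0.
1,2: have h : \forall y \near x, forall i, `|f i x - f i y| <= u.
1,3: by apply: near_forall => i; have [ci _] := hf i; have /cvg_atP := ci x xU; apply.
1,2: by apply: filterS h => y h; apply: rV_norm_le => [|i]; rewrite ?mxE; [exact: ltW|exact: h].
  by [].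
split=> // j; have hd x : U x -> derivable (fun x => \row_i f i x : 'rV[R]_e) x (delta_mx 0 j).
  move=> Ux; apply/derivable_mxP => a b; have [_ /(_ j)[db _]] := hf b.
  by under eq_fun do rewrite mxE; exact: db.
split=> //.
have h i : Ck k U (partial j (f i)) by have [_ /(_ j)[]] := hf i.
apply: (Ck_eq oU) (IH _ h) => x Ux.
rewrite /partial derive_mx//; last exact: hd.
apply/rowP => i; rewrite [LHS]mxE [RHS]mxE.
suff -> : f i = (fun y => (\row_l f l y : 'rV[R]_e) 0 i) by [].
by apply/funext => y; rewrite mxE.
Qed.

End CkCalculus.

(** * Analytic functions of arguments that vary smoothly with time *)

Section TimeDependence.
Context {R : realType} {d : nat}.
Variables (s c : R -> R).
Hypotheses (ss : smooth s) (cs : smooth c).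

(** With [s] and [c] the maps [tau |-> tau - n] and [tau |-> step (tau - n)], this is the point at
    which the generator is evaluated in the periodic field. *)
Definition time_arg (w : 'rV[R]_(1 + (1 + d))) : 'rV[R]_(1 + (1 + (1 + d))) :=
  let e := lsubmx w 0 0 in let tau := lsubmx (rsubmx w) 0 0 in
  tcons3 e (e * s tau) (e * c tau) (rsubmx (rsubmx w)).

Definition time_term (a : R -> R) (V : 'rV[R]_(1 + (1 + (1 + d))) -> R)
    (w : 'rV[R]_(1 + (1 + d))) : R :=
  a (lsubmx (rsubmx w) 0 0) * V (time_arg w).

Lemma derive_line (V : normedModType R) (f : V -> R) (w v : V) l :
  is_derive (0 : R) 1 (fun h : R => f (h *: v + w)) l -> is_derive w v f l.
Proof.
have e : (fun h : R => h^-1 *: (f ((h *: (1 : R) + 0 : R) *: v + w) - f ((0 : R) *: v + w))) =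
    (fun h : R => h^-1 *: (f (h *: v + w) - f w)).
  by apply/funext => h; rewrite addr0 scale0r add0r /GRing.scale/= mulr1.
move=> [dg eg]; apply: DeriveDef; first by move: dg; rewrite /derivable /= e.
by move: eg; rewrite /derive /= e.
Qed.

Lemma is_derive_tcons2 n (t : R) (a : R -> R) (y : R -> 'rV[R]_n) a' y' :
  is_derive t 1 a a' -> is_derive t 1 y y' ->
  is_derive t 1 (fun u => tcons (a u) (y u)) (tcons a' y').
Proof.
move=> da dy; apply: is_derive_coords => j; case: (split_ordP j) => j' ->.
  rewrite (ord1 j') tcons_fst (_ : (fun z => _) = a)//.
  by apply/funext => u; rewrite tcons_fst.
rewrite row_mxEr (_ : (fun z => _) = (fun z => y z 0 j')); first exact: is_derive_coord.
by apply/funext => u; rewrite row_mxEr.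
Qed.

Let i0 : 'I_(1 + (1 + (1 + d))) := lshift _ 0.
Let i1 : 'I_(1 + (1 + (1 + d))) := rshift 1 (lshift _ 0).
Let i2 : 'I_(1 + (1 + (1 + d))) := rshift 1 (rshift 1 (lshift _ 0)).
Let i3 (j : 'I_d) : 'I_(1 + (1 + (1 + d))) := rshift 1 (rshift 1 (rshift 1 j)).

(* The factor z_0 = e absorbs the e that the chain rule produces in the
   tau-derivative of [time_arg]. *)
Definition times0 (V : 'rV[R]_(1 + (1 + (1 + d))) -> R)
    (z : 'rV[R]_(1 + (1 + (1 + d)))) : R := z 0 i0 * V z.

(** Every directional derivative of a [time_term] is a linear combination of terms of the same shape
    with other [a] and [V]. The inductions on the order of differentiation rest on this closure. *)
Lemma time_term_derive a V w v : smooth a -> anal (time_arg w) V ->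
  let ve := lsubmx v 0 0 in let vt := lsubmx (rsubmx v) 0 0 in let vx := rsubmx (rsubmx v) in
  is_derive w v (time_term a V)
   (vt * (time_term (derive1 a) V w +
       (time_term (fun x => derive1 s x * a x) (times0 (partial i1 V)) w +
        time_term (fun x => derive1 c x * a x) (times0 (partial i2 V)) w)) +
    (ve * (time_term a (partial i0 V) w +
       (time_term (fun x => s x * a x) (partial i1 V) w +
        time_term (fun x => c x * a x) (partial i2 V) w)) +
     \sum_j vx 0 j * time_term a (partial (i3 j) V) w)).
Proof.
move=> sa Van ve vt vx; apply: derive_line.
set e := lsubmx w 0 0; set t := lsubmx (rsubmx w) 0 0; set x := rsubmx (rsubmx w).
have aff (p q : R) : is_derive (0 : R) 1 (fun h => h * p + q) p.
  have := is_deriveD (is_deriveZ p (is_derive_id (0 : R) (1 : R))) (is_derive_cst q (0 : R) (1 : R)).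
  rewrite addr0 /GRing.scale/= mulr1.
  by rewrite (_ : _ + cst q = (fun h : R => h * p + q))//; apply/funext => h; rewrite -[LHS]/(p * h + q) mulrC.
have affc (b : R -> R) : smooth b ->
    is_derive (0 : R) 1 (fun h => b (h * vt + t)) (derive1 b t * vt).
  move=> sb; have db : is_derive (0 * vt + t) 1 b (derive1 b t).
    by rewrite mul0r add0r; exact: smooth_is_derive.
  exact: (@is_derive1_comp R b (fun h => h * vt + t) 0 _ _ db (aff vt t)).
have dx : is_derive (0 : R) 1 (fun h => h *: vx + x) vx.
  apply: is_derive_coords => j; have := aff (vx 0 j) (x 0 j).
  by congr is_derive; apply/funext => h; rewrite !mxE.
pose gam (h : R) := tcons3 (h * ve + e) ((h * ve + e) * s (h * vt + t))
  ((h * ve + e) * c (h * vt + t)) (h *: vx + x).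
have lin h n m (A B : 'rV[R]_(n + m)) : lsubmx (h *: A + B) = h *: lsubmx A + lsubmx B.
  by apply/rowP => j; rewrite !mxE.
have rin h n m (A B : 'rV[R]_(n + m)) : rsubmx (h *: A + B) = h *: rsubmx A + rsubmx B.
  by apply/rowP => j; rewrite !mxE.
have coo h n (A B : 'rV[R]_n) j : (h *: A + B) 0 j = h * A 0 j + B 0 j by rewrite !mxE.
have gamE h : time_arg (h *: v + w) = gam h by rewrite /time_arg /gam !rin !lin !coo.
have tauE h : lsubmx (rsubmx (h *: v + w)) 0 0 = h * vt + t by rewrite rin lin coo.
have dgam := is_derive_tcons2 (aff ve e) (is_derive_tcons2 (is_deriveMf (aff ve e) (affc s ss))
  (is_derive_tcons2 (is_deriveMf (aff ve e) (affc c cs)) dx)).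
have gam0 : gam 0 = time_arg w by rewrite -gamE scale0r add0r.
have Van0 : anal (gam 0) V by rewrite gam0.
have dV := @anal_chain R _ _ (0 : R) 1 gam _ V Van0 dgam.
have da := is_deriveMf (affc a sa) dV.
have -> : (fun h : R => time_term a V (h *: v + w)) = (fun h : R => a (h * vt + t) * V (gam h)).
  by apply/funext => h; rewrite /time_term gamE tauE.
apply: (is_derive_eq da).
rewrite gam0 !mul0r !add0r (@big_split_ord _ _ _ 1) big_ord1 (@big_split_ord _ _ _ 1) big_ord1.
rewrite (@big_split_ord _ _ _ 1) big_ord1 /=.
rewrite !(tcons_fst, row_mxEr) -/i0 -/i1 -/i2.
rewrite /time_term /times0 -/t.
have -> : time_arg w 0 i0 = e by rewrite tcons_fst.
set S := \sum_(j < d) _.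
have -> : S = \sum_j vx 0 j * partial (i3 j) V (time_arg w).
  by apply: eq_bigr => j _; rewrite !row_mxEr.
have -> : \sum_j vx 0 j * (a t * partial (i3 j) V (time_arg w)) =
   a t * \sum_j vx 0 j * partial (i3 j) V (time_arg w).
  by rewrite mulr_sumr; apply: eq_bigr => j _; rewrite mulrCA.
move: (\sum_j _) (partial i0 V _) (partial i1 V _) (partial i2 V _) (V _) => z3 z0 z1 z2 zV.
by ring.
Qed.

Lemma smooth_continuous a (x : R) : smooth a -> a y @[y --> x] --> a x.
Proof.
move=> sa; apply: differentiable_continuous; rewrite -derivable1_diffP.
exact: smooth_derivable.
Qed.

Lemma cvg_tcons (V : normedModType R) n (a : V -> R) (y : V -> 'rV[R]_n) w :
  a z @[z --> w] --> a w -> y z @[z --> w] --> y w ->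
  tcons (a z) (y z) @[z --> w] --> tcons (a w) (y w).
Proof.
move=> /cvg_atP ca /cvg_atP cy; apply/cvg_atP => u u0.
have u2 : 0 < u / 2 by rewrite divr_gt0.
move: (ca _ u2) (cy _ u2); apply: filterS2 => z az yz.
apply: ltW; rewrite tconsB tcons_norm_lt.
have uu : u / 2 < u by rewrite ltr_pdivrMr// ltr_pMr// ltr1n.
by rewrite (le_lt_trans az)// (le_lt_trans yz).
Qed.

Lemma time_arg_continuous w : time_arg y @[y --> w] --> time_arg w.
Proof.
have ce : lsubmx y 0 0 @[y --> w] --> lsubmx w 0 0 := anal_continuous (anal_fst w).
have ct : lsubmx (rsubmx y) 0 0 @[y --> w] --> lsubmx (rsubmx w) 0 0 :=
  anal_continuous (anal_comp (analv_rsub w) (anal_fst _)).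
have cx : rsubmx (rsubmx y) @[y --> w] --> rsubmx (rsubmx w) :=
  analv_continuous (analv_comp (analv_rsub w) (analv_rsub _)).
have h1 := cvg_comp _ s ct (smooth_continuous ss).
have h2 := cvg_comp _ c ct (smooth_continuous cs).
have k1 : lsubmx y 0 0 * s (lsubmx (rsubmx y) 0 0) @[y --> w] -->
    lsubmx w 0 0 * s (lsubmx (rsubmx w) 0 0) by exact: (cvgM ce h1).
have k2 : lsubmx y 0 0 * c (lsubmx (rsubmx y) 0 0) @[y --> w] -->
    lsubmx w 0 0 * c (lsubmx (rsubmx w) 0 0) by exact: (cvgM ce h2).
exact: (cvg_tcons ce (cvg_tcons k1 (cvg_tcons k2 cx))).
Qed.

Lemma time_term_continuous a V w : smooth a -> anal (time_arg w) V ->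
  time_term a V y @[y --> w] --> time_term a V w.
Proof.
move=> sa Van.
have ct : lsubmx (rsubmx y) 0 0 @[y --> w] --> lsubmx (rsubmx w) 0 0 :=
  anal_continuous (anal_comp (analv_rsub w) (anal_fst _)).
have c1 := cvg_comp _ a ct (smooth_continuous sa).
have c2 := cvg_comp _ V (@time_arg_continuous w) (anal_continuous Van).
exact: (cvgM c1 c2).
Qed.

Lemma anal_times0 z V : anal z V -> anal z (times0 V).
Proof. by move=> Van; exact: anal_mul (anal_coord _ _) Van. Qed.

Lemma time_term_Ck k (U : set 'rV[R]_(1 + (1 + d))) a V : open U -> smooth a ->
  (forall w, U w -> anal (time_arg w) V) -> Ck k U (time_term a V).
Proof.
move=> oU; elim: k a V => [|k IH] a V sa UV.
all: have cT : {in U, continuous (time_term a V)}.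
1,3: by move=> w /set_mem Uw; exact: time_term_continuous sa (UV w Uw).
  by [].
split=> // i.
have dT w : U w -> is_derive w (delta_mx 0 i) (time_term a V) _ :=
  fun Uw => time_term_derive (delta_mx 0 i) sa (UV w Uw).
split; first by move=> w /dT[].
have pT w : U w -> _ = partial i (time_term a V) w := fun Uw => esym (@derive_val _ _ _ _ _ _ _ (dT w Uw)).
apply: (Ck_eq oU pT).
have UVp w j : U w -> anal (time_arg w) (partial j V) by move=> /UV; exact: anal_partial.
have UVt w j : U w -> anal (time_arg w) (times0 (partial j V)).
  by move=> /UV Van; apply: anal_times0; exact: anal_partial.
have sda := smooth_derive1 sa.
have sds := smooth_mul (smooth_derive1 ss) sa; have sdc := smooth_mul (smooth_derive1 cs) sa.
have ssa := smooth_mul ss sa; have sca := smooth_mul cs sa.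
have q1 : Ck k U (time_term (derive1 a) V) by exact: IH.
have q2 : Ck k U (time_term (fun x => derive1 s x * a x) (times0 (partial i1 V))).
  by apply: IH => // w; exact: UVt.
have q3 : Ck k U (time_term (fun x => derive1 c x * a x) (times0 (partial i2 V))).
  by apply: IH => // w; exact: UVt.
have q4 : Ck k U (time_term a (partial i0 V)) by apply: IH => // w; exact: UVp.
have q5 : Ck k U (time_term (fun x => s x * a x) (partial i1 V)) by apply: IH => // w; exact: UVp.
have q6 : Ck k U (time_term (fun x => c x * a x) (partial i2 V)) by apply: IH => // w; exact: UVp.
apply: (Ck_add oU); first exact: (Ck_scale _ oU (Ck_add oU q1 (Ck_add oU q2 q3))).
apply: (Ck_add oU); first exact: (Ck_scale _ oU (Ck_add oU q4 (Ck_add oU q5 q6))).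
by apply: (Ck_sum _ oU) => j; apply: (Ck_scale _ oU); apply: IH => // w; exact: UVp.
Qed.

(* A list of pairs (a, V) encodes the sum of the [time_term a V]; such sums are
   closed under tau-derivatives, which are thus computed on the lists. *)
Definition term := ((R -> R) * ('rV[R]_(1 + (1 + (1 + d))) -> R))%type.

Definition time_sum (l : seq term) (w : 'rV[R]_(1 + (1 + d))) : R :=
  \sum_(q <- l) time_term q.1 q.2 w.

Fixpoint good_terms z (l : seq term) : Prop :=
  if l is q :: l' then [/\ smooth q.1, anal z q.2 & good_terms z l'] else True.

Fixpoint tau_terms (l : seq term) : seq term :=
  if l is q :: l' then
    [:: (derive1 q.1, q.2),
        (fun x => derive1 s x * q.1 x, times0 (partial i1 q.2)),
        (fun x => derive1 c x * q.1 x, times0 (partial i2 q.2)) & tau_terms l']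
  else [::].

Lemma good_tau_terms z l : good_terms z l -> good_terms z (tau_terms l).
Proof.
elim: l => //= q l IH [sq aq gl]; split=> //; first exact: smooth_derive1.
split; [exact: smooth_mul (smooth_derive1 ss) sq|by apply: anal_times0; exact: anal_partial|].
split; [exact: smooth_mul (smooth_derive1 cs) sq|by apply: anal_times0; exact: anal_partial|].
exact: IH.
Qed.

Lemma derive_along (V : normedModType R) (f : V -> R) (gam : R -> V) (v : V) (t : R) l :
  (forall h u, gam (h + u) = h *: v + gam u) ->
  is_derive (gam t) v f l -> is_derive t 1 (fun u => f (gam u)) l.
Proof.
move=> hg [df <-].
have e : (fun h : R => h^-1 *: (f (gam (h *: 1 + t)) - f (gam t))) =
    (fun h : R => h^-1 *: (f (h *: v + gam t) - f (gam t))).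
  by apply/funext => h; rewrite hg /GRing.scale/= mulr1.
by apply: DeriveDef; [rewrite /derivable /= e|rewrite /derive /= e].
Qed.

Lemma time_sum_derive l e (t : R) x : good_terms (time_arg (tcons e (tcons t x))) l ->
  is_derive t 1 (fun u => time_sum l (tcons e (tcons u x)))
    (time_sum (tau_terms l) (tcons e (tcons t x))).
Proof.
elim: l => [_|q l IH /= [sq aq gl]].
  rewrite /time_sum big_nil; under eq_fun do rewrite big_nil; exact: is_derive_cst.
have hg (h u : R) : tcons e (tcons (h + u) x) = h *: tcons 0 (tcons 1 0) + tcons e (tcons u x).
  have sc n (y : 'rV[R]_n) a : h *: tcons a y = tcons (h * a) (h *: y).
    by rewrite /tcons scale_row_mx scale_scalar_mx.
  by rewrite !sc mulr0 mulr1 scaler0 !tconsD !add0r.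
have := derive_along (gam := fun u => tcons e (tcons u x)) hg
  (time_term_derive (tcons 0 (tcons 1 0)) sq aq).
rewrite !tcons_rsub !tcons_lsub mul1r mul0r add0r big1 ?addr0; last first.
  by move=> j _; rewrite mxE mul0r.
move=> dq; have dl := is_deriveD dq (IH gl).
rewrite (_ : (fun u => time_sum (q :: l) _) = (fun u => time_term q.1 q.2 (tcons e (tcons u x))) \+
   (fun u => time_sum l (tcons e (tcons u x)))); last first.
  by apply/funext => u; rewrite /time_sum big_cons.
by apply: (is_derive_eq dl); rewrite /time_sum /= !big_cons !addrA.
Qed.

(** An equality on an open set of times suffices at every order, derivatives being local. [I] will
    be an interval around a given time on which a fixed integer replaces the floor. *)
Lemma derive1n_time_sum n (G : R -> 'rV[R]_n) (l : 'I_n -> seq term) e x (I : set R) :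
  open I -> (forall t, I t -> G t = \row_i time_sum (l i) (tcons e (tcons t x))) ->
  (forall t i, I t -> good_terms (time_arg (tcons e (tcons t x))) (l i)) ->
  forall k t, I t ->
    derive1n k G t = \row_i time_sum (iter k tau_terms (l i)) (tcons e (tcons t x)).
Proof.
move=> oI Gl gl; elim=> [|k IH] t It; first by rewrite derive1n0 Gl.
rewrite derive1nS derive1E.
have gk i : good_terms (time_arg (tcons e (tcons t x))) (iter k tau_terms (l i)).
  by elim: k {IH} => [|k IHk] /=; [exact: gl|exact: good_tau_terms].
have d1 : is_derive t 1 (fun u => \row_i time_sum (iter k tau_terms (l i)) (tcons e (tcons u x)) : 'rV[R]_n)
    (\row_i time_sum (iter k.+1 tau_terms (l i)) (tcons e (tcons t x))).
  apply: is_derive_coords => i; rewrite mxE; under eq_fun do rewrite mxE.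
  exact: time_sum_derive.
have nt : \forall u \near t, derive1n k G u = \row_i time_sum (iter k tau_terms (l i)) (tcons e (tcons u x)).
  have := open_nbhs_nbhs (conj oI It); apply: filterS => u Iu; exact: IH.
by rewrite (near_eq_derive _ nt); have [_ ->] := d1.
Qed.

(** For fixed [t] the values of [s], [c] and of all coefficients are constants, and the argument is
    linear in [(e, x)]; functions that are merely smooth in time thus do not disturb analyticity. *)
Lemma time_sum_anal l t e x : good_terms (time_arg (tcons e (tcons t x))) l ->
  anal (tcons e x) (fun z => time_sum l (tcons (lsubmx z 0 0) (tcons t (rsubmx z)))).
Proof.
rewrite /time_arg !tcons_rsub !tcons_lsub => gl.
have aa : analv (tcons e x) (fun z => tcons3 (lsubmx z 0 0) (lsubmx z 0 0 * s t)
    (lsubmx z 0 0 * c t) (rsubmx z)).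
  have h1 := anal_fst (tcons e x); have h2 r := anal_mul h1 (anal_const (tcons e x) r).
  exact: analv_tcons h1 (analv_tcons (h2 _) (analv_tcons (h2 _) (analv_rsub _))).
elim: l gl => [_|q l IH /= [sq aq gl]].
  by apply: anal_eq (anal_const _ 0) => z; rewrite /time_sum big_nil.
have aq' : anal (tcons e x) (fun z => q.2 (tcons3 (lsubmx z 0 0) (lsubmx z 0 0 * s t)
    (lsubmx z 0 0 * c t) (rsubmx z))).
  by apply: (anal_comp aa); rewrite tcons_lsub tcons_rsub.
apply: anal_eq (anal_add (anal_mul (anal_const _ (q.1 t)) aq') (IH gl)) => z.
rewrite /time_sum big_cons /time_term /time_arg.
by rewrite ?tcons_rsub ?tcons_lsub.
Qed.

End TimeDependence.

(** * The radius function *)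

Section RadiusFunction.
Context {R : realType}.
Variable delta : nat -> R.
Hypothesis delta_gt0 : forall k, 0 < delta k.

(* For |e| >= delta k the term of index k is 1 / (k + 1), which forces
   radius e <= k + 1. *)
Definition inv_radius_term (k : nat) (e : R) : R := Num.min (`|e| / delta k) k.+1%:R^-1.
Definition inv_radius (e : R) : R := sup (range (inv_radius_term ^~ e)).
Definition radius (e : R) : \bar R := if e == 0 then +oo%E else ((inv_radius e)^-1)%:E.
Local Notation phi_term := inv_radius_term.
Local Notation phi := inv_radius.

Let term_ge0 k e : 0 <= phi_term k e.
Proof. by rewrite le_min divr_ge0 ?invr_ge0// ltW. Qed.

Let phi_sup e : has_sup (range (phi_term ^~ e)).
Proof.
split; first by exists (phi_term 0 e); exists 0%N.
by exists 1 => _ [k _ <-]; rewrite ge_min invf_le1// ler1n orbT.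
Qed.

Let term_le_phi k e : phi_term k e <= phi e.
Proof. by apply: ub_le_sup; [exact: (phi_sup e).2|exists k]. Qed.

Let phi_le e c : (forall k, phi_term k e <= c) -> phi e <= c.
Proof. by move=> h; apply: ge_sup; [exact: (phi_sup e).1|move=> _ [k _ <-]]. Qed.

Let phi_ge0 e : 0 <= phi e.
Proof. exact: le_trans (term_ge0 0 e) (term_le_phi 0 e). Qed.

Let phi0 : phi 0 = 0.
Proof.
apply/eqP; rewrite eq_le phi_ge0 andbT; apply: phi_le => k.
by rewrite /phi_term normr0 mul0r ge_min lexx.
Qed.

Let phi_gt0 e : e != 0 -> 0 < phi e.
Proof.
move=> e0; apply: lt_le_trans (term_le_phi 0 e).
by rewrite lt_min invr1 ltr01 divr_gt0// normr_gt0.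
Qed.

Let phi_homo a b : `|a| <= `|b| -> phi a <= phi b.
Proof.
move=> ab; apply: phi_le => k; apply: le_trans (term_le_phi k b).
rewrite le_min !ge_min lexx orbT andbT ler_wpM2r//.
by rewrite invr_ge0 ltW.
Qed.

(** All but finitely many terms are at most [u] everywhere, and each of the others is Lipschitz with
    constant [(delta k)^-1]. *)
Let phi_continuous e : phi y @[y --> e] --> phi e.
Proof.
apply/cvg_atP => u u0.
have [K Ku] : exists K : nat, K.+1%:R^-1 <= u.
  exists (Num.truncn u^-1); rewrite -[leRHS]invrK lef_pV2 ?posrE ?invr_gt0//.
  by apply: ltW; exact: truncnS_gt.
have [eta eta0 hK] : exists2 eta, 0 < eta & forall k, (k < K)%N -> eta <= u * delta k.
  elim: K {Ku} => [|K [eta eta0 IH]]; first by exists 1.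
  exists (Num.min eta (u * delta K)); first by rewrite lt_min eta0 mulr_gt0.
  move=> k; rewrite ltnS leq_eqVlt => /orP[/eqP ->|kK]; first by rewrite ge_min lexx orbT.
  by rewrite ge_min IH.
have close y z k : `|y - z| < eta -> phi_term k y <= phi_term k z + u.
  move=> yz; have [kK|kK] := ltnP k K.
    rewrite -lerBlDr le_min !lerBlDr !ge_min; apply/andP; split; last first.
      by rewrite lerDl (ltW u0) orbT.
    apply/orP; left; rewrite -(ler_pM2r (delta_gt0 k)) mulrDl.
    rewrite !divfK ?gt_eqF//; have := hK k kK.
    have := ler_normD (y - z) z; rewrite subrK => h1 h2; lra.
  apply: (@le_trans _ _ k.+1%:R^-1); first by rewrite ge_min lexx orbT.
  apply: (@le_trans _ _ u); last by rewrite lerDr.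
  by apply: le_trans Ku; rewrite lef_pV2 ?posrE// ler_nat ltnS.
have close_phi y z : `|y - z| < eta -> phi y <= phi z + u.
  move=> yz; apply: phi_le => k; apply: le_trans (close y z k yz) _.
  by rewrite lerD2r.
apply/near_at; exists eta => // h hh.
rewrite ler_norml; apply/andP; split.
  have := close_phi (e + h) e; rewrite addrAC subrr add0r => /(_ hh); lra.
have := close_phi e (e + h); rewrite opprD addrA subrr sub0r normrN => /(_ hh).
lra.
Qed.

Lemma radius_continuous : continuous (radius).
Proof.
move=> e; rewrite /continuous_at {2}/radius; have [->|e0] := eqVneq e 0.
  apply/cvgeyPge => A.
  have : \forall y \near (0 : R), phi y <= (`|A| + 1)^-1.
    have /cvg_atP := @phi_continuous 0; move=> /(_ (`|A| + 1)^-1).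
    rewrite invr_gt0 ltr_wpDl// => /(_ isT).
    apply: filterS => y; rewrite phi0 sub0r normrN.
    exact: le_trans (ler_norm _).
  apply: filterS => y yA; rewrite /radius; case: eqVneq => [_|y0]; first by rewrite leey.
  rewrite lee_fin; apply: (@le_trans _ _ (`|A| + 1)).
    by apply: le_trans (ler_norm _) _; rewrite lerDl.
  by rewrite -[leLHS]invrK lef_pV2 ?posrE ?phi_gt0// invr_gt0 ltr_wpDl.
have c1 : ((phi y)^-1)%:E @[y --> e] --> ((phi e)^-1)%:E.
  apply: cvg_EFin; first by exact: nearW.
  apply: (cvgV _ (@phi_continuous e)).
  by rewrite gt_eqF// phi_gt0.
apply: cvg_trans c1; apply: near_eq_cvg.
have : \forall y \near e, ((phi y)^-1)%:E = radius y; last by [].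
apply/near_at; exists `|e|; first by rewrite normr_gt0.
move=> h he; rewrite /radius ifF//; apply/negbTE/eqP => eh.
by move: he; rewrite (_ : h = - e) ?normrN ?ltxx//; apply/eqP; rewrite -addr_eq0 addrC eh.
Qed.

Lemma radius0 : radius 0 = +oo%E.
Proof. by rewrite /radius eqxx. Qed.

Lemma radius_ge0 e : (0 <= radius e)%E.
Proof. by rewrite /radius; case: eqP => // _; rewrite lee_fin invr_ge0. Qed.

Lemma radius_nonincreasing a b : `|a| <= `|b| -> (radius b <= radius a)%E.
Proof.
move=> ab; rewrite /radius; case: (eqVneq a) => [_|a0]; first by rewrite leey.
have b0 : b != 0 by rewrite -normr_gt0 (lt_le_trans _ ab)// normr_gt0.
by rewrite (negPf b0) lee_fin lef_pV2 ?posrE ?phi_gt0// phi_homo.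
Qed.

Lemma radius_gt k e : (k.+1%:R%:E < radius e)%E -> `|e| < delta k.
Proof.
rewrite /radius; case: eqVneq => [->|e0]; first by rewrite normr0.
rewrite lte_fin => h; have p0 := phi_gt0 e0.
have : phi e < k.+1%:R^-1.
  by rewrite -[ltLHS]invrK ltf_pV2 ?posrE ?invr_gt0.
move=> /(le_lt_trans (term_le_phi k e)); rewrite gt_min ltxx orbF.
rewrite ltr_pdivrMr// => /lt_le_trans; apply.
by rewrite ler_piMl ?(ltW (delta_gt0 k))// invf_le1// ler1n.
Qed.

End RadiusFunction.

(** [delta] will stem from a choice and need not be monotone; therefore [r < rho e] is turned into
    [e < delta r'] for some [r'] above [r], not for [r] itself. *)
Lemma admissible_radius (R : realType) (delta : R -> R) (e0 : R) :
  0 < e0 -> (forall r, 0 < delta r) ->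
  exists (eps0 : R) (rho : R -> \bar R),
  [/\ 0 < eps0 <= e0,
      [/\ {within `[0, eps0], continuous rho},
        {in `[0, eps0] &, {homo rho : a b / a <= b >-> (b <= a)%E}},
        (forall e, e \in `[0, eps0] -> (0 <= rho e)%E) &
        rho 0 = +oo%E],
      (forall e r, e \in `[0, eps0] -> (r%:E < rho e)%E ->
         exists2 r', r <= r' & e < delta r') &
      forall r : R, exists2 d : R, 0 < d <= eps0 & forall e, e \in `[0, d] -> (r%:E < rho e)%E].
Proof.
(* [radius dk e > k.+1] yields [e < dk k]. For [k.+1 <= r < k.+2] this has to be the step size of a
   ball of radius at least [r], hence the index [k.+2]. Radii below 1 are served by
   [eps0 <= delta 1 / 2]. *)
move=> e00 delta0; pose dk (k : nat) := delta k.+2%:R.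
have dk0 k : 0 < dk k by exact: delta0.
pose eps0 := Num.min e0 (delta 1 / 2).
have eps00 : 0 < eps0 by rewrite lt_min e00 divr_gt0.
exists eps0, (radius dk); split.
- by rewrite eps00 ge_min lexx.
- split.
  + by apply: continuous_subspaceT; exact: radius_continuous.
  + move=> a b; rewrite !in_itv/= => /andP[a0 _] /andP[b0 _] ab.
    by apply: radius_nonincreasing; rewrite ?ger0_norm.
  + by move=> e _; exact: radius_ge0.
  + exact: radius0.
- move=> e r; rewrite in_itv/= => /andP[ep ee] re.
  have [r1|r1] := ltP r 1.
    exists 1; first exact: ltW.
    apply: le_lt_trans ee _; apply: (@le_lt_trans _ _ (delta 1 / 2)).
      by rewrite ge_min lexx orbT.
    by rewrite ltr_pdivrMr// ltr_pMr// ltr1n.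
  have : (0 < Num.truncn r)%N by rewrite truncn_gt0.
  have /truncn_itv/andP[] : 0 <= r by exact: le_trans r1.
  case: (Num.truncn r) => // k kr rk _; exists k.+2%:R; first exact: ltW.
  have := @radius_gt _ _ dk0 k e; rewrite ger0_norm//; apply.
  by apply: le_lt_trans re; rewrite lee_fin.
move=> r; have : radius dk y @[y --> (0:R)] --> +oo%E.
  by rewrite -[X in _ --> X](radius0 dk); exact: radius_continuous.
move=> /cvgeyPgt /(_ r) /near_at[s s0 hs].
have m0 : 0 < Num.min (s / 2) eps0 by rewrite lt_min divr_gt0.
exists (Num.min (s / 2) eps0); first by rewrite m0 ge_min lexx orbT.
move=> e; rewrite in_itv/= le_min => /andP[ep /andP[es _]].
rewrite -[e]add0r; apply: hs; rewrite ger0_norm//; apply: le_lt_trans es _.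
by rewrite ltr_pdivrMr// ltr_pMr// ltr1n.
Qed.

(** * The periodic perturbation *)

Section Periodization.
Context {R : realType} {d : nat}.
Implicit Types (G : R -> R -> R -> 'rV[R]_d -> 'rV[R]_d) (x y : 'rV[R]_d).

Definition periodic_field G (e tau : R) x : 'rV[R]_d :=
  let s := tau - (Num.floor tau)%:~R in
  derive1 step s *: G e (e * s) (e * step s) x.

Lemma periodic_fieldD1 G e tau x : periodic_field G e (tau + 1) x = periodic_field G e tau x.
Proof.
rewrite /periodic_field; have -> : Num.floor (tau + 1) = Num.floor tau + 1.
  apply: floor_def; have /andP[h1 h2] := floor_itv tau.
  by rewrite rmorphD/= lerD2r h1 intrD ltrD2r.
by rewrite intrD opprD addrACA subrr addr0.
Qed.

(* The transitions of [step] are flat near the integers, so that the floor in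
   [periodic_field] does not break smoothness. *)
Lemma periodic_fieldE G (n : int) e tau x : - 4^-1 < tau - n%:~R < 5 / 4 ->
  periodic_field G e tau x =
  derive1 step (tau - n%:~R) *: G e (e * (tau - n%:~R)) (e * step (tau - n%:~R)) x.
Proof.
move=> /andP[h1 h2]; have zero s : s < 4^-1 \/ 3 / 4 < s -> forall y, derive1 step s *: y = 0 :> 'rV[R]_d.
  by move=> hs y; rewrite derive1_step_eq0 ?scale0r.
rewrite /periodic_field.
have [t0|t0] := ltP tau n%:~R.
  rewrite (_ : Num.floor tau = n - 1); last by apply: floor_def; rewrite subrK intrD; lra.
  transitivity (0 : 'rV[R]_d); [apply: zero; right|apply/esym/zero; left]; rewrite ?intrD; lra.
have [t1|t1] := ltP tau (n%:~R + 1).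
  by rewrite (_ : Num.floor tau = n)//; apply: floor_def; rewrite intrD; lra.
rewrite (_ : Num.floor tau = n + 1); last by apply: floor_def; rewrite !intrD; lra.
transitivity (0 : 'rV[R]_d); [apply: zero; left|apply/esym/zero; right]; rewrite ?intrD; lra.
Qed.

(** On the window where a fixed integer replaces the floor, [s] may exceed 1 but stays below 5/4;
    this is why analyticity is demanded up to [2 * dl] for step sizes below [dl]. *)
Lemma scaled_time_lt (e s dl : R) : `|e| < dl -> - 4^-1 < s < 5 / 4 ->
  [/\ `|e| < 2 * dl, `|e * s| < 2 * dl & `|e * step s| < 2 * dl].
Proof.
move=> edl /andP[s1 s2]; have dl0 : 0 < dl by exact: le_lt_trans edl.
have edl2 : `|e| < 2 * dl by lra.
split=> //; rewrite normrM.
  apply: (@le_lt_trans _ _ (`|e| * (5 / 4))); last by lra.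
  by rewrite ler_wpM2l// ler_norml; apply/andP; split; lra.
have /andP[q0 q1] := step_itv s; apply: le_lt_trans edl2.
by rewrite ler_piMr// ger0_norm.
Qed.

Section Smoothness.
Variables (G : R -> R -> R -> 'rV[R]_d -> 'rV[R]_d) (x0 : 'rV[R]_d) (dl : R).
Hypothesis Gan : forall a b c x, `|a| < 2 * dl -> `|b| < 2 * dl -> `|c| < 2 * dl ->
  `|x - x0| < 1 -> analv (tcons3 a b c x) (joint3 G).

Let box tau0 (w : 'rV[R]_(1 + (1 + d))) :=
  [/\ `|lsubmx w 0 0| < dl, `|lsubmx (rsubmx w) 0 0 - tau0| < 4^-1 &
      `|rsubmx (rsubmx w) - x0| < 1].

Let field_term (n : int) (i : 'I_d) (w : 'rV[R]_(1 + (1 + d))) :=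
  time_term (fun t => t - n%:~R) (fun t => step (t - n%:~R)) (fun t => derive1 step (t - n%:~R))
    (fun z => joint3 G z 0 i) w.

Let floor_near (tau0 tau : R) : `|tau - tau0| < 4^-1 ->
  - 4^-1 < tau - (Num.floor tau0)%:~R < 5 / 4.
Proof.
by have := floor_itv tau0; rewrite intrD ltr_norml => h1 h2; apply/andP; split; lra.
Qed.

Let field_termE tau0 e tau x : `|tau - tau0| < 4^-1 ->
  periodic_field G e tau x =
  \row_i field_term (Num.floor tau0) i (tcons e (tcons tau x)).
Proof.
move=> tt; rewrite (periodic_fieldE _ _ _ (floor_near tt)); apply/rowP => i.
rewrite [LHS]mxE [RHS]mxE /field_term /time_term /time_arg.
by rewrite !(tcons_lsub, tcons_rsub) joint3E.
Qed.

Let field_arg_anal tau0 i e tau x : `|e| < dl -> `|tau - tau0| < 4^-1 -> `|x - x0| < 1 ->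
  anal (time_arg (fun t => t - (Num.floor tau0)%:~R) (fun t => step (t - (Num.floor tau0)%:~R))
    (tcons e (tcons tau x))) (fun z => joint3 G z 0 i).
Proof.
move=> ed tt xx; rewrite /time_arg !(tcons_lsub, tcons_rsub).
by have [h1 h2 h3] := scaled_time_lt ed (floor_near tt); exact: Gan.
Qed.

(** Within 1/4 of [tau0] the integer [floor tau0] can be used throughout, so each component of the
    field is locally a single [time_term], free of the floor. *)
Lemma periodic_field_Ck (e0 tau0 : R) : `|e0| < dl -> exists U (F : 'rV[R]_(1 + (1 + d)) -> 'rV[R]_d),
  [/\ open U, U (tcons e0 (tcons tau0 x0)), (forall k, Ck k U F) &
      forall w, U w -> joint (fun e => joint (periodic_field G e)) w = F w].
Proof.
move=> e0d; exists (interior (box tau0)), (fun w => \row_i field_term (Num.floor tau0) i w).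
split; first exact: open_interior.
- rewrite /interior /=.
  have : \forall w \near tcons e0 (tcons tau0 x0), box tau0 w; last by [].
  apply/near_tcons; exists (Num.min (dl - `|e0|) 4^-1).
    by rewrite lt_min subr_gt0 e0d /= invr_gt0.
  move=> e y; rewrite !lt_min => /andP[e1 _] /andP[_ yd].
  rewrite (tconsE y) tconsB tcons_norm_lt in yd; case/andP: yd => y1 y2.
  rewrite /box tcons_rsub tcons_lsub; split=> //.
    by rewrite -(subrK e0 e); apply: le_lt_trans (ler_normD _ _) _; rewrite -ltrBrDr.
  by apply: lt_trans y2 _; rewrite invf_lt1// ltr1n.
- move=> k; apply: Ck_row; first exact: open_interior.
  move=> i; apply: time_term_Ck.
  + exact: smooth_idB.
  + exact: smooth_shift smooth_step.
  + exact: open_interior.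
  + exact: smooth_shift (smooth_derive1 smooth_step).
  + move=> w /interior_subset[h1 h2 h3].
    by rewrite (tconsE w) (tconsE (rsubmx w)); exact: field_arg_anal.
move=> w /interior_subset[h1 h2 h3].
by rewrite (tconsE w) (tconsE (rsubmx w)) !jointE (field_termE _ _ h2).
Qed.

Lemma periodic_field_anal k tau e0 : `|e0| < dl ->
  exists2 F, analv (tcons e0 x0) F & \forall z \near tcons e0 x0,
    joint (fun e x => derive1n k (fun s => periodic_field G e s x) tau) z = F z.
Proof.
move=> e0d; pose n := Num.floor tau.
pose s (t : R) := t - n%:~R; pose c (t : R) := step (t - n%:~R).
have ss : smooth s by exact: smooth_idB.
have cs : smooth c by exact: smooth_shift smooth_step.
pose l (i : 'I_d) : seq (@term R d) := [:: (fun t => derive1 step (t - n%:~R), fun z => joint3 G z 0 i)].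
have gl e t x i : `|e| < dl -> `|t - tau| < 4^-1 -> `|x - x0| < 1 ->
    good_terms (time_arg s c (tcons e (tcons t x))) (l i).
  move=> ed tt xx; split=> //; first exact: smooth_shift (smooth_derive1 smooth_step).
  exact: field_arg_anal.
have tau0 : `|tau - tau| < 4^-1 by rewrite subrr normr0 invr_gt0.
exists (fun z => \row_i time_sum s c (iter k (tau_terms s c) (l i))
    (tcons (lsubmx z 0 0) (tcons tau (rsubmx z)))).
  move=> i; under eq_fun do rewrite mxE; apply: time_sum_anal.
  have : good_terms (time_arg s c (tcons e0 (tcons tau x0))) (l i).
    by apply: gl; rewrite // subrr normr0.
  by move=> g; elim: k => //= k; exact: good_tau_terms.
apply/near_tcons; exists (Num.min (dl - `|e0|) 1); first by rewrite lt_min subr_gt0 e0d ltr01.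
move=> e x; rewrite !lt_min => /andP[e1 _] /andP[_ x1].
have ed : `|e| < dl by rewrite -(subrK e0 e); apply: le_lt_trans (ler_normD _ _) _; rewrite -ltrBrDr.
rewrite jointE tcons_lsub tcons_rsub.
apply: (@derive1n_time_sum R d s c ss cs d _ l e x (ball tau 4^-1)).
- exact: ball_open.
- move=> t; rewrite /ball/= distrC => tt; rewrite (field_termE _ _ tt).
  by apply/rowP => i; rewrite [LHS]mxE [RHS]mxE /time_sum big_seq1.
- by move=> t i; rewrite /ball/= distrC => tt; exact: gl.
- exact: ballxx.
Qed.

End Smoothness.

End Periodization.

Lemma derive1_step_bounded (R : realType) : exists2 C, 0 <= C & forall x : R, `|derive1 step x| <= C.
Proof.
have [|c _ h] := @EVT_max R (fun u => `|derive1 step u|) 0 1 ler01.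
  move=> t; apply: cvg_norm; apply: continuous_subspaceT => u.
  exact: smooth_continuous (smooth_derive1 smooth_step).
exists `|derive1 step c|; first exact: normr_ge0.
move=> x.
have [x0|x0] := ltP x 4^-1; first by rewrite derive1_step_eq0 ?normr0//; left.
have [x1|x1] := ltP (3 / 4) x; first by rewrite derive1_step_eq0 ?normr0//; right.
by apply: h; rewrite in_itv/=; apply/andP; split; lra.
Qed.

(** * Uniform step sizes and the evolution of the perturbed equation *)

Section Assembly.
Context {R : realType} {d : nat}.
Variables (f : 'rV[R]_d -> 'rV[R]_d) (Phi : R -> 'rV[R]_d -> 'rV[R]_d) (p : nat) (e0 : R).
Hypothesis fan : forall x, analv x f.
Hypothesis Phian : forall x, analv (tcons 0 x) (joint Phi).
Hypothesis e0_gt0 : 0 < e0.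
Hypothesis Phierr : forall r, exists C, forall (e : R) z w, `|e| <= e0 -> `|z| <= r ->
  evolves (fun=> f) setT 0 e z w -> `|Phi e z - w| <= C * `|e| ^+ p.+1.

Local Notation gen := (generator f Phi p).

Definition perturbation : R -> R -> 'rV[R]_d -> 'rV[R]_d := periodic_field gen.

Definition perturbed_field (e t : R) (x : 'rV[R]_d) : 'rV[R]_d :=
  f x + e ^+ p *: perturbation e (t / e) x.

Lemma perturbed_fieldE e t x : 0 <= t <= e -> 0 < e ->
  perturbed_field e t x =
  f x + e ^+ p *: (derive1 step (t / e) *: gen e t (e * step (t / e)) x).
Proof.
move=> /andP[t0 te] ep; rewrite /perturbed_field /perturbation.
have q0 : 0 <= t / e by rewrite divr_ge0// ltW.
have q1 : t / e <= 1 by rewrite ler_pdivrMr// mul1r.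
have te0 : t / e - (0 : int)%:~R = t / e by rewrite mulr0z subr0.
have te_itv : - 4^-1 < t / e - (0 : int)%:~R < 5 / 4.
  by rewrite te0; apply/andP; split; lra.
have ete : e * (t / e) = t by rewrite mulrCA divff ?gt_eqF// mulr1.
by rewrite (periodic_fieldE gen e x te_itv) te0 ete.
Qed.

Definition interpolates (e : R) (xi : 'rV[R]_d) (X : R -> 'rV[R]_d) : Prop :=
  [/\ X 0 = xi, X e = Phi e xi &
    forall t : R, 0 <= t <= e -> `|X t| <= `|xi| + 1 /\ is_derive t 1 X (perturbed_field e t (X t))].

(** One step size per ball, by [uniform_on_balls]. The ball of radius [r + 1] leaves room for the
    interpolating curve, whose norm exceeds [|xi|] by at most 1, and for the unit neighbourhoods in
    which the regularity of the periodic field is derived. *)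
Lemma uniform_step_size r : exists2 delta, 0 < delta & exists K, [/\
  forall a b c x, `|a| < 2 * delta -> `|b| < 2 * delta -> `|c| < 2 * delta -> `|x| <= r + 1 ->
    analv (tcons3 a b c x) (joint3 gen),
  forall a b c x y, `|a| < delta -> `|b| < delta -> `|c| < delta ->
    `|x| <= r + 1 -> `|y| <= r + 1 -> `|gen a b c x - gen a b c y| <= K * `|x - y| &
  forall e xi, 0 < e < delta -> `|xi| <= r + 1 -> exists X, interpolates e xi X].
Proof.
have gan := generator_anal fan Phian e0_gt0 Phierr.
pose P (delta : R) (x : 'rV[R]_d) :=
  (forall a b c, `|a| < 2 * delta -> `|b| < 2 * delta -> `|c| < 2 * delta ->
     analv (tcons3 a b c x) (joint3 gen)) /\
  (forall e, 0 < e < delta -> exists X, interpolates e x X).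
have [||d1 d10 h1] := @uniform_on_balls R d P _ _ (r + 1).
- move=> x s t t0 ts [p1 p2]; have ts2 : 2 * t <= 2 * s by rewrite ler_pM2l.
  split=> [a b c at_ bt ct|e /andP[ep et]].
    by apply: p1; [exact: lt_le_trans at_ ts2|exact: lt_le_trans bt ts2|exact: lt_le_trans ct ts2].
  by apply: p2; rewrite ep; exact: lt_le_trans et ts.
- move=> x; have /near_tcons3[s s0 hs] := analv_near (gan x).
  have [||s' s'0 hs'] := interpolation_local fan Phian e0_gt0 Phierr x
    (fun tau => smooth_is_derive tau smooth_step) step_itv.
  + by apply: step_eq0; rewrite invr_ge0.
  + by apply: step_eq1; rewrite ler_pdivrMr// mul1r ler_nat.
  have [m [m0 ms ms']] : exists m, [/\ 0 < m, 2 * m <= s & m <= s'].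
    exists (Num.min (s / 2) s'); rewrite lt_min divr_gt0// s'0; split=> //.
      by rewrite -ler_pdivlMl// mulrC ge_min lexx.
    by rewrite ge_min lexx orbT.
  exists m => // y yx; split=> [a b c at_ bt ct|e /andP[ep em]].
    apply: hs; first exact: lt_le_trans at_ ms.
    - exact: lt_le_trans bt ms.
    - exact: lt_le_trans ct ms.
    - by apply: lt_le_trans yx (le_trans _ ms); lra.
  have [||X0 Xe Xt] := hs' e y; first by rewrite ep (lt_le_trans em).
    exact: lt_le_trans yx ms'.
  exists (fun t : R => flow f t (y + (e * step (t / e)) *: shift_field f Phi p e y)).
  split; [exact: X0|exact: Xe|move=> t te].
  have [Xb dX] := Xt t te; split; first exact: Xb.
  by rewrite (perturbed_fieldE _ te ep); exact: dX.
have [d2 [K [d20 h2]]] := uniform_lipschitz gan (r + 1).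
have m0 : 0 < Num.min d1 d2 by rewrite lt_min d10.
have m1 : Num.min d1 d2 <= d1 by rewrite ge_min lexx.
have m2 : Num.min d1 d2 <= d2 by rewrite ge_min lexx orbT.
exists (Num.min d1 d2) => //; exists K; split.
- move=> a b c x ad bd cd xr; have [+ _] := h1 x xr; apply; apply: lt_le_trans.
  + exact: ad. + by rewrite ler_pM2l.
  + exact: bd. + by rewrite ler_pM2l.
  + exact: cd. + by rewrite ler_pM2l.
- move=> a b c x y ad bd cd; apply: h2; apply: lt_le_trans m2 => //.
- move=> e xi /andP[ep ed] xr; have [_] := h1 xi xr; apply.
  by rewrite ep (lt_le_trans ed).
Qed.

(** Both curves solve the perturbed equation, whose field is Lipschitz on the ball of radius [r + 1]
    uniformly in time: [Kf] accounts for [f] and [e ^+ p * (C * K)] for the perturbation, [C] being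
    a bound on the derivative of [step]. *)
Lemma interpolates_unique r e delta K xi (X Y : R -> 'rV[R]_d) : 0 < e < delta ->
  (forall a b c x y, `|a| < delta -> `|b| < delta -> `|c| < delta ->
    `|x| <= r + 1 -> `|y| <= r + 1 -> `|gen a b c x - gen a b c y| <= K * `|x - y|) ->
  interpolates e xi X -> Y 0 = xi -> {within `[0, e], continuous Y} ->
  (forall u : R, u \in `]0, e[ -> is_derive u 1 Y (perturbed_field e u (Y u))) ->
  (forall u, u \in `[0, e] -> `|Y u| <= r) -> Y e = Phi e xi.
Proof.
move=> /andP[ep ed] gl [X0 Xe Xt] Y0 cY dY Yr.
have [Kf hf] := field_lipschitz fan (r + 1).
have [C C0 hC] := derive1_step_bounded R.
have r1 : r <= r + 1 by rewrite lerDl.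
have xir : `|xi| <= r by rewrite -Y0; apply: Yr; rewrite in_itv/= lexx ltW.
have Xc : {within `[0, e], continuous X}.
  apply: continuous_in_subspaceT => u /set_mem; rewrite /= in_itv/= => ue.
  by apply: differentiable_continuous; rewrite -derivable1_diffP; have [_ []] := Xt u ue.
have := @ode_unique R d 0 e (Kf + e ^+ p * (C * K)) Y X
  (fun u => perturbed_field e u (Y u)) (fun u => perturbed_field e u (X u)) (ltW ep) cY Xc dY.
case.
- by move=> u /subset_itv_oo_cc; rewrite in_itv/= => ue; have [] := Xt u ue.
- move=> u /subset_itv_oo_cc uc; have Yu := le_trans (Yr u uc) r1.
  move: uc; rewrite in_itv/= => ue.
  have Xu : `|X u| <= r + 1 by have [h _] := Xt u ue; apply: le_trans h _; rewrite lerD2r.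
  rewrite !perturbed_fieldE// opprD addrACA -scalerBr -scalerBr.
  apply: le_trans (ler_normD _ _) _; rewrite mulrDl; apply: lerD; first exact: hf.
  rewrite normrZ normrX (gtr0_norm ep) -!mulrA ler_wpM2l ?exprn_ge0 ?(ltW ep)//.
  rewrite normrZ; apply: ler_pM => //.
  have /andP[u0 ue'] := ue; have eabs : `|e| < delta by rewrite gtr0_norm.
  apply: gl => //; first by rewrite ger0_norm// (le_lt_trans ue').
  have /andP[q0 q1] := step_itv (u / e); apply: le_lt_trans eabs.
  by rewrite normrM ler_piMr// ger0_norm.
by move=> h _; rewrite h ?Xe// X0.
Qed.

Lemma interpolation_evolution : exists (eps0 : R) (rho : R -> \bar R),
  let Om e := [set xi : 'rV[R]_d | (`|xi|%:E < rho e)%E] in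
    [/\ 0 < eps0 <= e0,
        [/\ {within `[0, eps0], continuous rho},
            {in `[0, eps0] &, {homo rho : a b / a <= b >-> (b <= a)%E}},
            (forall e, e \in `[0, eps0] -> (0 <= rho e)%E) &
            rho 0 = +oo%E],
        smooth_on [set z | lsubmx z 0 0 \in `[0, eps0] /\ Om (lsubmx z 0 0) (rsubmx (rsubmx z))]
              (joint (fun e => joint (perturbation e))) /\
            (forall (k : nat) (tau : R),
               analytic_on [set z | lsubmx z 0 0 \in `[0, eps0] /\ Om (lsubmx z 0 0) (rsubmx z)]
                 (joint (fun e xi => derive1n k (fun s => perturbation e s xi) tau))),
        (forall e xi eta, e \in `[0, eps0] ->
           evolves (perturbed_field e) (Om e) 0 e xi eta -> eta = Phi e xi) &
        forall r : R, exists2 d : R, 0 < d <= eps0 &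
          forall e xi, e \in `[0, d] -> `|xi| <= r ->
            evolves (perturbed_field e) (Om e) 0 e xi (Phi e xi)].
Proof.
have hd r : exists delta, 0 < delta /\ _ :=
  let: ex_intro2 x h1 h2 := uniform_step_size r in ex_intro _ x (conj h1 h2).
have [delta hdelta] := choice hd.
have [eps0 [rho [eps0e rhoP rho_delta rho_large]]] :=
  admissible_radius e0_gt0 (fun r => (hdelta r).1).
have an (e : R) (x : 'rV[R]_d) : e \in `[0, eps0] -> (`|x|%:E < rho e)%E -> exists2 dl, `|e| < dl &
    forall a b c y, `|a| < 2 * dl -> `|b| < 2 * dl -> `|c| < 2 * dl ->
    `|y - x| < 1 -> analv (tcons3 a b c y) (joint3 gen).
  move=> ee xe; have [r xr er] := rho_delta e `|x| ee xe.
  have [_ [K [ga _ _]]] := hdelta r.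
  move: ee; rewrite in_itv/= => /andP[ep _].
  exists (delta r) => [|a b c y ad bd cd yx]; first by rewrite ger0_norm.
  apply: ga => //; rewrite -(subrK x y) addrC; apply: le_trans (ler_normD _ _) _.
  by apply: lerD xr (ltW yx).
exists eps0, rho; split=> //; first split.
- move=> z [ze zx]; have [dl edl ga] := an _ _ ze zx.
  have [U [F [oU Uz CF EF]]] := periodic_field_Ck ga (lsubmx (rsubmx z) 0 0) edl.
  rewrite -!tconsE in Uz; exists U, F; split=> // w Uw _; exact: EF.
- move=> k tau; apply: anal_analytic_on => z [ze zx]; have [dl edl ga] := an _ _ ze zx.
  have [F] := periodic_field_anal ga k tau edl; rewrite -tconsE => Fan Fn.
  by exists F => //; apply: filterS Fn => w h _.
- move=> e xi eta ee [Y [Y0 Ye cY dY OmY]].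
  have /andP[ep _] : 0 <= e <= eps0 by rewrite in_itv/= in ee.
  rewrite min_l// max_r// in cY dY OmY.
  (* At [e = 0] the time interval is a single point, on which no differential equation is imposed,
     and [Phi 0] is the identity. *)
  have [e00|en0] := eqVneq e 0.
    by rewrite -Ye -Y0 e00 (Phi0 fan e0_gt0 Phierr).
  have ep' : 0 < e by rewrite lt_def en0.
  (* The maximum of [|Y|] is attained, hence lies strictly below [rho e]; this selects a ball that
     contains the whole curve and whose step size exceeds [e]. *)
  have [c ce hc] := EVT_max (ltW ep') (fun t => cvg_norm (cY t)).
  have [r cr er] := rho_delta e `|Y c| ee (OmY c ce).
  have [_ [K [_ gl ex]]] := hdelta r.
  have Yr u : u \in `[0, e] -> `|Y u| <= r by move=> ue; exact: le_trans (hc u ue) cr.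
  have ed : 0 < e < delta r by rewrite ep'.
  have [|X hX] := ex e xi ed.
    by rewrite -Y0; apply: (@le_trans _ _ r); [apply: Yr; rewrite in_itv/= lexx|rewrite lerDl].
  by rewrite -Ye; exact: (interpolates_unique ed gl hX Y0 cY dY Yr).
(* The margin 1 keeps the whole interpolating curve in the domain, not only its starting point. *)
move=> r; have [s /andP[s0 seps] hs] := rho_large (r + 1).
exists s; rewrite ?s0// => e xi es xir.
have ee : e \in `[0, eps0].
  by move: es; rewrite !in_itv/= => /andP[-> /le_trans]; apply.
have re := hs e es; have /andP[ep _] : 0 <= e <= eps0 by rewrite in_itv/= in ee.
have Omr (y : 'rV[R]_d) : `|y| <= r + 1 -> (`|y|%:E < rho e)%E.
  by move=> yr; apply: le_lt_trans re; rewrite lee_fin.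
have [e00|en0] := eqVneq e 0.
  have Om0 : (`|xi|%:E < rho 0%R)%E by rewrite -e00; apply: Omr; rewrite (le_trans xir)// lerDl.
  rewrite e00; exists (fun=> xi); split=> //; first by rewrite (Phi0 fan e0_gt0 Phierr).
  - exact: cst_continuous.
  - by move=> u; rewrite in_itv/= minxx maxxx => /andP[/lt_trans h /h]; rewrite ltxx.
have ep' : 0 < e by rewrite lt_def en0.
have [r' rr' er'] := rho_delta e _ ee re.
have [_ [K [_ _ ex]]] := hdelta r'.
have [||X [X0 Xe Xt]] := ex e xi; first by rewrite ep'.
  apply: le_trans xir _; apply: le_trans (_ : r + 1 <= _); first by rewrite lerDl.
  by rewrite (le_trans rr')// lerDl.
rewrite -[X in evolves _ _ _ _ X]X0 -Xe; apply: evolvesI => u.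
rewrite min_l// max_r// in_itv/= => ue; have [Xb dX] := Xt u ue; split=> //.
by apply: Omr; rewrite (le_trans Xb)// lerD2r.
Qed.

End Assembly.

Theorem corollary4p1 (R : realType) (n m p : nat)
    (L : 'rV[R]_(n + n) -> R) (mu : 'rV[R]_n -> 'M[R]_(m, n))
    (psi : 'rV[R]_(n + n - m) -> 'rV[R]_(n + n))
    (P : 'rV[R]_(n + n - m) -> 'M[R]_(n + n, n + n - m))
    (e0 : R) (Phi : R -> 'rV[R]_(n + n - m) -> 'rV[R]_(n + n - m)) :
  mechanical L ->
  constraints mu ->
  coordinate_map (constraint_set mu) psi ->
  jacobian_left_inverse psi P ->
  analytic_on setT (nonholonomic_rhs L mu psi P) ->
  discretization p (nonholonomic_rhs L mu psi P) e0 Phi ->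
  exists (eps0 : R) (rho : R -> \bar R)
         (g : R -> R -> 'rV[R]_(n + n - m) -> 'rV[R]_(n + n - m)),
    let Om e := [set xi : 'rV[R]_(n + n - m) | (`|xi|%:E < rho e)%E] in
    let perturbed e t xi :=
      nonholonomic_rhs L mu psi P xi + e ^+ p *: g e (t / e) xi in
    [/\ 0 < eps0 <= e0,
        [/\ {within `[0, eps0], continuous rho},
            {in `[0, eps0] &, {homo rho : a b / a <= b >-> (b <= a)%E}},
            (forall e, e \in `[0, eps0] -> (0 <= rho e)%E) &
            rho 0 = +oo%E],
        [/\ smooth_on
              [set z | lsubmx z 0 0 \in `[0, eps0] /\
                       Om (lsubmx z 0 0) (rsubmx (rsubmx z))]
              (joint (fun e => joint (g e))),
            (forall (k : nat) (tau : R),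
               analytic_on
                 [set z | lsubmx z 0 0 \in `[0, eps0] /\
                          Om (lsubmx z 0 0) (rsubmx z)]
                 (joint (fun e xi => derive1n k (fun s => g e s xi) tau))) &
            forall e tau xi, e \in `[0, eps0] -> Om e xi ->
              g e (tau + 1) xi = g e tau xi],
        (forall e xi eta, e \in `[0, eps0] ->
           evolves (perturbed e) (Om e) 0 e xi eta -> eta = Phi e xi) &
        forall r : R, exists2 d : R, 0 < d <= eps0 &
          forall e xi, e \in `[0, d] -> `|xi| <= r ->
            evolves (perturbed e) (Om e) 0 e xi (Phi e xi)].
Proof.
pose f := nonholonomic_rhs L mu psi P; move=> _ _ _ _ _ [_ fa e00 _ Pa [C [_ Cinc _ Cerr]]].
have fan x : analv x f by apply: (analytic_on_anal fa) => //; exact: filterE.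
have Phian x : analv (tcons 0 x) (joint Phi).
  (* [Phi] is analytic on a closed strip around [e = 0]; the points with [e = 0] are interior to it
     because [0 < e0]. *)
  apply: (analytic_on_anal Pa); first by rewrite /= tcons_lsub normr0 ltW.
  apply/near_tcons; exists e0 => // s y; rewrite subr0 /= tcons_lsub.
  by move=> /ltW.
have Phierr r : exists C, forall (e : R) z w, `|e| <= e0 -> `|z| <= r ->
    evolves (fun=> f) setT 0 e z w -> `|Phi e z - w| <= C * `|e| ^+ p.+1.
  (* Monotonicity of [C] makes the error bound uniform on balls; being stated strictly, it leaves
     [|z| = r] as a separate case. *)
  exists (C r) => e z w ee zr ev; apply: le_trans (Cerr e z w ee ev) _.
  rewrite ler_wpM2r ?exprn_ge0//; move: zr; rewrite le_eqVlt => /orP[/eqP <-//|zr].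
  apply: ltW; apply: Cinc => //; rewrite in_itv/= andbT//.
  exact: le_trans (ltW zr).
have [eps0 [rho [h1 h2 [h3 h4] h5 h6]]] := interpolation_evolution fan Phian e00 Phierr.
exists eps0, rho, (perturbation f Phi p).
split; [exact: h1|exact: h2|split; [exact: h3|exact: h4|]|exact: h5|exact: h6].
by move=> e tau xi _ _; exact: periodic_fieldD1.
Qed.
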